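(* Let $f\in M_k(\Gamma_g)$. If the restriction of $f$ along $\mathfrak H_1\times\mathfrak H_{g-1}$ vanishes to order $r$ and not to higher order (i.e. $t_i(f)=0$ for $i<r$ and $t_r(f)\neq 0$ in the development of $f$ along $\mathfrak H_1\times\mathfrak H_{g-1}$), then the lowest order terms of $f$ along $\mathfrak H_1\times\mathfrak H_{g-1}$ define a non-vanishing element $f'\otimes f''\in M_{k'}(\Gamma_1)\otimes M_{k''}(\Gamma_{g-1})$, where the weight $k'$ of $f'$ equals $k+r$ and the weight $k''$ of $f''$ equals $(r,0,\ldots,0,k)$ (a vector of length $g-1$).
   Context: Here $g\ge 2$. $\Gamma_g=\mathrm{Sp}(2g,\mathbb Z)$ acts on the Siegel upper half space $\mathfrak H_g$ by $\tau\mapsto(a\tau+b)(c\tau+d)^{-1}$. $M_k(\Gamma_g)$ is the space of holomorphic $f:\mathfrak H_g\to\mathbb C$ with $f((a\tau+b)(c\tau+d)^{-1})=\det(c\tau+d)^k f(\tau)$ (and holomorphic at infinity if $g=1$). For a finite-dimensional complex representation $\rho:\mathrm{GL}_g\to\mathrm{GL}(V)$, $M_\rho(\Gamma_g)$ is the space of holomorphic $f:\mathfrak H_g\to V$ with $f((a\tau+b)(c\tau+d)^{-1})=\rho(c\tau+d)f(\tau)$. If $\rho$ is irreducible of highest weight $(a_1\ge\dots\ge a_g)$ one writes $M_{\mathbf k}(\Gamma_g)$ with $\mathbf k=(a_1-a_2,\dots,a_{g-1}-a_g,a_g)$. Thus weight $(r,0,\ldots,0,k)$ means $\mathrm{Sym}^r(\mathbb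 C^g)\otimes\det^k$; in degree $1$ it is read as weight $k+r$. Development along $\mathfrak H_1\times\mathfrak H_{g-1}$: write $\tau=\begin{pmatrix}\tau'&z\\ z^t&\tau''\end{pmatrix}\in\mathfrak H_g$ with $\tau'\in\mathfrak H_1$, $\tau''\in\mathfrak H_{g-1}$, and expand $f=t_0(f)+t_1(f)+t_2(f)+\cdots$ as a Taylor series in the entries of $z$ around $z=0$, where $t_r(f)$ is the part homogeneous of degree $r$ in these entries, with coefficients holomorphic in $(\tau',\tau'')$. Let $V_1=\mathbb C$, $V_{g-1}=\mathbb C^{g-1}$ be the standard representations of $\mathrm{GL}_1$, $\mathrm{GL}_{g-1}$ with standard bases $(e_1)$, $(f_b)$. Identifying $z_{1b}$ with $e_1\otimes f_b$, $t_r(f)$ becomes a function on $\mathfrak H_1\times\mathfrak H_{g-1}$ with values in $\mathrm{Sym}^r(V_1\otimes V_{g-1})\cong V_1^{\otimes r}\otimes\mathrm{Sym}^r(V_{g-1})$; this is how the lowest order term is viewed in the tensor product of spaces of modular forms.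
   Formalization: ''Element f'⊗f'''' is read as a nonzero element of the tensor product, i.e. a finite sum of pure tensors; a single pure tensor fails in general, e.g. g=2, k=12, r=0, f=E_4^3+E_6^2 restricts to E_4^3⊗E_4^3+E_6^2⊗E_6^2, of rank 2. *)

(* Defs.v *)
From HB Require Import structures.
From mathcomp Require Import all_boot all_order all_algebra.
From mathcomp Require Import all_classical all_reals all_analysis.
From mathcomp Require Import complex.
(* The notations of mpoly clash with those of mathcomp-analysis. *)
From mathcomp Require Export -(notations) mpoly.
Import Order.TTheory GRing.Theory Num.Theory.
Import numFieldNormedType.Exports.

Set Implicit Arguments.
Unset Strict Implicit.
Unset Printing Implicit Defensive.

Local Open Scope classical_set_scope.
Local Open Scope ring_scope.
Local Open Scope complex_scope.

Section SiegelModularForms.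
Context {R : realType}.
Local Notation C := R[i].

Definition posdef (g : nat) (Y : 'M[R]_g) : Prop :=
  forall v : 'rV[R]_g, v != 0 -> 0 < (v *m Y *m v^T) 0 0.

Definition siegel (g : nat) : set 'M[C]_g :=
  [set tau | tau^T = tau /\ posdef (map_mx (@complex.Im R) tau)].

Definition std_symplectic (g : nat) : 'M[int]_(g + g) :=
  block_mx 0 1%:M (- 1%:M) 0.

Definition symplectic (g : nat) : set 'M[int]_(g + g) :=
  [set M | M^T *m std_symplectic g *m M = std_symplectic g].

Definition intC (g : nat) (A : 'M[int]_g) : 'M[C]_g := map_mx intr A.

(* c tau + d *)
Definition autom_factor (g : nat) (M : 'M[int]_(g + g)) (tau : 'M[C]_g) :
    'M[C]_g :=
  intC (dlsubmx M) *m tau + intC (drsubmx M).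

Definition siegel_act (g : nat) (M : 'M[int]_(g + g)) (tau : 'M[C]_g) :
    'M[C]_g :=
  (intC (ulsubmx M) *m tau + intC (ursubmx M)) *m invmx (autom_factor M tau).

Definition sym_part (g : nat) (w : 'M[C]_g) : 'M[C]_g := 2^-1 *: (w + w^T).

Definition coordinate (V : vectType C) (i : 'I_(\dim {:V})) (v : V) : C^o :=
  coord (vbasis {:V}) i v.

(* Forms are total functions on matrices of which only the values on
   the Siegel space matter. That space is open in the space of symmetric
   matrices, onto which sym_part is the linear projection: the condition is
   complex differentiability of f as a function of the symmetric matrix tau. *)
Definition holomorphic_siegel (g : nat) (V : vectType C) (f : 'M[C]_g -> V) :
    Prop :=
  forall tau : ('M[C]_g : normedModType C), siegel tau -> forall i,
    differentiable (fun w : 'M[C]_g => coordinate i (f (sym_part w))) tau.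

(* exp (2 pi i t) *)
Definition nome (t : C) : C :=
  let x := 2 * pi * complex.Re t in
  let y := 2 * pi * complex.Im t in
  (expR (- y) * cos x) +i* (expR (- y) * sin x).

(* Only used for g = 1, where t%:M is the general 1 x 1 matrix: as a function
   of q = exp (2 pi i tau), f extends holomorphically to the whole disc. *)
Definition holomorphic_at_infinity (g : nat) (V : vectType C)
    (f : 'M[C]_g -> V) : Prop :=
  exists F : C^o -> V,
    (forall q : C^o, `|q| < 1 ->
       forall i, differentiable (fun x : C^o => coordinate i (F x)) q) /\
    (forall t : C, 0 < complex.Im t -> f t%:M = F (nome t)).

(* M_rho(Gamma_g) *)
Definition siegel_form (g : nat) (V : vectType C) (rho : 'M[C]_g -> V -> V) :
    set ('M[C]_g -> V) :=
  [set f | [/\ holomorphic_siegel f,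
    (forall M tau, symplectic M -> siegel tau ->
       f (siegel_act M tau) = rho (autom_factor M tau) (f tau)) &
    (g = 1%N -> holomorphic_at_infinity f)]].

Definition det_rep (g : nat) (k : int) (A : 'M[C]_g) (v : C^o) : C^o :=
  (\det A) ^ k *: v.

(* Sym^r(C^n) is the space of homogeneous polynomials of degree r in the
   standard basis 'X_0, ..., 'X_(n-1) of C^n, and A maps the basis vector 'X_b
   to the b-th column of A. *)
Definition std_image (n : nat) (A : 'M[C]_n) : n.-tuple (mpoly n C) :=
  [tuple \sum_(a < n) A a b *: mpolyX C (mnm1 a) | b < n].

Lemma sym_subst_homog (n r : nat) (A : 'M[C]_n) (p : dhomog n C r) :
  comp_mpoly (std_image A) p \is ishomog1 r mdeg.
Proof.
rewrite comp_mpolyE big_seq rpred_sum// => m mp; rewrite rpredZ//.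
have <- : mdeg m = r by exact: (dhomog_mf (dhomog_is_dhomog p)).
rewrite mdegE.
have lin b : tnth (std_image A) b \is ishomog1 1 mdeg.
  rewrite tnth_mktuple rpred_sum// => a _.
  by rewrite rpredZ// dhomogX/= mdeg1.
elim/big_rec2: _ => [|b d q _ hq]; first exact: dhomog1.
by apply: dhomogM => //; have := dhomogMn (m b) (lin b); rewrite mul1n.
Qed.

Definition sym_det_rep (n r : nat) (k : int) (A : 'M[C]_n) (p : dhomog n C r) :
    dhomog n C r :=
  (\det A) ^ k *: DHomog (sym_subst_homog A p).

Definition partial (n : nat) (m : multinom n) (F : 'rV[C]_n -> C^o) :
    'rV[C]_n -> C^o :=
  foldr (fun b G => iter (m b) (fun H z => 'D_(delta_mx 0 b) H z) G)
        F (enum 'I_n).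

Definition block_tau (n : nat) (tau1 : 'M[C]_1) (z : 'rV[C]_n)
    (tau2 : 'M[C]_n) : 'M[C]_(1 + n) :=
  block_mx tau1 z z^T tau2.

Definition taylor_coeff (n : nat) (f : 'M[C]_(1 + n) -> C^o) (m : multinom n)
    (tau1 : 'M[C]_1) (tau2 : 'M[C]_n) : C :=
  (\prod_(b < n) (m b)`!%:R)^-1 * partial m (fun z => f (block_tau tau1 z tau2)) 0.

Definition taylor_poly (n r : nat) (f : 'M[C]_(1 + n) -> C^o)
    (tau1 : 'M[C]_1) (tau2 : 'M[C]_n) : mpoly n C :=
  \sum_(m : bmultinom n r.+1 | mdeg m == r)
    taylor_coeff f m tau1 tau2 *: mpolyX C m.

Lemma taylor_poly_homog (n r : nat) (f : 'M[C]_(1 + n) -> C^o)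
    (tau1 : 'M[C]_1) (tau2 : 'M[C]_n) :
  taylor_poly r f tau1 tau2 \is ishomog1 r mdeg.
Proof. by rewrite rpred_sum// => m mr; rewrite rpredZ// dhomogX. Qed.

(* t_r(f), with z_b identified with the basis vector 'X_b *)
Definition taylor_part (n r : nat) (f : 'M[C]_(1 + n) -> C^o)
    (tau1 : 'M[C]_1) (tau2 : 'M[C]_n) : dhomog n C r :=
  DHomog (taylor_poly_homog r f tau1 tau2).

Definition lin_indep_on (T : Type) (V : lmodType C) (D : set T) (N : nat)
    (F : 'I_N -> T -> V) : Prop :=
  forall c : 'I_N -> C,
    (forall x, D x -> \sum_(i < N) c i *: F i x = 0) -> forall i, c i = 0.

(* The tensor product of two spaces of functions embeds into the functions of
   two variables. Every element is a sum of N pure tensors with both families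
   of factors linearly independent, and it is nonzero exactly when N > 0. *)
Definition nonzero_tensor (g1 g2 : nat) (V : vectType C)
    (M1 : set ('M[C]_g1 -> C^o)) (M2 : set ('M[C]_g2 -> V))
    (F : 'M[C]_g1 -> 'M[C]_g2 -> V) : Prop :=
  exists (N : nat) (f1 : 'I_N -> 'M[C]_g1 -> C^o) (f2 : 'I_N -> 'M[C]_g2 -> V),
    [/\ (0 < N)%N,
        forall i, M1 (f1 i) /\ M2 (f2 i),
        lin_indep_on (@siegel g1) f1,
        lin_indep_on (@siegel g2) f2 &
        forall tau1 tau2, siegel tau1 -> siegel tau2 ->
          F tau1 tau2 = \sum_(i < N) (f1 i tau1 : C) *: f2 i tau2].

End SiegelModularForms.

(* Main.v *)
From HB Require Import structures.
Require Import Defs.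
From mathcomp Require Import all_boot all_order all_algebra.
From mathcomp Require Import all_classical all_reals all_analysis.
From mathcomp Require Import complex.
From mathcomp Require Import ring lra zify.
Import Order.TTheory GRing.Theory Num.Theory.
Import numFieldNormedType.Exports.

(* Two kinds of elements of Gamma_g, coming from Gamma_1 and from Gamma_(g-1), transform the
   off-diagonal block z linearly and move the diagonal blocks only by terms quadratic in z.
   Dividing the transformation law of f at (tau', s z, tau'') by s ^ r and letting s tend to 0
   shows that t_r(f) has weight k + r in tau' and Sym^r (x) det^k in tau''.

   Holomorphy at infinity is a form of the Koecher principle.  On the horosphere
   Im tau' - Im z (Im tau'')^-1 (Im z)^t = 1, with tau'' fixed, f is bounded because the
   translations and the unipotent elements z |-> z + lambda tau'' act cocompactly.  For Im tau'
   large, Cauchy's formula in the first coordinate of z, in a periodic strip between two points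
   of the horosphere, bounds f near z = 0, and Cauchy's estimates bound the Taylor coefficients.
   For g = 2 exchanging tau' and tau'' gives the same for the other variable.

   A form of degree one that vanishes to high order at the cusp is zero, so that the forms of
   weight k + r span a space of finite dimension and the minors of the kernel
   (tau', (tau'', m)) |-> (coefficient of t_r(f) at m) have bounded rank.  A maximal nonsingular
   minor writes t_r(f) as a sum of products with linearly independent factors. *)

Set Implicit Arguments.
Unset Strict Implicit.
Unset Printing Implicit Defensive.

Local Open Scope classical_set_scope.
Local Open Scope ring_scope.
Local Open Scope complex_scope.

(** * Real-valued norms on complex normed spaces *)

(** For g >= 2 a form carries no growth condition, whereas forms of degree one must be holomorphic
    at infinity: this gap is what the boundedness argument has to fill. All Cauchy integrals run
    over horizontal segments of length 1. The coordinate exp (2 pi i t) turns circles into such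
    segments, so that Goursat's theorem on rectangles and periodicity serve strips, half planes and
    discs alike. Matrices of the Siegel space are symmetric and form no open set of all matrices.
    Derivatives are therefore taken of f composed with the projection to symmetric matrices, on the
    open preimage of the Siegel space. The polynomial t_r(f) is handled through its values: at a
    vector zeta it is the r-th Taylor coefficient in s of f at (tau', s zeta, tau''), and a
    polynomial over C is determined by its values. The transformation laws become limits in the
    single variable s. In the final decomposition the second factors are the values of t_r(f) at
    finitely many points tau', and the first factors are combinations of its coefficients at
    finitely many tau''. So both are modular as soon as t_r(f) is modular in each variable
    separately. *)

Notation normc := ComplexField.Normc.normc.

Section RealNorm.
Context {R : realType}.
Local Notation C := R[i].
Implicit Types (z w : C) (V : normedModType C).

(** A norm over [R[i]] takes values in [R[i]], where the order is partial; its real part is a norm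
    in [R], to which real arithmetic applies. *)
Definition rnorm V (v : V) : R := complex.Re `|v|.

Lemma normv_rnorm V (v : V) : `|v| = (rnorm v)%:C.
Proof. by rewrite /rnorm RRe_real// ger0_real. Qed.

Lemma rnorm_ge0 V (v : V) : 0 <= rnorm v.
Proof. by rewrite -ler0c -normv_rnorm. Qed.

Lemma rnormc (z : C^o) : rnorm z = normc z.
Proof. by []. Qed.

Lemma rnorm0 V : rnorm (0 : V) = 0.
Proof. by rewrite /rnorm normr0. Qed.

Lemma rnormD V (u v : V) : rnorm (u + v) <= rnorm u + rnorm v.
Proof. by rewrite -lecR raddfD/= -!normv_rnorm ler_normD. Qed.

Lemma rnormN V (v : V) : rnorm (- v) = rnorm v.
Proof. by rewrite /rnorm normrN. Qed.

Lemma rnormZ V (a : C) (v : V) : rnorm (a *: v) = normc a * rnorm v.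
Proof.
apply: complexI; rewrite rmorphM/= -!normv_rnorm.
by rewrite [LHS]normrZ.
Qed.

Lemma normc_ge0 z : 0 <= normc z.
Proof. exact: (@rnorm_ge0 C^o). Qed.
Lemma normcD z w : normc (z + w) <= normc z + normc w.
Proof. exact: (@rnormD C^o). Qed.
Lemma normcM z w : normc (z * w) = normc z * normc w.
Proof. exact: ComplexField.Normc.normcM. Qed.
Lemma normcN z : normc (- z) = normc z.
Proof. exact: (@rnormN C^o). Qed.
Lemma normcB z w : normc (z - w) = normc (w - z).
Proof. by rewrite -normcN opprB. Qed.
Lemma normcV z : normc z^-1 = (normc z)^-1.
Proof. exact: ComplexField.Normc.normcV. Qed.
Lemma normc_0 : normc (0 : C) = 0.
Proof. exact: ComplexField.Normc.normc0. Qed.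
Lemma normc_1 : normc (1 : C) = 1.
Proof. exact: ComplexField.Normc.normc1. Qed.
Lemma normcX z n : normc (z ^+ n) = normc z ^+ n.
Proof. by elim: n => [|n IH]; rewrite ?expr0 ?normc_1// !exprS normcM IH. Qed.
Lemma normc_real (x : R) : normc x%:C = `|x|.
Proof. by rewrite /= expr0n/= addr0 sqrtr_sqr. Qed.
Lemma normc_eq0 z : (normc z == 0) = (z == 0).
Proof.
apply/eqP/eqP => [/ComplexField.Normc.eq0_normc//|->]; exact: normc_0.
Qed.
Lemma normc_gt0 z : (0 < normc z) = (z != 0).
Proof. by rewrite lt_def normc_ge0 andbT normc_eq0. Qed.
Lemma normr_Re z : `|complex.Re z| <= normc z.
Proof. by rewrite -lecR; exact: normc_ge_Re. Qed.
Lemma normr_Im z : `|complex.Im z| <= normc z.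
Proof.
case: z => a b /=; rewrite -sqrtr_sqr ler_sqrt ?addr_ge0 ?sqr_ge0//.
by rewrite lerDr sqr_ge0.
Qed.
Lemma normc_ReIm z : normc z <= `|complex.Re z| + `|complex.Im z|.
Proof.
rewrite {1}[z]complexE (le_trans (normcD _ _))// normc_real lerD2l.
by rewrite normcM normc_real /= expr0n expr1n add0r sqrtr1 mul1r.
Qed.
Lemma normc_eta (x y : R) : normc (x +i* y) <= `|x| + `|y|.
Proof. exact: normc_ReIm. Qed.
Lemma normc_sqr z : normc z ^+ 2 = complex.Re z ^+ 2 + complex.Im z ^+ 2.
Proof. by case: z => a b /=; rewrite sqr_sqrtr// addr_ge0// sqr_ge0. Qed.
Lemma lerB_normc z w : normc z - normc w <= normc (z - w).
Proof. by have := normcD (z - w) w; rewrite subrK lerBlDr. Qed.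

Lemma gt0_cplx (e : C) : 0 < e -> exists2 r : R, 0 < r & e = r%:C.
Proof.
move=> e0; exists (complex.Re e); last by rewrite RRe_real// gtr0_real.
by move: e0; rewrite ltcE/= => /andP[].
Qed.

Lemma near_rnormP V (x : V) (P : V -> Prop) :
  (\forall y \near x, P y) <->
  exists2 d : R, 0 < d & forall h, rnorm h < d -> P (x + h).
Proof.
split=> [/nbhs_normP[e /= e0 he]|[d d0 hd]].
  have [r r0 er] := gt0_cplx e0; exists r => // h hr; apply: he => /=.
  by rewrite /ball_/= opprD addrA subrr add0r normrN er normv_rnorm ltcR.
apply/nbhs_normP; exists d%:C; first by rewrite /= ltcR.
move=> y /=; rewrite /ball_/= distrC => hy.
rewrite -(subrK x y) addrC; apply: hd.
by rewrite -ltcR -normv_rnorm.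
Qed.

Lemma near_realP (x : R) (P : R -> Prop) :
  (\forall y \near x, P y) <->
  exists2 d : R, 0 < d & forall h, `|h| < d -> P (x + h).
Proof.
split=> [/nbhs_normP[e /= e0 he]|[d d0 hd]].
  exists e => // h hr; apply: he => /=.
  by rewrite /ball_/= opprD addrA subrr add0r normrN.
apply/nbhs_normP; exists d => // y /=; rewrite /ball_/= distrC => hy.
by rewrite -(subrK x y) addrC; apply: hd.
Qed.

Lemma cvg_rnormP (T : Type) (F : set_system T) V (f : T -> V) (l : V) :
  Filter F ->
  f @ F --> l <-> forall e : R, 0 < e -> \forall t \near F, rnorm (f t - l) <= e.
Proof.
move=> FF; split=> [/cvgrPdist_le fl e e0|fl].
  have e0' : 0 < e%:C by rewrite ltcR.
  have := fl _ e0'; apply: filterS => t.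
  by rewrite distrC normv_rnorm lecR.
apply/cvgrPdist_le => e /gt0_cplx[r r0 ->].
by have := fl _ r0; apply: filterS => t; rewrite distrC normv_rnorm lecR.
Qed.

Lemma cvg_realP (T : Type) (F : set_system T) (f : T -> R) (l : R) :
  Filter F ->
  f @ F --> l <-> forall e : R, 0 < e -> \forall t \near F, `|f t - l| <= e.
Proof.
move=> FF; split=> [/cvgrPdist_le fl e e0|fl].
  by have := fl _ e0; apply: filterS => t; rewrite distrC.
apply/cvgrPdist_le => e e0.
by have := fl _ e0; apply: filterS => t; rewrite distrC.
Qed.

Lemma continuous_epsP V V' (f : V -> V') (x : V) :
  {for x, continuous f} <-> forall e : R, 0 < e ->
    exists2 d : R, 0 < d & forall h, rnorm h < d -> rnorm (f (x + h) - f x) <= e.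
Proof.
split=> [/cvg_rnormP fx e e0|fx].
  exact: (near_rnormP x (fun y => rnorm (f y - f x) <= e)).1 (fx _ e0).
by apply/cvg_rnormP => e e0; apply/near_rnormP; exact: fx.
Qed.

Lemma continuous_eps_realP V (f : V -> R) (x : V) :
  {for x, continuous f} <-> forall e : R, 0 < e ->
    exists2 d : R, 0 < d & forall h, rnorm h < d -> `|f (x + h) - f x| <= e.
Proof.
split=> [/cvg_realP fx e e0|fx].
  exact: (near_rnormP x (fun y => `|f y - f x| <= e)).1 (fx _ e0).
by apply/cvg_realP => e e0; apply/near_rnormP; exact: fx.
Qed.

Lemma continuous_Re : continuous (@complex.Re R : C^o -> R).
Proof.
move=> z; apply/continuous_eps_realP => e e0; exists e => // h he.
by rewrite raddfD addrAC subrr add0r (le_trans (normr_Re _))// ltW.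
Qed.

Lemma continuous_Im : continuous (@complex.Im R : C^o -> R).
Proof.
move=> z; apply/continuous_eps_realP => e e0; exists e => // h he.
by rewrite raddfD addrAC subrr add0r (le_trans (normr_Im _))// ltW.
Qed.

Lemma cvg_complex (T : Type) (F : set_system T) (f g : T -> R) a b :
  Filter F -> f @ F --> a -> g @ F --> b ->
  (fun t => f t +i* g t : C^o) @ F --> (a +i* b : C^o).
Proof.
move=> FF /cvg_realP fa /cvg_realP gb; apply/cvg_rnormP => e e0.
have e2 : 0 < e / 2 by lra.
near=> t; rewrite rnormc; apply: (le_trans (normc_ReIm _)) => /=.
rewrite (splitr e) lerD//.
  by near: t; exact: fa.
by near: t; exact: gb.
Unshelve. all: by end_near. Qed.

Lemma continuous_normc : continuous (fun z : C^o => normc z).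
Proof.
move=> z; apply/continuous_eps_realP => e e0; exists e => // h he.
rewrite ler_norml; apply/andP; split.
  have := lerB_normc z (- h); rewrite normcN opprK; move: he; rewrite rnormc; lra.
have := normcD z h; move: he; rewrite rnormc; lra.
Qed.

Lemma continuous_real_complex : continuous (fun x : R => x%:C : C^o).
Proof. by move=> x; apply: cvg_complex; [exact: cvg_id|exact: cvg_cst]. Qed.

End RealNorm.

(** * Integrals of complex functions on an interval *)

Section Differentiability.
Context {R : realType}.
Local Notation C := R[i].
Context {V W : normedModType C}.

Lemma differentiable_eps (f : V -> W) x : differentiable f x ->
  forall e : R, 0 < e -> exists2 d : R, 0 < d &
    forall h, rnorm h < d -> rnorm (f (x + h) - f x - 'd f x h) <= e * rnorm h.
Proof.
move=> /diff_locally/eqaddoP fx e e0.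
have := fx e%:C; rewrite ltcR => /(_ e0)/near_rnormP[d d0 hd].
exists d => // h /hd; rewrite add0r !normv_rnorm -rmorphM lecR.
suff -> : (f \o shift x - (cst (f x) + 'd f x)) h = f (x + h) - f x - 'd f x h by [].
by rewrite [x + h]addrC -[RHS]addrA -opprD.
Qed.

Lemma eps_differentiable (f : V -> W) x (L : {linear V -> W}) :
  continuous L ->
  (forall e : R, 0 < e -> exists2 d : R, 0 < d &
    forall h, rnorm h < d -> rnorm (f (x + h) - f x - L h) <= e * rnorm h) ->
  differentiable f x /\ 'd f x = L :> (V -> W).
Proof.
move=> Lc fL.
have E : f \o shift x = cst (f x) + L +o_ 0 id.
  apply/eqaddoP => e /gt0_cplx[r r0 ->].
  apply/near_rnormP; have [d d0 hd] := fL r r0; exists d => // h /hd.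
  rewrite add0r !normv_rnorm -rmorphM lecR.
  suff -> : (f \o shift x - (cst (f x) + L)) h = f (x + h) - f x - L h by [].
  by rewrite [x + h]addrC -[RHS]addrA -opprD.
have dE := diff_unique Lc E; split => //.
by apply/diff_locallyP; rewrite dE.
Qed.

End Differentiability.

Section ComplexIntegral.
Context {R : realType}.
Local Notation C := R[i].
Local Notation mu := (@lebesgue_measure R).
Implicit Types (g h : R -> C) (a b : R) (c : C).

Definition cint a b g : C :=
  (\int[mu]_(x in `[a, b]) complex.Re (g x))%R +i*
  (\int[mu]_(x in `[a, b]) complex.Im (g x))%R.

(* contin, ccontinuous, cdiff and holo are records so that unification never unfolds them. *)
Record contin a b g : Prop := Contin {
  continP : forall x, a <= x <= b -> {for x, continuous (g : R -> C^o)} }.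

Lemma contin_integrable a b (g : R -> C) : contin a b g ->
  mu.-integrable `[a, b] (EFin \o (fun x => complex.Re (g x))) /\
  mu.-integrable `[a, b] (EFin \o (fun x => complex.Im (g x))).
Proof.
move=> [gc]; split; apply: continuous_compact_integrable;
  try exact: segment_compact; apply: continuous_in_subspaceT => x;
  rewrite inE/= in_itv/= => xab.
  by apply: (continuous_comp (gc x xab)); exact: continuous_Re.
by apply: (continuous_comp (gc x xab)); exact: continuous_Im.
Qed.

Lemma cint_cst a b c : a <= b -> cint a b (fun=> c) = (b - a)%:C * c.
Proof.
move=> ab; rewrite /cint !Rintegral_cst//= lebesgue_measure_itv/= lte_fin.
have -> : fine (if a < b then (b%:E - a%:E)%E else 0%E) = b - a.
  case: ltP => // ba; have -> : a = b by apply/eqP; rewrite eq_le ab ba.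
  by rewrite subrr.
case: c => x y; apply/eqP; rewrite eq_complex/= !mul0r subr0 addr0.
by rewrite ![_ * (b - a)]mulrC !eqxx.
Qed.

Lemma cintD a b g h : contin a b g -> contin a b h ->
  cint a b (fun x => g x + h x) = cint a b g + cint a b h.
Proof.
move=> /contin_integrable[gr gi] /contin_integrable[hr hi].
apply/eqP; rewrite eq_complex/=; apply/andP; split; apply/eqP.
  by rewrite -RintegralD//; apply: eq_Rintegral => x _; rewrite raddfD.
by rewrite -RintegralD//; apply: eq_Rintegral => x _; rewrite raddfD.
Qed.

Lemma cintZ a b c g : contin a b g ->
  cint a b (fun x => c * g x) = c * cint a b g.
Proof.
move=> /contin_integrable[gr gi].
have ZI (r : R) (k : R -> R) : mu.-integrable `[a, b] (EFin \o k) ->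
    mu.-integrable `[a, b] (EFin \o (fun x => r * k x)).
  move=> ki; have := @integrableZl _ _ _ mu _ (measurable_itv `[a, b]) r _ ki.
  by [].
case: c => u v; apply/eqP; rewrite eq_complex/=; apply/andP; split; apply/eqP.
  rewrite -!RintegralZl//; rewrite -RintegralB//; try exact: ZI.
  by apply: eq_Rintegral => x _; case: (g x).
rewrite -!RintegralZl//; rewrite -RintegralD//; try exact: ZI.
by apply: eq_Rintegral => x _; case: (g x).
Qed.

Lemma continN a b g : contin a b g -> contin a b (fun x => - g x).
Proof. by move=> [gc]; split=> x /gc gx; apply: (@cvgN _ C^o). Qed.

Lemma continD a b g h : contin a b g -> contin a b h ->
  contin a b (fun x => g x + h x).
Proof. by move=> [gc] [hc]; split=> x xab; apply: (@cvgD _ C^o); [exact: gc|exact: hc]. Qed.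

Lemma continM a b g h : contin a b g -> contin a b h ->
  contin a b (fun x => g x * h x).
Proof. by move=> [gc] [hc]; split=> x xab; apply: (@cvgM C); [exact: gc|exact: hc]. Qed.

Lemma contin_cst a b c : contin a b (fun=> c).
Proof. by split=> x _; exact: cvg_cst. Qed.

Lemma cintN a b g : contin a b g ->
  cint a b (fun x => - g x) = - cint a b g.
Proof.
move=> gc; rewrite -mulN1r -cintZ//.
by congr (cint a b _); apply/funext => x; rewrite mulN1r.
Qed.

Lemma cintB a b g h : contin a b g -> contin a b h ->
  cint a b (fun x => g x - h x) = cint a b g - cint a b h.
Proof.
move=> gc hc; rewrite (@cintD _ _ g (fun x => - h x)).
- by rewrite cintN.
- exact: gc.
- exact: continN hc.
Qed.

Lemma eq_cint a b g h : (forall x, a <= x <= b -> g x = h x) ->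
  cint a b g = cint a b h.
Proof.
move=> gh; rewrite /cint; congr (_ +i* _); apply: eq_Rintegral => x;
  by rewrite inE/= in_itv/= => /gh->.
Qed.

Lemma cint_split m a b g : a <= m <= b -> contin a b g ->
  cint a b g = cint a m g + cint m b g.
Proof.
move=> /andP[am mb] /contin_integrable[gr gi].
have H (k : R -> R) : mu.-integrable `[a, b] (EFin \o k) ->
  (\int[mu]_(x in `[a, b]) k x)%R =
  (\int[mu]_(x in `[a, m]) k x)%R + (\int[mu]_(x in `[m, b]) k x)%R.
  move=> ki; have := @Rintegral_itvB _ k (BLeft a) (BRight b) m ki.
  rewrite !bnd_simp => /(_ am mb) E; rewrite -(@Rintegral_itv_obnd_cbnd _ m).
    by rewrite -E addrC subrK.
  by apply: integrableS ki => //; apply: subset_itvr; rewrite bnd_simp.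
by rewrite /cint (H _ gr) (H _ gi).
Qed.

(** Rotation by the conjugate of the integral I: |I|^2 is the real part of the integral of
    [I^* * g], hence at most |I| (b - a) M. Bounding the two components separately would lose a
    constant factor. *)
Lemma cint_norm a b (M : R) g : a <= b -> contin a b g ->
  (forall x, a <= x <= b -> normc (g x) <= M) ->
  normc (cint a b g) <= (b - a) * M.
Proof.
move=> ab gc gM; set I := cint a b g.
have [->|I0] := eqVneq I 0.
  rewrite normc_0 mulr_ge0 ?subr_ge0//.
  by rewrite (le_trans (normc_ge0 (g a)))// gM// lexx.
have In0 : 0 < normc I by rewrite normc_gt0.
rewrite -(ler_pM2l In0) -expr2.
have -> : normc I ^+ 2 = complex.Re (cint a b (fun x => I^* * g x)).
  rewrite cintZ// -/I normc_sqr; case: (I) => x y /=.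
  by rewrite mulNr opprK -!expr2.
have c1 : contin a b (fun x => I^* * g x).
  by apply: continM => //; exact: contin_cst.
have := cint_cst (normc I * M)%:C ab => /(congr1 (@complex.Re R)) /=.
rewrite mul0r subr0 => E.
rewrite mulrCA -E; apply: le_Rintegral => //.
- exact: (contin_integrable c1).1.
- exact: (contin_integrable (@contin_cst a b (normc I * M)%:C)).1.
- move=> x; rewrite /= in_itv/= => xab.
  rewrite (le_trans (ler_norm _))// (le_trans (normr_Re _))// normcM.
  have -> : normc I^* = normc I by apply: complexI; exact: normcJ.
  by rewrite ler_pM2l// gM.
Qed.

End ComplexIntegral.

#[global] Opaque cint.

(** * Goursat's theorem *)

Section Goursat.
Context {R : realType}.
Local Notation C := R[i].

Lemma exists_small_halving (L d : R) : 0 < d -> exists n : nat, L / 2 ^+ n < d.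
Proof.
move=> d0; pose n := Num.bound (`|L| / d); exists n.
have H : `|L| / d < n%:R by apply: archi_boundP; rewrite divr_ge0// ltW.
rewrite ltr_pdivrMr ?exprn_gt0// (le_lt_trans (ler_norm L))//.
move: H; rewrite ltr_pdivrMr// mulrC => H; apply: (lt_le_trans H).
rewrite ler_pM2l// -natrX ler_nat; exact/ltnW/ltn_expl.
Qed.

Lemma nested_intervals (a b : nat -> R) :
  (forall n, a n <= a n.+1) -> (forall n, b n.+1 <= b n) ->
  (forall n, a n <= b n) -> exists p, forall n, a n <= p <= b n.
Proof.
move=> aS bS ab.
have am m n : (m <= n)%N -> a m <= a n.
  elim: n => [|n IH]; first by rewrite leqn0 => /eqP->.
  by rewrite leq_eqVlt ltnS => /orP[/eqP->//|/IH mn]; exact: le_trans mn (aS n).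
have bm m n : (m <= n)%N -> b n <= b m.
  elim: n => [|n IH]; first by rewrite leqn0 => /eqP->.
  by rewrite leq_eqVlt ltnS => /orP[/eqP->//|/IH mn]; exact: le_trans (bS n) mn.
have abm m n : a m <= b n.
  by apply: (le_trans (am _ _ (leq_maxl m n))); rewrite (le_trans (ab _))// bm// leq_maxr.
have hs : has_sup (range a).
  by split; [exists (a 0%N), 0%N|exists (b 0%N) => _ [n _ <-]].
exists (sup (range a)) => n; apply/andP; split.
  by apply: ub_le_sup; [exact: hs.2|exists n].
by apply: sup_le_ub; [exact: hs.1|move=> _ [m _ <-]].
Qed.

Section AdditiveRectangle.
Variables (F : R -> R -> R -> R -> C) (a0 b0 c0 d0 : R).
Hypotheses (ab0 : a0 <= b0) (cd0 : c0 <= d0).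
Hypothesis addx : forall a m b c d, a0 <= a -> a <= m -> m <= b -> b <= b0 ->
  c0 <= c -> c <= d -> d <= d0 -> F a b c d = F a m c d + F m b c d.
Hypothesis addy : forall a b c m d, a0 <= a -> a <= b -> b <= b0 ->
  c0 <= c -> c <= m -> m <= d -> d <= d0 -> F a b c d = F a b c m + F a b m d.
Hypothesis small : forall p q, a0 <= p <= b0 -> c0 <= q <= d0 ->
  forall e : R, 0 < e -> exists2 r : R, 0 < r & forall a b c d,
    a0 <= a -> a <= p -> p <= b -> b <= b0 ->
    c0 <= c -> c <= q -> q <= d -> d <= d0 -> b - a < r -> d - c < r ->
    normc (F a b c d) <= e * (b - a + (d - c)) ^+ 2.

Let bad e (r : (R * R) * (R * R)) :=
  [/\ a0 <= r.1.1, r.1.1 <= r.1.2, r.1.2 <= b0 &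
    [/\ c0 <= r.2.1, r.2.1 <= r.2.2, r.2.2 <= d0 &
     e * (r.1.2 - r.1.1 + (r.2.2 - r.2.1)) ^+ 2 <
     normc (F r.1.1 r.1.2 r.2.1 r.2.2)]].

Let half (s t : R * R) :=
  [/\ s.1 <= t.1, t.2 <= s.2 & t.2 - t.1 = (s.2 - s.1) / 2].

(** The bound is quadratic in the semiperimeter, so four quarters that respect it add up to a whole
    that respects it with the same [e]. *)
Let bad_quarter e r : 0 < e -> bad e r ->
  exists r', [/\ half r.1 r'.1, half r.2 r'.2 & bad e r'].
Proof.
case: r => -[a b] [c d] e0 [/= aa ab bb [/= cc cd dd hF]].
pose m := (a + b) / 2; pose k := (c + d) / 2.
have [am mb] : a <= m /\ m <= b by rewrite /m; split; lra.
have [ck kd] : c <= k /\ k <= d by rewrite /k; split; lra.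
apply: contrapT => H.
have good a' b' c' d' : (a' = a /\ b' = m) \/ (a' = m /\ b' = b) ->
    (c' = c /\ d' = k) \/ (c' = k /\ d' = d) ->
    normc (F a' b' c' d') <= e * ((b - a + (d - c)) / 2) ^+ 2.
  move=> ab' cd'; rewrite leNgt; apply/negP => H'; apply: H.
  have Eb : b' - a' = (b - a) / 2.
    by case: ab' => -[-> ->]; rewrite /m; lra.
  have Ed : d' - c' = (d - c) / 2.
    by case: cd' => -[-> ->]; rewrite /k; lra.
  exists (a', b', (c', d')); split => /=.
  - by case: ab' => -[? ?]; split => /=; lra.
  - by case: cd' => -[? ?]; split => /=; lra.
  - split => /=; try by case: ab' => -[? ?]; lra.
    split => /=; try by case: cd' => -[? ?]; lra.
    by rewrite Eb Ed -mulrDl.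
have := hF; rewrite (addx aa am mb bb)// (addy (c := c) (m := k) (d := d))//; last lra.
rewrite (addy (a := m) (c := c) (m := k) (d := d))//; last lra.
have := good a m c k; have := good a m k d; have := good m b c k.
have := good m b k d.
move=> /(_ (or_intror (conj erefl erefl)) (or_intror (conj erefl erefl))) H1.
move=> /(_ (or_intror (conj erefl erefl)) (or_introl (conj erefl erefl))) H2.
move=> /(_ (or_introl (conj erefl erefl)) (or_intror (conj erefl erefl))) H3.
move=> /(_ (or_introl (conj erefl erefl)) (or_introl (conj erefl erefl))) H4.
rewrite ltNge => /negP; apply; apply: le_trans (normcD _ _) _.
have := normcD (F a m c k) (F a m k d); have := normcD (F m b c k) (F m b k d).
have -> : e * (b - a + (d - c)) ^+ 2 =
  4 * (e * ((b - a + (d - c)) / 2) ^+ 2) by field.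
lra.
Qed.

(** Goursat's bisection for any additive function of rectangles: nested bad quarters shrink to a
    point (p, q), where [small] contradicts their badness. *)
Lemma additive_rect_zero : F a0 b0 c0 d0 = 0.
Proof.
apply/eqP; rewrite -normc_eq0 eq_le normc_ge0 andbT leNgt; apply/negP => F0.
pose w := b0 - a0 + (d0 - c0).
(* Makes [e * w ^+ 2] smaller than the norm of [F] on the whole rectangle; the [+ 1] admits a
   degenerate rectangle, with w = 0. *)
pose e := normc (F a0 b0 c0 d0) / (2 * (w ^+ 2 + 1)).
have w1 : 0 < w ^+ 2 + 1 by rewrite ltr_wpDl// sqr_ge0.
have e0 : 0 < e by rewrite divr_gt0// mulr_gt0.
have badr0 : bad e ((a0, b0), (c0, d0)).
  split => //; split => //=; rewrite -/w /e mulrAC ltr_pdivrMr ?mulr_gt0//.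
  by rewrite ltr_pM2l//; have := sqr_ge0 w; lra.
have /choice[f fP] (r : (R * R) * (R * R)) : exists r', bad e r ->
    [/\ half r.1 r'.1, half r.2 r'.2 & bad e r'].
  have [br|nbr] := pselect (bad e r); last by exists r.
  by have [r' hr'] := bad_quarter e0 br; exists r'.
pose u n := iter n f ((a0, b0), (c0, d0)).
have badu n : bad e (u n) by elim: n => //= n /fP[].
have st n : half (u n).1 (u n.+1).1 /\ half (u n).2 (u n.+1).2.
  by have [] := fP _ (badu n).
have [p hp] : exists p, forall n, (u n).1.1 <= p <= (u n).1.2.
  apply: nested_intervals => n; [|by case: (st n) => -[]..|by case: (badu n)].
  by case: (st n) => -[].
have [q hq] : exists q, forall n, (u n).2.1 <= q <= (u n).2.2.
  apply: nested_intervals => n; [|by case: (st n) => _ []..|].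
    by case: (st n) => _ [].
  by case: (badu n) => _ _ _ [].
have wx n : (u n).1.2 - (u n).1.1 = (b0 - a0) / 2 ^+ n.
  elim: n => [|n IH]; first by rewrite expr0 divr1.
  by have [[_ _ ->] _] := st n; rewrite IH exprSr invfM mulrA.
have wy n : (u n).2.2 - (u n).2.1 = (d0 - c0) / 2 ^+ n.
  elim: n => [|n IH]; first by rewrite expr0 divr1.
  by have [_ [_ _ ->]] := st n; rewrite IH exprSr invfM mulrA.
have [r r0 hr] := small (hp 0%N) (hq 0%N) e0.
have [n hn] := exists_small_halving w r0.
have [h1 h2 h3 [h4 h5 h6 h7]] := badu n.
have p2 : 0 < 2 ^+ n :> R by rewrite exprn_gt0.
have lex : (b0 - a0) / 2 ^+ n <= w / 2 ^+ n.
  by rewrite ler_pM2r ?invr_gt0// /w lerDl subr_ge0.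
have ley : (d0 - c0) / 2 ^+ n <= w / 2 ^+ n.
  by rewrite ler_pM2r ?invr_gt0// /w lerDr subr_ge0.
have /andP[hp1 hp2] := hp n; have /andP[hq1 hq2] := hq n.
have := hr _ _ _ _ h1 hp1 hp2 h3 h4 hq1 hq2 h6.
rewrite wx wy => /(_ (le_lt_trans lex hn) (le_lt_trans ley hn)).
by rewrite leNgt -wx -wy h7.
Qed.

End AdditiveRectangle.


(** The counterclockwise boundary integral over [a, b] x [c, d], with opposite sides paired under
    one integral sign. *)
Definition rect_int (h : C -> C) a b c d : C :=
  cint a b (fun x => h (x +i* c) - h (x +i* d)) +
  'i * cint c d (fun y => h (b +i* y) - h (a +i* y)).

Record ccontinuous (h : C -> C) (w : C) : Prop := CContinuous {
  ccontinuousW : {for (w : C^o), continuous (h : C^o -> C^o)} }.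

Lemma contin_horizontal (h : C -> C) a b c :
  (forall x, a <= x <= b -> ccontinuous h (x +i* c)) ->
  contin a b (fun x => h (x +i* c)).
Proof.
move=> hc; split=> x xab.
apply: (@continuous_comp R C^o C^o (fun x : R => x +i* c) h); last exact: ccontinuousW (hc _ xab).
by apply: cvg_complex; [exact: cvg_id|exact: cvg_cst].
Qed.

Lemma contin_vertical (h : C -> C) a c d :
  (forall y, c <= y <= d -> ccontinuous h (a +i* y)) ->
  contin c d (fun y => h (a +i* y)).
Proof.
move=> hc; split=> x xab.
apply: (@continuous_comp R C^o C^o (fun y : R => a +i* y) h); last exact: ccontinuousW (hc _ xab).
by apply: cvg_complex; [exact: cvg_cst|exact: cvg_id].
Qed.

Lemma continB a b (g h : R -> C) : contin a b g -> contin a b h ->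
  contin a b (fun x => g x - h x).
Proof. by move=> gc hc; apply: continD gc (continN hc). Qed.

End Goursat.

Section GoursatRectangle.
Context {R : realType}.
Local Notation C := R[i].
Implicit Types (h k : C -> C) (w : C).

Record cdiff h w : Prop := CDiff {
  cdiffW : differentiable (h : C^o -> C^o) (w : C^o) }.

Lemma cdiff_continuous h w : cdiff h w -> ccontinuous h w.
Proof. by case=> hw; split; exact: differentiable_continuous. Qed.

Lemma cdiff_cst c w : cdiff (fun=> c) w.
Proof. by split; exact: differentiable_cst. Qed.

Lemma cdiff_id w : cdiff id w.
Proof. by split; exact: ex_diff. Qed.

Lemma cdiffD h k w : cdiff h w -> cdiff k w -> cdiff (fun w => h w + k w) w.
Proof. by case=> hw [kw]; split; exact: differentiableD. Qed.

Lemma cdiffB h k w : cdiff h w -> cdiff k w -> cdiff (fun w => h w - k w) w.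
Proof. by case=> hw [kw]; split; exact: differentiableB. Qed.

Lemma cdiffM h k w : cdiff h w -> cdiff k w -> cdiff (fun w => h w * k w) w.
Proof. by case=> hw [kw]; split; exact: differentiableM. Qed.

Lemma cdiffV h w : h w != 0 -> cdiff h w -> cdiff (fun w => (h w)^-1) w.
Proof. by move=> hw0 [hw]; split; exact: differentiableV. Qed.

Lemma cdiff_comp h k w : cdiff h w -> cdiff k (h w) -> cdiff (fun w => k (h w)) w.
Proof. by case=> hw [kw]; split; exact: differentiable_comp hw kw. Qed.

Lemma ccontinuous_eps h w : ccontinuous h w <-> forall e : R, 0 < e ->
  exists2 d : R, 0 < d & forall v, normc v < d -> normc (h (w + v) - h w) <= e.
Proof.
split=> [[/(@continuous_epsP R C^o C^o)//]|hw]; split.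
exact: (@continuous_epsP R C^o C^o _ _).2 hw.
Qed.

Lemma cdiff_eps h w : cdiff h w -> exists b : C, forall e : R, 0 < e ->
  exists2 d : R, 0 < d & forall v, normc v < d ->
    normc (h (w + v) - h w - v * b) <= e * normc v.
Proof.
move=> [hw]; exists (derive1 (h : C^o -> C^o) w) => e e0.
have [d d0 hd] := differentiable_eps hw e0; exists d => // v vd.
by have := hd v vd; rewrite !rnormc diff1E.
Qed.

Lemma normc_i : normc ('i : C) = 1.
Proof. by rewrite /= expr0n expr1n add0r sqrtr1. Qed.

Section Goursat.
Variables (h : C -> C) (a0 b0 c0 d0 : R).
Hypotheses (ab0 : a0 <= b0) (cd0 : c0 <= d0).
Hypothesis hdiff : forall x y, a0 <= x <= b0 -> c0 <= y <= d0 -> cdiff h (x +i* y).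

Let ch a b c : a0 <= a -> b <= b0 -> c0 <= c <= d0 ->
  contin a b (fun x => h (x +i* c)).
Proof.
move=> aa bb cc; apply: contin_horizontal => x xab.
by apply/cdiff_continuous/hdiff => //; lra.
Qed.

Let cv a c d : c0 <= c -> d <= d0 -> a0 <= a <= b0 ->
  contin c d (fun y => h (a +i* y)).
Proof.
move=> aa bb cc; apply: contin_vertical => x xab.
by apply/cdiff_continuous/hdiff => //; lra.
Qed.

Let rect_addx a m b c d : a0 <= a -> a <= m -> m <= b -> b <= b0 ->
  c0 <= c -> c <= d -> d <= d0 ->
  rect_int h a b c d = rect_int h a m c d + rect_int h m b c d.
Proof.
move=> *; rewrite /rect_int (@cint_split _ m a b); [|lra|]; last first.
  by apply: continB; apply: ch; lra.
rewrite addrACA; congr (_ + _); rewrite -mulrDr -cintD; last first.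
- by apply: continB; apply: cv; lra.
- by apply: continB; apply: cv; lra.
- by congr (_ * _); apply: eq_cint => y _; ring.
Qed.

Let rect_addy a b c m d : a0 <= a -> a <= b -> b <= b0 ->
  c0 <= c -> c <= m -> m <= d -> d <= d0 ->
  rect_int h a b c d = rect_int h a b c m + rect_int h a b m d.
Proof.
move=> *; rewrite /rect_int (@cint_split _ m c d); [|lra|]; last first.
  by apply: continB; apply: cv; lra.
rewrite mulrDr addrACA; congr (_ + _); rewrite -cintD; last first.
- by apply: continB; apply: ch; lra.
- by apply: continB; apply: ch; lra.
- by apply: eq_cint => y _; ring.
Qed.

(** Near (p, q), [h] is affine up to a remainder [k]. The affine part has boundary integral 0, and
    |k| <= [M] on a boundary of length 2 (b - a + d - c). *)
Let rect_small p q : a0 <= p <= b0 -> c0 <= q <= d0 ->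
  forall e : R, 0 < e -> exists2 r : R, 0 < r & forall a b c d,
    a0 <= a -> a <= p -> p <= b -> b <= b0 ->
    c0 <= c -> c <= q -> q <= d -> d <= d0 -> b - a < r -> d - c < r ->
    normc (rect_int h a b c d) <= e * (b - a + (d - c)) ^+ 2.
Proof.
move=> hp hq e e0; have [be hbe] := cdiff_eps (hdiff hp hq).
have [|r r0 hr] := hbe (e / 2); first by rewrite divr_gt0.
exists (r / 2); first by rewrite divr_gt0.
move=> a b c d *; pose w0 := p +i* q.
pose k w := h w - h w0 - (w - w0) * be.
pose M := e / 2 * (b - a + (d - c)).
have kM x y : a <= x <= b -> c <= y <= d -> normc (k (x +i* y)) <= M.
  move=> hx hy; pose v : C := (x - p) +i* (y - q).
  have vE : x +i* y = w0 + v.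
    by apply/eqP; rewrite eq_complex/=; apply/andP; split; apply/eqP; lra.
  have vn : normc v <= b - a + (d - c).
    by apply: le_trans (normc_eta _ _) _; rewrite lerD// ler_norml; lra.
  have wv : x +i* y - w0 = v by rewrite vE; ring.
  have := hr v; rewrite -/w0 -vE /k wv.
  move=> hv; apply: le_trans (hv _) _; first by lra.
  by rewrite /M ler_pM2l//; lra.
have ck x c' : c <= c' <= d -> contin a b (fun x => k (x +i* c')).
  move=> hc; apply: contin_horizontal => x' hx'.
  apply: cdiff_continuous; apply: cdiffB; last first.
    apply: cdiffM (cdiff_cst _ _); apply: cdiffB (cdiff_cst _ _); exact: cdiff_id.
  by apply: cdiffB (cdiff_cst _ _); apply: hdiff; lra.
have ckv x : a <= x <= b -> contin c d (fun y => k (x +i* y)).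
  move=> hc; apply: contin_vertical => x' hx'.
  apply: cdiff_continuous; apply: cdiffB; last first.
    apply: cdiffM (cdiff_cst _ _); apply: cdiffB (cdiff_cst _ _); exact: cdiff_id.
  by apply: cdiffB (cdiff_cst _ _); apply: hdiff; lra.
have kdiff w w' : h w - h w' = (k w - k w') + (w - w') * be.
  by rewrite /k; ring.
have ab : a <= b by lra.
have cd : c <= d by lra.
have E : rect_int h a b c d =
    cint a b (fun x => k (x +i* c) - k (x +i* d)) +
    'i * cint c d (fun y => k (b +i* y) - k (a +i* y)).
  rewrite /rect_int.
  rewrite (@eq_cint _ a b _ (fun x => (k (x +i* c) - k (x +i* d)) +
      ((0 +i* (c - d)) * be))); last first.
    move=> x _; rewrite kdiff; congr (_ + _ * _).
    by apply/eqP; rewrite eq_complex/= subrr !eqxx.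
  rewrite (@eq_cint _ c d _ (fun y => (k (b +i* y) - k (a +i* y)) +
      (((b - a) +i* 0) * be))); last first.
    move=> x _; rewrite kdiff; congr (_ + _ * _).
    by apply/eqP; rewrite eq_complex/= subrr !eqxx.
  rewrite (@cintD _ a b (fun x => k (x +i* c) - k (x +i* d)) (fun=> _));
    [|by apply: continB; apply: ck => //; lra|exact: contin_cst].
  rewrite (@cintD _ c d (fun y => k (b +i* y) - k (a +i* y)) (fun=> _));
    [|by apply: continB; apply: ckv => //; lra|exact: contin_cst].
  (* The linear part contributes i (c - d) (b - a) be on the horizontal sides and the opposite value
     on the vertical ones. *)
  rewrite !cint_cst// mulrDr addrACA -[RHS]addr0; congr (_ + _).
  rewrite !mulrA -mulrDl; apply/eqP; rewrite mulf_eq0; apply/orP; left.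
  by apply/eqP/eqP; rewrite eq_complex/=; apply/andP; split; apply/eqP; ring.
rewrite E; apply: le_trans (normcD _ _) _; rewrite normcM normc_i mul1r.
have -> : e * (b - a + (d - c)) ^+ 2 = (b - a) * (M + M) + (d - c) * (M + M).
  by rewrite /M; field.
apply: lerD; apply: cint_norm => //.
- by apply: continB; apply: ck => //; lra.
- move=> x hx; apply: le_trans (normcD _ _) _; rewrite normcN.
  by apply: lerD; apply: kM; lra.
- by apply: continB; apply: ckv => //; lra.
- move=> x hx; apply: le_trans (normcD _ _) _; rewrite normcN.
  by apply: lerD; apply: kM; lra.
Qed.

Theorem goursat : rect_int h a0 b0 c0 d0 = 0.
Proof. exact: additive_rect_zero rect_addx rect_addy rect_small. Qed.

End Goursat.

(* The vertical sides of the rectangle cancel. *)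
Lemma periodic_cint_const h (c d : R) : c <= d ->
  (forall y, c <= y <= d -> h (1 +i* y) = h (0 +i* y)) ->
  (forall x y, 0 <= x <= 1 -> c <= y <= d -> cdiff h (x +i* y)) ->
  cint 0 1 (fun x => h (x +i* c)) = cint 0 1 (fun x => h (x +i* d)).
Proof.
move=> cd per hd; have := goursat ler01 cd hd; rewrite /rect_int.
rewrite [X in 'i * X](@eq_cint _ c d _ (fun=> 0)); last first.
  by move=> y hy; rewrite per// subrr.
rewrite cint_cst// mulr0 mulr0 addr0 cintB; last 2 first.
- by apply: contin_horizontal => x hx; apply/cdiff_continuous/hd; lra.
- by apply: contin_horizontal => x hx; apply/cdiff_continuous/hd; lra.
by move=> /eqP; rewrite subr_eq0 => /eqP.
Qed.

(** Continuity is uniform along a compact segment, so that the integral over a horizontal segment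
    varies continuously with its height. *)
Lemma near_cint (h : C -> C) (s : R) :
  (forall x, 0 <= x <= 1 -> ccontinuous h (x +i* s)) ->
  forall e : R, 0 < e -> exists2 d : R, 0 < d & forall t, `|t - s| < d ->
    forall x, 0 <= x <= 1 -> normc (h (x +i* t) - h (x +i* s)) <= e.
Proof.
move=> hc e e0.
have /compact_near_coveringP cov := @segment_compact R 0 1.
suff H : \forall t \near s, `[0, 1]%classic `<=`
    (fun x => normc (h (x +i* t) - h (x +i* s)) <= e).
  have [d d0 hd] := (near_realP _ _).1 H; exists d => // t ts x hx.
  by have := hd (t - s) ts; rewrite addrC subrK => /(_ x); apply; rewrite /= in_itv.
apply: (cov R (nbhs s) (fun t x => normc (h (x +i* t) - h (x +i* s)) <= e)) => x.
rewrite /= in_itv/= => hx.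
have [|r r0 hr] := (ccontinuous_eps _ _).1 (hc x hx) (e / 2).
  by rewrite divr_gt0.
exists ([set x' | `|x' - x| < r / 2], [set t | `|t - s| < r / 2]) => /=.
  split; apply/near_realP; exists (r / 2); rewrite ?divr_gt0// => v;
    by rewrite /= addrAC subrr add0r.
move=> [x' t] [/= xx ts].
have H u v : `|u| < r / 2 -> `|v| < r / 2 ->
    normc (h ((x + u) +i* (s + v)) - h (x +i* s)) <= e / 2.
  move=> hu hv; have := hr (u +i* v); apply.
  by apply: le_lt_trans (normc_eta _ _) _; lra.
have h0 : `|0 : R| < r / 2 by rewrite normr0 divr_gt0.
have H1 := H (x' - x) (t - s) xx ts.
have H2 := H (x' - x) 0 xx h0.
have E1 : x + (x' - x) = x' by ring.
have E2 : s + (t - s) = t by ring.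
rewrite E1 addr0 in H2; rewrite E1 E2 in H1.
have -> : h (x' +i* t) - h (x' +i* s) = (h (x' +i* t) - h (x +i* s)) -
  (h (x' +i* s) - h (x +i* s)) by ring.
by apply: le_trans (normcD _ _) _; rewrite normcN (splitr e) lerD.
Qed.

End GoursatRectangle.

(** * The exponential nome *)

Section Nome.
Context {R : realType}.
Local Notation C := R[i].
Implicit Types (h k : C -> C) (w s t : C).

Lemma is_derive_eps (f : R -> R) (x d : R) : is_derive x 1 f d ->
  forall e : R, 0 < e -> exists2 r : R, 0 < r & forall h : R, `|h| < r ->
    `|f (x + h) - f x - h * d| <= e * `|h|.
Proof.
move=> [fx dE] e e0; have := fx; rewrite /derivable => /cvg_ex[l lE].
have := lE; move/cvg_lim : lE; rewrite -[lim _]/(derive f x 1) dE => <-//.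
move=> /cvg_realP/(_ e e0); rewrite near_withinE => /near_realP[r r0 hr].
exists r => // h hh; have [->|h0] := eqVneq h 0.
  by rewrite addr0 mul0r subrr subr0 normr0 mulr0.
have := hr h hh; rewrite add0r => /(_ h0) H.
have E : f (x + h) - f x - h * d =
    (h^-1 *: (f (h *: 1 + x) - f x) - d) * h.
  rewrite /GRing.scale/= mulr1 [h + x]addrC mulrBl mulrAC mulVf// mul1r.
  by rewrite [d * h]mulrC.
by rewrite E normrM ler_pM.
Qed.

Lemma cdiff_of_eps h w (b : C) :
  (forall e : R, 0 < e -> exists2 d : R, 0 < d & forall v, normc v < d ->
    normc (h (w + v) - h w - v * b) <= e * normc v) -> cdiff h w.
Proof.
move=> hb; split; apply/(@derivable1_diffP C C^o h w); apply/cvg_ex; exists b.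
apply/cvg_rnormP => e e0.
rewrite near_withinE; apply: (near_rnormP (0 : C^o) _).2.
have [d d0 hd] := hb e e0; exists d => // v; rewrite rnormc add0r => vd v0.
rewrite rnormc.
have E : v^-1 *: (h (v *: (1 : C) + w) - h w) - b =
    v^-1 * (h (w + v) - h w - v * b) :> C.
  rewrite [v *: _]mulr1 [v + w]addrC -[_ *: _]/(v^-1 * (h (w + v) - h w)).
  by field.
rewrite [X in normc X]E normcM normcV ler_pdivrMl ?normc_gt0//.
by apply: le_trans (hd v vd) _; rewrite mulrC.
Qed.

Lemma nomeD s t : nome (s + t) = nome s * nome t :> C.
Proof.
case: s t => [a b] [c d]; apply/eqP; rewrite eq_complex/=.
rewrite !mulrDr opprD expRD cosD sinD; apply/andP; split; apply/eqP; ring.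
Qed.

Lemma normc_nome t : normc (nome t) = expR (- (2 * pi * complex.Im t)).
Proof.
rewrite /nome /= !exprMn -mulrDr cos2Dsin2 mulr1 sqrtr_sqr.
by rewrite gtr0_norm// expR_gt0.
Qed.

Lemma nome_neq0 t : nome t != 0.
Proof. by rewrite -normc_gt0 normc_nome expR_gt0. Qed.

Lemma nome_real (x : R) : nome (x%:C) = cos (2 * pi * x) +i* sin (2 * pi * x).
Proof. by rewrite /nome/= mulr0 oppr0 expR0 !mul1r. Qed.

Lemma two_piE : 2 * pi = pi *+ 2 :> R.
Proof. by rewrite mulr_natl. Qed.

Lemma nome1 : nome 1 = 1 :> C.
Proof.
by rewrite -[1]/(1%:C) nome_real mulr1 two_piE cos2pi sin2pi.
Qed.

Lemma nome0 : nome 0 = 1 :> C.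
Proof. by rewrite -[0]/(0%:C) nome_real mulr0 cos0 sin0. Qed.

Lemma nomeN t : nome (- t) = (nome t)^-1.
Proof.
by apply: (mulfI (nome_neq0 t)); rewrite mulfV ?nome_neq0// -nomeD subrr nome0.
Qed.

Lemma nomeD1 t : nome (t + 1) = nome t.
Proof. by rewrite nomeD nome1 mulr1. Qed.

Lemma nome_int (n : int) : nome n%:~R = 1 :> C.
Proof.
have H (m : nat) : nome m%:R = 1 :> C.
  by elim: m => [|m IH]; rewrite ?nome0// mulrS addrC nomeD1.
by case: n => n; rewrite ?NegzE ?rmorphN ?nomeN /= H ?invr1.
Qed.

Lemma nome_eq1 t : nome t = 1 -> exists n : int, t = n%:~R.
Proof.
case: t => x y H; have : normc (nome (x +i* y)) = 1 by rewrite H normc_1.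
rewrite normc_nome => yE.
have /expR_inj/eqP : expR (- (2 * pi * y)) = expR 0 by rewrite expR0.
have p20 : 0 < 2 * pi :> R by rewrite mulr_gt0// pi_gt0.
rewrite oppr_eq0 mulf_eq0 gt_eqF//= => /eqP y0.
have := H; rewrite y0 -[x +i* 0]/(x%:C); pose n := Num.floor x.
pose u := x - n%:~R.
have u0 : 0 <= u by rewrite subr_ge0 ge_floor.
have u1 : u < 1 by have := floorD1_gt x; rewrite -/n intrD mulr1z /u; lra.
have -> : x%:C = u%:C + n%:~R :> C.
  by rewrite /u rmorphB/= rmorph_int subrK.
rewrite nomeD nome_int mulr1 nome_real => -[/eqP cu su].
(* For the fractional part u, cos (2 pi u) = 1 forces sin (pi u) = 0, whereas sin (pi u) > 0 for 0 <
   u < 1. *)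
have : sin (pi * u) = 0.
  apply/eqP; rewrite -sqrf_eq0.
  have := cos2Dsin2 (pi * u); have : cos (2 * pi * u) = 1 by exact/eqP.
  have -> : 2 * pi * u = pi * u + pi * u by ring.
  rewrite cosD -!expr2 => h1 h2; apply/eqP; lra.
have [->|un0] := eqVneq u 0; first by exists n; rewrite add0r.
have ugt0 : 0 < u by rewrite lt_def un0.
have : 0 < sin (pi * u).
  by apply: sin_gt0_pi; rewrite mulr_gt0 ?pi_gt0//= gtr_pMr ?pi_gt0.
by move=> /[swap] ->; rewrite ltxx.
Qed.

Lemma nome_inj s t : nome s = nome t -> exists n : int, s = t + n%:~R.
Proof.
move=> st; have [|n nE] := @nome_eq1 (s - t).
  by rewrite nomeD nomeN st mulfV// nome_neq0.
by exists n; rewrite -nE addrC subrK.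
Qed.

Lemma nome_surj (q : C) : q != 0 -> exists t, nome t = q.
Proof.
move=> q0; have n0 : 0 < normc q by rewrite normc_gt0.
pose a := complex.Re q / normc q; pose b := complex.Im q / normc q.
have ab : a ^+ 2 + b ^+ 2 = 1.
  by rewrite !expr_div_n -mulrDl -normc_sqr mulfV// expf_neq0// gt_eqF.
have a1 : -1 <= a <= 1.
  by rewrite -ler_norml -(ler_sqr (normr_ge0 _))// ?nnegrE// expr1n
    real_normK ?num_real// -ab lerDl sqr_ge0.
have [th [ct st]] : exists th, cos th = a /\ sin th = b.
  have sE : sin (acos a) = `|b|.
    by rewrite sin_acos// -ab addrAC subrr add0r sqrtr_sqr.
  have [b0|b0] := leP 0 b.
    by exists (acos a); rewrite acosK// sE ger0_norm.
  exists (- acos a); rewrite cosN sinN acosK// sE ltr0_norm//.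
  by rewrite opprK.
have p0 : 2 * pi != 0 :> R by rewrite mulf_neq0 ?pnatr_eq0// gt_eqF ?pi_gt0.
exists ((th / (2 * pi)) +i* (- (ln (normc q) / (2 * pi)))).
apply/eqP; rewrite eq_complex/= mulrN opprK.
rewrite ![2 * pi * (_ / _)]mulrC !divfK// lnK ?posrE// ct st /a /b.
by apply/andP; split; apply/eqP; field; rewrite gt_eqF.
Qed.

Definition two_pi_i : C := 0 +i* (2 * pi).

Lemma two_pi_i_neq0 : two_pi_i != 0.
Proof.
by rewrite eq_complex/= eqxx/= mulf_neq0 ?pnatr_eq0// gt_eqF ?pi_gt0.
Qed.

Let nome_eps0 (e : R) : 0 < e -> exists2 d : R, 0 < d & forall v, normc v < d ->
  normc (nome v - 1 - v * two_pi_i) <= e * normc v.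
Proof.
move=> e0; pose p : R := 2 * pi.
have p0 : 0 < p by rewrite mulr_gt0// pi_gt0.
(* The error terms below add up to at most e1 |Y| + 6 e1 |X|, and |X| and |Y| are at most p |v|;
   hence the divisor [8 * p]. *)
pose e1 := e / (8 * p).
have e10 : 0 < e1 by rewrite divr_gt0// mulr_gt0.
have e1p : e1 * p = e / 8 by rewrite /e1; field; rewrite gt_eqF.
have [d1 d10 h1] := is_derive_eps (is_derive_expR (0 : R)) e10.
have [d2 d20 h2] := is_derive_eps (is_derive_cos (0 : R)) e10.
have [d3 d30 h3] := is_derive_eps (is_derive_sin (0 : R)) e10.
have [d4 d40 h4] := is_derive_eps (is_derive_expR (0 : R)) ltr01.
pose m := Num.min (Num.min d1 d2) (Num.min d3 (Num.min d4 (Num.min (1/2) e1))).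
have m0 : 0 < m by rewrite !lt_min d10 d20 d30 d40 e10/= divr_gt0.
exists (m / p); first by rewrite divr_gt0.
case=> x y hv; pose X := p * x; pose Y := - (p * y).
have hX : `|X| < m.
  rewrite normrM gtr0_norm// mulrC -ltr_pdivlMr//.
  by apply: le_lt_trans hv; exact: normr_Re (x +i* y).
have hY : `|Y| < m.
  rewrite normrN normrM gtr0_norm// mulrC -ltr_pdivlMr//.
  by apply: le_lt_trans hv; exact: normr_Im (x +i* y).
have [mX1 mX2 mX3] : [/\ `|X| < d2, `|X| < d3 & `|X| < e1].
  by move: hX; rewrite !lt_min => /andP[/andP[_ ->] /and4P[-> _ _ ->]].
have [mY1 mY4 mY5 mY6] : [/\ `|Y| < d1, `|Y| < d4, `|Y| < 1/2 & `|Y| < e1].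
  by move: hY; rewrite !lt_min => /andP[/andP[-> _] /and4P[_ -> -> ->]].
have := h1 Y mY1; have := h2 X mX1; have := h3 X mX2; have := h4 Y mY4.
rewrite !add0r expR0 cos0 sin0 mulr1 oppr0 mulr0 !subr0 addr0 mul1r mulr1 => k4 k3 k2 k1.
set E := expR Y in k1 k4 *; set c := cos X in k2 *; set s := sin X in k3 *.
have EY : `|E - 1| <= 2 * `|Y|.
  by have := ler_normD (E - 1 - Y) Y; rewrite subrK; lra.
have E2 : `|E| <= 2.
  by have := ler_normD (E - 1) 1; rewrite subrK normr1; lra.
have xn : `|X| <= p * normc (x +i* y).
  by rewrite normrM gtr0_norm// ler_pM2l//; exact: normr_Re (x +i* y).
have yn : `|Y| <= p * normc (x +i* y).
  by rewrite normrN normrM gtr0_norm// ler_pM2l//; exact: normr_Im (x +i* y).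
have -> : nome (x +i* y) - 1 - (x +i* y) * two_pi_i =
    ((E - 1 - Y) + E * (c - 1)) +i* (E * (s - X) + (E - 1) * X).
  apply/eqP; rewrite eq_complex/= -/p -/X -/Y -/E -/c -/s /X /Y.
  by apply/andP; split; apply/eqP; ring.
apply: le_trans (normc_eta _ _) _.
have A1 : `|E - 1 - Y + E * (c - 1)| <= e1 * `|Y| + 2 * (e1 * `|X|).
  by apply: le_trans (ler_normD _ _) _; apply: lerD => //; rewrite normrM; apply: ler_pM.
have A2 : `|E * (s - X) + (E - 1) * X| <= 2 * (e1 * `|X|) + (2 * `|Y|) * `|X|.
  by apply: le_trans (ler_normD _ _) _; apply: lerD; rewrite normrM; apply: ler_pM.
have A3 : `|Y| * `|X| <= e1 * `|X| by rewrite ler_wpM2r// ltW.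
have : e1 * `|X| <= e / 8 * normc (x +i* y) by rewrite -e1p -mulrA ler_pM2l//.
have : e1 * `|Y| <= e / 8 * normc (x +i* y) by rewrite -e1p -mulrA ler_pM2l//.
have := normc_ge0 (x +i* y); set N := normc _ => N0.
have : 0 <= e * N by rewrite mulr_ge0// ltW.
lra.
Qed.

Lemma nome_eps w (e : R) : 0 < e -> exists2 d : R, 0 < d & forall v, normc v < d ->
  normc (nome (w + v) - nome w - v * (nome w * two_pi_i)) <= e * normc v.
Proof.
move=> e0; have n0 : 0 < normc (nome w) by rewrite normc_gt0 nome_neq0.
have [|d d0 hd] := @nome_eps0 (e / normc (nome w)); first by rewrite divr_gt0.
exists d => // v vd.
have -> : nome (w + v) - nome w - v * (nome w * two_pi_i) =
  nome w * (nome v - 1 - v * two_pi_i) by rewrite nomeD; ring.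
rewrite normcM -ler_pdivlMl// (le_trans (hd v vd))// mulrA.
by rewrite [_^-1 * e]mulrC.
Qed.

Lemma cdiff_nome w : cdiff (@nome R) w.
Proof. by apply: (@cdiff_of_eps _ _ (nome w * two_pi_i)) => e /(nome_eps w). Qed.

End Nome.

(* Prevents unification from computing with the exponential series. *)
Global Opaque nome.

(** * Cauchy's formula in a periodic strip *)

Section StripCauchy.
Context {R : realType}.
Local Notation C := R[i].
Implicit Types (h k f : C -> C) (w z : C).

Lemma eps_cvg h w (b : C) :
  (forall e : R, 0 < e -> exists2 d : R, 0 < d & forall v, normc v < d ->
    normc (h (w + v) - h w - v * b) <= e * normc v) ->
  (fun v : C^o => v^-1 * (h (w + v) - h w) : C^o) @ (0 : C^o)^' --> (b : C^o).
Proof.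
move=> hb; apply/cvg_rnormP => e e0.
rewrite near_withinE; apply: (near_rnormP (0 : C^o) _).2.
have [d d0 hd] := hb e e0; exists d => // v; rewrite rnormc add0r => vd v0.
rewrite rnormc.
have -> : v^-1 * (h (w + v) - h w) - b = v^-1 * (h (w + v) - h w - v * b).
  by field.
rewrite normcM normcV ler_pdivrMl ?normc_gt0//.
by apply: le_trans (hd v vd) _; rewrite mulrC.
Qed.

Lemma cdiff_near h k w : (exists2 d : R, 0 < d &
    forall v, normc v < d -> h (w + v) = k (w + v)) -> cdiff h w -> cdiff k w.
Proof.
move=> [d d0 hd] [/(@derivable1_diffP C C^o h w) hw]; split.
apply/(@derivable1_diffP C C^o k w).
apply: near_eq_derivable hw; apply: (near_rnormP (w : C^o) _).2.
by exists d.
Qed.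

(** The integral is constant on each side of the line of height [m], and continuity in the height
    carries its value across. This serves the difference quotient of Cauchy's formula, which at its
    removable singularities is only known to be continuous. *)
Lemma periodic_cint_const_off h (c m d : R) : c < m -> m < d ->
  (forall y, c <= y <= d -> h (1 +i* y) = h (0 +i* y)) ->
  (forall x y, 0 <= x <= 1 -> c <= y <= d -> ccontinuous h (x +i* y)) ->
  (forall x y, 0 <= x <= 1 -> c <= y <= d -> y != m -> cdiff h (x +i* y)) ->
  cint 0 1 (fun x => h (x +i* c)) = cint 0 1 (fun x => h (x +i* d)).
Proof.
move=> cm md per hc hd.
pose I s := cint 0 1 (fun x => h (x +i* s)).
have const s t : c <= s -> s <= t -> t <= d -> (t < m) || (m < s) -> I s = I t.
  move=> cs st td out; apply: periodic_cint_const => // [y hy|x y hx hy].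
    by apply: per; lra.
  by apply: hd => //; [lra|apply/eqP => ym; move: out; lra].
have close (e : R) : 0 < e -> exists2 r : R, 0 < r & forall t, `|t - m| < r ->
    c <= t <= d -> normc (I t - I m) <= e.
  move=> e0; have [|r r0 hr] := @near_cint _ h m _ e e0.
    by move=> x hx; apply: hc => //; lra.
  exists r => // t tm tcd; rewrite /I -cintB.
  - apply: le_trans (cint_norm _ _ _) _ => //; last 2 first.
    + exact: hr.
    + by rewrite subr0 mul1r.
    by apply: continB; apply: contin_horizontal => x hx; apply: hc => //; lra.
  - by apply: contin_horizontal => x hx; apply: hc => //; lra.
  - by apply: contin_horizontal => x hx; apply: hc => //; lra.
have eq_of_close (a b : C) : (forall e : R, 0 < e -> normc (a - b) <= e) -> a = b.
  move=> hab; apply/eqP; rewrite -subr_eq0 -normc_eq0 eq_le normc_ge0 andbT.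
  by apply/ler_addgt0Pr => e e0; rewrite add0r; exact: hab.
rewrite -/(I c) -/(I d); transitivity (I m); apply: eq_of_close => e e0.
  have [r r0 hr] := close e e0.
  pose t := Num.max c (m - r / 2).
  have tE : c <= t /\ m - r / 2 <= t by rewrite /t !le_max !lexx orbT.
  have tm : t < m by rewrite /t gt_max cm/=; lra.
  have -> : I c = I t by apply: const => //; lra.
  by apply: hr; rewrite ?ltr_norml; lra.
have [r r0 hr] := close e e0.
pose t := Num.min d (m + r / 2).
have tE : t <= d /\ t <= m + r / 2 by rewrite /t !ge_min !lexx orbT.
have tm : m < t by rewrite /t lt_min md/=; lra.
have <- : I t = I d by apply: const; lra.
by rewrite normcB; apply: hr; rewrite ?ltr_norml; lra.
Qed.

(** The form dq / (2 pi i (q - nome z)) pulled back by q = nome w and divided by dw. *)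
Definition cauchy_kernel z w : C := nome w / (nome w - nome z).

Lemma cauchy_kernelE z w : cauchy_kernel z w = nome w / (nome w - nome z).
Proof. by []. Qed.

Lemma cdiff_cauchy_kernel z w : nome w != nome z -> cdiff (cauchy_kernel z) w.
Proof.
move=> wz; apply: cdiffM; first exact: cdiff_nome.
apply: cdiffV; first by rewrite subr_eq0.
by apply: cdiffB; [exact: cdiff_nome|exact: cdiff_cst].
Qed.

#[global] Opaque cauchy_kernel.

Lemma nome_neq_Im z w : complex.Im w != complex.Im z -> nome w != nome z.
Proof.
apply: contra => /eqP wz; have : normc (nome w) = normc (nome z) by rewrite wz.
rewrite !normc_nome => /expR_inj/oppr_inj/mulfI => ->//.
by rewrite mulf_neq0// gt_eqF// pi_gt0.
Qed.

Lemma cauchy_kernelD1 z w : cauchy_kernel z (w + 1) = cauchy_kernel z w.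
Proof. by rewrite cauchy_kernelE nomeD1. Qed.

Lemma side_periodic h (y : R) :
  (forall w, complex.Im w = y -> h (w + 1) = h w) -> h (1 +i* y) = h (0 +i* y).
Proof.
move=> hp; rewrite -[RHS]hp//; congr h.
by apply/eqP; rewrite eq_complex/= add0r addr0 !eqxx.
Qed.

Lemma contin_kernel z (s : R) : s != complex.Im z ->
  contin 0 1 (fun x => cauchy_kernel z (x +i* s)).
Proof.
move=> sz; apply: contin_horizontal => x hx; apply: cdiff_continuous.
by apply: cdiff_cauchy_kernel; exact: nome_neq_Im.
Qed.

Let kernel_const z (c d : R) : c <= d ->
  (d < complex.Im z) || (complex.Im z < c) ->
  cint 0 1 (fun x => cauchy_kernel z (x +i* c)) =
  cint 0 1 (fun x => cauchy_kernel z (x +i* d)).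
Proof.
move=> cd out; apply: periodic_cint_const; [exact: cd|move=> y hy|move=> x y hx hy].
  by apply: side_periodic => w _; rewrite cauchy_kernelD1.
apply: cdiff_cauchy_kernel; apply: nome_neq_Im => /=.
by apply/eqP => yz; move: out hy; rewrite yz; lra.
Qed.

Lemma eq_of_normc_le (a b : C) : (forall e : R, 0 < e -> normc (a - b) <= e) -> a = b.
Proof.
move=> hab; apply/eqP; rewrite -subr_eq0 -normc_eq0 eq_le normc_ge0 andbT.
by apply/ler_addgt0Pr => e e0; rewrite add0r; exact: hab.
Qed.

(** Below z the integral is independent of the height, and the kernel tends to 1 far down, where
    |nome w| is large. *)
Lemma cint_kernel_below z (s : R) : s < complex.Im z ->
  cint 0 1 (fun x => cauchy_kernel z (x +i* s)) = 1.
Proof.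
move=> sz; apply: eq_of_normc_le => e e0.
have n0 : 0 < normc (nome z) by rewrite normc_gt0 nome_neq0.
have p20 : 0 < 2 * pi :> R by rewrite mulr_gt0// pi_gt0.
(* |nome w| >= K makes |nome z| / |nome w - nome z| at most [e]. *)
pose K := normc (nome z) * (1 + e^-1).
pose t := Num.min s (- K / (2 * pi)).
have [ts tK] : t <= s /\ t <= - K / (2 * pi) by rewrite /t !ge_min !lexx orbT.
have {}tK : K <= expR (- (2 * pi * t)).
  apply: le_trans (expR_ge1Dx _); rewrite -[K]opprK -[K in - - K]opprK.
  by move: tK; rewrite ler_pdivlMr// opprK [_ * t]mulrC; lra.
rewrite -(@kernel_const z t s)//; last by rewrite sz.
have tz : t != complex.Im z by rewrite lt_eqF// (le_lt_trans ts).
have -> : 1 = cint 0 1 (fun=> 1 : C).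
  by rewrite cint_cst// subr0 mul1r.
rewrite -cintB; last 2 first.
- exact: contin_kernel.
- exact: contin_cst.
apply: le_trans (cint_norm (M := e) _ _ _) _ => //.
- by apply: continB; [exact: contin_kernel|exact: contin_cst].
- move=> x hx; set w := x +i* t.
  have wz : nome w != nome z by exact: nome_neq_Im.
  have -> : cauchy_kernel z w - 1 = nome z / (nome w - nome z).
    by rewrite cauchy_kernelE; field; rewrite subr_eq0.
  rewrite normcM normcV ler_pdivrMr ?normc_gt0 ?subr_eq0//.
  have := lerB_normc (nome w) (nome z); rewrite normc_nome => H.
  rewrite -ler_pdivrMl//; apply: le_trans H; rewrite lerBrDr.
  by apply: le_trans tK; rewrite /K mulrDr mulr1 addrC [_ * e^-1]mulrC.
- by rewrite subr0 mul1r.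
Qed.

(** Above z the integral is again independent of the height, and the kernel tends to 0 together with
    nome w. *)
Lemma cint_kernel_above z (s : R) : complex.Im z < s ->
  cint 0 1 (fun x => cauchy_kernel z (x +i* s)) = 0.
Proof.
move=> sz; apply: eq_of_normc_le => e e0; rewrite subr0.
have n0 : 0 < normc (nome z) by rewrite normc_gt0 nome_neq0.
have p20 : 0 < 2 * pi :> R by rewrite mulr_gt0// pi_gt0.
pose K := (1 + e^-1) / normc (nome z).
pose t := Num.max s (K / (2 * pi)).
have [ts tK] : s <= t /\ K / (2 * pi) <= t by rewrite /t !le_max !lexx orbT.
have {}tK : K <= expR (2 * pi * t).
  apply: le_trans (expR_ge1Dx _).
  by move: tK; rewrite ler_pdivrMr// [t * _]mulrC; lra.
rewrite (@kernel_const z s t)//; last by rewrite sz orbT.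
have tz : t != complex.Im z by rewrite gt_eqF// (lt_le_trans sz).
apply: le_trans (cint_norm (M := e) _ _ _) _ => //.
- exact: contin_kernel.
- move=> x hx; set w := x +i* t.
  have wz : nome w != nome z by exact: nome_neq_Im.
  rewrite cauchy_kernelE normcM normcV ler_pdivrMr ?normc_gt0 ?subr_eq0//.
  have := lerB_normc (nome z) (nome w); rewrite normcB => H.
  rewrite -ler_pdivrMl//; apply: le_trans H; rewrite lerBrDr.
  rewrite -[X in _ + X]mul1r -mulrDl [_ + 1]addrC normc_nome expRN/=.
  by rewrite ler_pdivrMr ?expR_gt0// -ler_pdivrMl// mulrC.
- by rewrite subr0 mul1r.
Qed.

End StripCauchy.

Section StripCauchyFormula.
Context {R : realType}.
Local Notation C := R[i].
Implicit Types (h k f : C -> C) (w z : C).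

Section Formula.
Variables (f : C -> C) (s1 s2 : R) (z : C).
Hypotheses (s1z : s1 < complex.Im z) (zs2 : complex.Im z < s2).
Hypothesis fper : forall w, s1 <= complex.Im w <= s2 -> f (w + 1) = f w.
Hypothesis fdiff : forall w, s1 <= complex.Im w <= s2 -> cdiff f w.

Let fperZ w (n : int) : s1 <= complex.Im w <= s2 -> f (w + n%:~R) = f w.
Proof.
have H (m : nat) v : s1 <= complex.Im v <= s2 -> f (v + m%:R) = f v.
  elim: m v => [|m IH] v vs; first by rewrite addr0.
  have ImE : complex.Im (v + m%:R) = complex.Im v.
    by rewrite raddfD/= (_ : complex.Im m%:R = 0) ?addr0// -[m%:R](rmorph_nat (real_complex R)).
  by rewrite -natr1 addrA fper ?ImE// IH.
case: n => n ws; first exact: H.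
have ImE : complex.Im (w + (Negz n)%:~R) = complex.Im w.
  rewrite raddfD/= (_ : complex.Im (Negz n)%:~R = 0) ?addr0//.
  by rewrite -[(Negz n)%:~R](rmorph_int (real_complex R)).
rewrite -(H n.+1 (w + _)) ?ImE//; congr f.
by rewrite NegzE rmorphN/= subrK.
Qed.

Let nz := nome z.
(** The difference quotient of [f] in the coordinate nome, times nome w; its value at z and its
    integer translates is the limit f'(z) / (2 pi i), so that [g] is continuous on the strip. *)
Let g w : C := if nome w == nz then derive1 (f : C^o -> C^o) z / two_pi_i
  else (f w - f z) * cauchy_kernel z w.

Let g_off w : nome w != nz -> g w = (f w - f z) * cauchy_kernel z w.
Proof. by rewrite /g => /negbTE ->. Qed.

Let g_diff w : s1 <= complex.Im w <= s2 -> nome w != nz -> cdiff g w.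
Proof.
move=> ws wz; apply: (@cdiff_near _ (fun w => (f w - f z) * cauchy_kernel z w)).
  have e0 : 0 < normc (nome w - nz) / 2 by rewrite divr_gt0// normc_gt0 subr_eq0.
  have [d d0 hd] := (ccontinuous_eps _ _).1 (cdiff_continuous (cdiff_nome w)) _ e0.
  exists d => // v /hd H; rewrite g_off//; apply/eqP => E.
  by move: H e0; rewrite E normcB; lra.
apply: cdiffM; last exact: cdiff_cauchy_kernel.
by apply: cdiffB; [exact: fdiff|exact: cdiff_cst].
Qed.

Let g_per w (n : int) : s1 <= complex.Im w <= s2 -> g (w + n%:~R) = g w.
Proof.
by move=> ws; rewrite /g !cauchy_kernelE nomeD nome_int mulr1 fperZ.
Qed.

Let g_cont_z : ccontinuous g z.
Proof.
have zs : s1 <= complex.Im z <= s2 by rewrite !ltW.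
have fz : (fun v : C^o => v^-1 * (f (z + v) - f z) : C^o) @ (0 : C^o)^' -->
    (derive1 (f : C^o -> C^o) z : C^o).
  apply: eps_cvg => e e0.
  have [d d0 hd] := differentiable_eps (cdiffW (fdiff zs)) e0; exists d => // v vd.
  by have := hd v vd; rewrite !rnormc diff1E//; exact: cdiffW (fdiff zs).
have nz' : (fun v : C^o => v^-1 * (nome (z + v) - nome z) : C^o) @ (0 : C^o)^' -->
    (nome z * two_pi_i : C^o) by apply: eps_cvg => e; exact: nome_eps.
have n0 : (fun v : C^o => nome (z + v) : C^o) @ (0 : C^o)^' --> (nome z : C^o).
  apply/cvg_rnormP => e e0; rewrite near_withinE; apply: (near_rnormP (0 : C^o) _).2.
  have [d d0 hd] := (ccontinuous_eps _ _).1 (cdiff_continuous (cdiff_nome z)) e e0.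
  by exists d => // v vd _; rewrite add0r; exact: hd.
have D0 : nome z * two_pi_i != 0 :> C by rewrite mulf_neq0 ?nome_neq0 ?two_pi_i_neq0.
have : (fun v : C^o => (v^-1 * (f (z + v) - f z)) *
   (nome (z + v) * (v^-1 * (nome (z + v) - nome z))^-1) : C^o) @ (0 : C^o)^' -->
   (derive1 (f : C^o -> C^o) z * (nome z * (nome z * two_pi_i)^-1) : C^o).
  apply: (@cvgM C); [exact: fz|apply: (@cvgM C); [exact: n0|]].
  by apply: (@cvgV C); [exact: D0|exact: nz'].
move=> /cvg_rnormP H; apply/ccontinuous_eps => e e0.
have := H e e0; rewrite near_withinE => /(near_rnormP (0 : C^o) _).1[d d0 hd].
exists d => // v vd; have -> : g z = derive1 (f : C^o -> C^o) z / two_pi_i.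
  by rewrite /g eqxx.
have [E|NE] := eqVneq (nome (z + v)) nz.
  by rewrite /g E eqxx subrr normc_0 ltW.
have v0 : v != 0 by apply: contra NE => /eqP->; rewrite addr0.
have := hd v vd; rewrite rnormc add0r => /(_ v0).
rewrite g_off// cauchy_kernelE.
have -> : derive1 (f : C^o -> C^o) z * (nome z * (nome z * two_pi_i)^-1) =
    derive1 (f : C^o -> C^o) z / two_pi_i.
  by field; rewrite two_pi_i_neq0 nome_neq0.
suff -> : v^-1 * (f (z + v) - f z) *
    (nome (z + v) * (v^-1 * (nome (z + v) - nome z))^-1) =
    (f (z + v) - f z) * (nome (z + v) / (nome (z + v) - nome z)) by [].
by field; rewrite v0 subr_eq0 NE.
Qed.

Let g_cont w : s1 <= complex.Im w <= s2 -> ccontinuous g w.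
Proof.
move=> ws; have [wz|wz] := eqVneq (nome w) nz; last exact/cdiff_continuous/g_diff.
have zs : s1 <= complex.Im z <= s2 by rewrite !ltW.
have [n wE] := nome_inj wz.
apply/ccontinuous_eps => e e0.
have [d d0 hd] := (ccontinuous_eps _ _).1 g_cont_z e e0.
(* Keeps z + v in the strip, where [g] is periodic; continuity at the translate w = z + n then
   reduces to continuity at z. *)
pose d' := Num.min d (Num.min (complex.Im z - s1) (s2 - complex.Im z)).
exists d'; first by rewrite !lt_min d0 !subr_gt0 s1z zs2.
move=> v; rewrite !lt_min => /and3P[vd v1 v2].
rewrite wE addrAC !g_per//; first exact: hd.
by have := normr_Im v; rewrite ler_norml raddfD/=; lra.
Qed.

(** [g] has the same integral on both lines. Expanding (f w - f z) times the kernel leaves f z times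
    the integrals of the kernel, which are 1 on the lower line and 0 on the upper one. *)
Lemma strip_cauchy : f z =
  cint 0 1 (fun x => f (x +i* s1) * cauchy_kernel z (x +i* s1)) -
  cint 0 1 (fun x => f (x +i* s2) * cauchy_kernel z (x +i* s2)).
Proof.
have H : cint 0 1 (fun x => g (x +i* s1)) = cint 0 1 (fun x => g (x +i* s2)).
  apply: (@periodic_cint_const_off _ g s1 (complex.Im z) s2) => //.
  - move=> y hy; apply: side_periodic => w wy.
    by rewrite -[1]/(1%:~R) g_per// wy.
  - by move=> x y hx hy; exact: g_cont.
  - by move=> x y hx hy yz; apply: g_diff => //; exact: nome_neq_Im.
have E s : s1 <= s <= s2 -> s != complex.Im z ->
    cint 0 1 (fun x => g (x +i* s)) =
    cint 0 1 (fun x => f (x +i* s) * cauchy_kernel z (x +i* s)) -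
    f z * cint 0 1 (fun x => cauchy_kernel z (x +i* s)).
  move=> hs sz.
  have fc : contin 0 1 (fun x => f (x +i* s)).
    by apply: contin_horizontal => x hx; apply: cdiff_continuous; exact: fdiff.
  have kc := contin_kernel sz.
  rewrite -(cintZ (f z) kc) -(cintB (continM fc kc) (continM (contin_cst _ _ (f z)) kc)).
  apply: eq_cint => x hx; rewrite g_off; last exact: nome_neq_Im.
  by rewrite mulrBl.
have s12 : s1 <= s2 by exact: ltW (lt_trans s1z zs2).
have h1 : s1 <= s1 <= s2 by apply/andP; split; [exact: lexx|exact: s12].
have h2 : s1 <= s2 <= s2 by apply/andP; split; [exact: s12|exact: lexx].
move: H; rewrite (E _ h1 (negbT (lt_eqF s1z))) (E _ h2 (negbT (gt_eqF zs2))).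
rewrite (cint_kernel_below s1z).
rewrite (cint_kernel_above zs2).
have aux (a b c : C) : a - c * 1 = b - c * 0 -> c = a - b.
  move=> ab; have -> : a - b = a - (b - c * 0) by ring.
  by rewrite -ab; ring.
exact: aux.
Qed.

End Formula.

(* As the upper line rises, nome w tends to 0 on it and its integral in strip_cauchy vanishes. *)
Lemma halfplane_cauchy f (s B : R) z : s < complex.Im z ->
  (forall w, s <= complex.Im w -> f (w + 1) = f w) ->
  (forall w, s <= complex.Im w -> cdiff f w) ->
  (exists T, forall w, T <= complex.Im w -> normc (f w) <= B) ->
  f z = cint 0 1 (fun x => f (x +i* s) * cauchy_kernel z (x +i* s)).
Proof.
move=> sz fper fdiff [T fB]; apply: eq_of_normc_le => e e0.
have n0 : 0 < normc (nome z) by rewrite normc_gt0 nome_neq0.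
have p20 : 0 < 2 * pi :> R by rewrite mulr_gt0// pi_gt0.
have B0 : 0 <= B by apply: le_trans (normc_ge0 (f (T *i))) (fB _ _) => /=.
pose d := e / (B + 1).
have d0 : 0 < d by rewrite divr_gt0// ltr_wpDl.
pose K := (1 + d^-1) / normc (nome z).
pose t := Num.max (Num.max T (complex.Im z + 1)) (K / (2 * pi)).
have [tT tz tK] : [/\ T <= t, complex.Im z + 1 <= t & K / (2 * pi) <= t].
  by rewrite /t !le_max !lexx !orbT.
have {}tK : K <= expR (2 * pi * t).
  apply: le_trans (expR_ge1Dx _).
  by move: tK; rewrite ler_pdivrMr// [t * _]mulrC; lra.
have zt : complex.Im z < t by lra.
rewrite (@strip_cauchy f s t z sz zt); last 2 first.
- by move=> w /andP[sw _]; exact: fper.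
- by move=> w /andP[sw _]; exact: fdiff.
rewrite addrAC subrr add0r normcN.
have kc := contin_kernel (z := z) (s := t) _.
apply: le_trans (cint_norm (M := e) _ _ _) _ => //.
- apply: continM; last by apply: contin_kernel; rewrite gt_eqF.
  apply: contin_horizontal => x hx; apply/cdiff_continuous/fdiff => /=.
  by rewrite ltW// (lt_trans sz).
- move=> x hx; set w := x +i* t.
  have wz : nome w != nome z by apply: nome_neq_Im; rewrite gt_eqF.
  rewrite normcM; have -> : e = (B + 1) * d by rewrite /d mulrC divfK// gt_eqF// ltr_wpDl.
  rewrite ler_pM ?normc_ge0//.
    by apply: le_trans (fB _ _) _ => //; lra.
  rewrite cauchy_kernelE normcM normcV ler_pdivrMr ?normc_gt0 ?subr_eq0//.
  have := lerB_normc (nome z) (nome w); rewrite normcB => H.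
  rewrite -ler_pdivrMl//; apply: le_trans H; rewrite lerBrDr.
  rewrite -[X in _ + X]mul1r -mulrDl [_ + 1]addrC normc_nome expRN/=.
  by rewrite ler_pdivrMr ?expR_gt0// -ler_pdivrMl// mulrC.
- by rewrite subr0 mul1r.
Qed.

End StripCauchyFormula.

(** * Taylor expansions in a disc *)

Section Disc.
Context {R : realType}.
Local Notation C := R[i].
Implicit Types (F : C -> C) (s w : C).

Definition circle (r x : R) : C := r%:C * nome (x%:C).

Lemma normc_circle (r x : R) : 0 < r -> normc (circle r x) = r.
Proof.
move=> r0; rewrite /circle normcM normc_real normc_nome /= mulr0 oppr0 expR0 mulr1.
by rewrite gtr0_norm.
Qed.

Lemma circle_neq0 (r x : R) : 0 < r -> circle r x != 0.
Proof. by move=> r0; rewrite -normc_gt0 normc_circle. Qed.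

Lemma circle_neq (r x : R) s : normc s < r -> circle r x != s.
Proof.
move=> sr; apply: contraTneq sr => <-.
rewrite -leNgt; have [r0|r0] := ltP 0 r; first by rewrite normc_circle.
exact: le_trans r0 (normc_ge0 _).
Qed.

Lemma circle_continuous (r : R) : continuous (circle r : R -> C^o).
Proof.
move=> x; apply: (@continuous_comp R C^o C^o (fun x : R => x%:C) (fun w => r%:C * nome w)).
  exact: continuous_real_complex.
have : cdiff (fun w => r%:C * nome w) x%:C.
  by apply: cdiffM; [exact: cdiff_cst|exact: cdiff_nome].
by move=> /cdiff_continuous/ccontinuousW.
Qed.

Lemma contin_circle (r : R) F a b :
  (forall x, ccontinuous F (circle r x)) -> contin a b (fun x => F (circle r x)).
Proof.
move=> Fc; split=> x _.
apply: (@continuous_comp R C^o C^o (circle r) F); first exact: circle_continuous.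
exact: ccontinuousW.
Qed.

(** The map t |-> r nome t sends the segment [0, 1] onto the circle and the upper half plane onto
    the punctured disc, so that [halfplane_cauchy] applies. The centre is not a value of the nome:
    there the horizontal integral, independent of the height, tends to F 0. *)
Lemma disc_cauchy F (r : R) s : normc s < r ->
  (forall w, normc w <= r -> cdiff F w) ->
  F s = cint 0 1 (fun x => F (circle r x) * (circle r x / (circle r x - s))).
Proof.
move=> sr Fd; have r0 : 0 < r by exact: le_lt_trans (normc_ge0 _) sr.
have p20 : 0 < 2 * pi :> R by rewrite mulr_gt0// pi_gt0.
pose f t := F (r%:C * nome t).
have nr t : 0 <= complex.Im t -> normc (r%:C * nome t) <= r.
  move=> t0; rewrite normcM normc_real gtr0_norm// ger_pMr// normc_nome.
  by rewrite -[X in _ <= X]expR0 ler_expR oppr_le0 mulr_ge0// ltW.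
have fper w : f (w + 1) = f w by rewrite /f nomeD1.
have fd t : 0 <= complex.Im t -> cdiff f t.
  move=> t0; apply: cdiff_comp; last exact/Fd/nr.
  by apply: cdiffM; [exact: cdiff_cst|exact: cdiff_nome].
have near0 (e : R) : 0 < e -> exists T, forall t, T <= complex.Im t ->
    normc (f t - F 0) <= e.
  move=> e0; have F0 : cdiff F 0 by apply: Fd; rewrite normc_0 ltW.
  have [d d0 hd] := (ccontinuous_eps _ _).1 (cdiff_continuous F0) e e0.
  pose K := r / d + 1; exists (K / (2 * pi)) => t tK.
  have K0 : 0 < K by rewrite ltr_wpDl// divr_ge0// ltW.
  have -> : f t = F (0 + r%:C * nome t) by rewrite add0r.
  apply: hd.
  rewrite normcM normc_real gtr0_norm// normc_nome expRN ltr_pdivrMr ?expR_gt0//.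
  rewrite -ltr_pdivrMl// mulrC; apply: lt_le_trans (expR_ge1Dx _).
  move: tK; rewrite ler_pdivrMr// [_ * (2 * pi)]mulrC /K; lra.
have kE x : (x +i* 0) = x%:C :> C by [].
have [s0|s0] := eqVneq s 0.
  rewrite s0 (@eq_cint _ 0 1 _ (fun x => f (x +i* 0))); last first.
    by move=> x _; rewrite subr0 mulfV ?mulr1 ?circle_neq0.
  apply: eq_of_normc_le => e e0; have [T hT] := near0 e e0.
  pose t := Num.max 0 T.
  have [t0 tT] : 0 <= t /\ T <= t by rewrite /t !le_max !lexx orbT.
  rewrite (@periodic_cint_const _ f 0 t t0); last 2 first.
  - by move=> y _; apply: side_periodic => w _; exact: fper.
  - by move=> x y _ /andP[y0 _]; exact: fd.
  have fc : contin 0 1 (fun x => f (x +i* t)).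
    by apply: contin_horizontal => x _; apply/cdiff_continuous/fd.
  have -> : F 0 = cint 0 1 (fun=> F 0) by rewrite cint_cst// subr0 mul1r.
  rewrite -(cintB (contin_cst _ _ _) fc).
  apply: le_trans (cint_norm (M := e) _ _ _) _; first exact: ler01.
  - by apply: continB; [exact: contin_cst|exact: fc].
  - by move=> x _; rewrite normcB; apply: hT.
  - by rewrite subr0 mul1r.
have rC : r%:C != 0 :> C by rewrite -normc_gt0 normc_real gtr0_norm.
have [z zE] := @nome_surj R (s / r%:C) (mulf_neq0 s0 (invr_neq0 rC)).
have z0 : 0 < complex.Im z.
  have : normc (nome z) < 1.
    by rewrite zE normcM normcV normc_real gtr0_norm// ltr_pdivrMr// mul1r.
  by rewrite normc_nome -[X in _ < X]expR0 ltr_expR oppr_lt0 pmulr_rgt0.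
have [T hT] := near0 1 ltr01.
have sE : s = r%:C * nome z by rewrite zE mulrC divfK.
rewrite {1}sE -[LHS]/(f z).
rewrite (@halfplane_cauchy _ f 0 (normc (F 0) + 1) z z0); last 3 first.
- by move=> w _; exact: fper.
- by move=> w; exact: fd.
- exists T => w /hT H; rewrite -(subrK (F 0) (f w)) addrC.
  by apply: le_trans (normcD _ _) _; rewrite lerD2l.
apply: eq_cint => x _; rewrite cauchy_kernelE sE -[circle r x]/(r%:C * nome (x +i* 0)).
congr (_ * _); rewrite -mulrBr invfM mulrACA mulfV// mul1r//.
Qed.

Definition taylor_rem F (r : R) (d : nat) s : C :=
  cint 0 1 (fun x => F (circle r x) * circle r x ^- d * (circle r x / (circle r x - s))).

Definition cauchy_coef F (r : R) (j : nat) : C :=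
  cint 0 1 (fun x => F (circle r x) * circle r x ^- j).

Section Taylor.
Variables (F : C -> C) (r : R).
Hypotheses (r0 : 0 < r) (Fd : forall w, normc w <= r -> cdiff F w).

Let cF x : ccontinuous F (circle r x).
Proof. by apply/cdiff_continuous/Fd; rewrite normc_circle. Qed.

Lemma cdiff_expV (d : nat) w : w != 0 -> cdiff (fun w => w ^- d) w.
Proof.
move=> w0; elim: d => [|d IH].
  have -> : (fun w => w ^- 0) = (fun=> 1 : C) by apply/funext => u; rewrite expr0 invr1.
  exact: cdiff_cst.
have -> : (fun w => w ^- d.+1) = (fun w => w ^- d * w^-1).
  by apply/funext => u; rewrite exprSr invfM mulrC.
apply: cdiffM; first exact: IH.
by apply: cdiffV; [exact: w0|exact: cdiff_id].
Qed.

Lemma contin_coef (j : nat) : contin 0 1 (fun x => F (circle r x) * circle r x ^- j).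
Proof.
apply: continM; first exact: contin_circle.
apply: (@contin_circle r (fun w => w ^- j)) => x.
by apply/cdiff_continuous/cdiff_expV; rewrite circle_neq0.
Qed.

Lemma contin_rem (d : nat) s : normc s < r ->
  contin 0 1 (fun x => F (circle r x) * circle r x ^- d *
    (circle r x / (circle r x - s))).
Proof.
move=> sr; apply: continM; first exact: contin_coef.
apply: (@contin_circle r (fun w => w / (w - s))) => x; apply: cdiff_continuous.
apply: cdiffM; first exact: cdiff_id.
apply: cdiffV; first by rewrite subr_eq0 circle_neq.
by apply: cdiffB; [exact: cdiff_id|exact: cdiff_cst].
Qed.

(** One step of the geometric series: c / (c - s) = 1 + (s / c) (c / (c - s)). *)
Lemma taylor_remS (d : nat) s : normc s < r ->
  taylor_rem F r d s = cauchy_coef F r d + s * taylor_rem F r d.+1 s.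
Proof.
move=> sr; rewrite /taylor_rem /cauchy_coef -(cintZ s (contin_rem d.+1 sr)).
rewrite -(cintD (contin_coef d)); last first.
  by apply: continM; [exact: contin_cst|exact: contin_rem].
apply: eq_cint => x _; rewrite exprS.
by field; rewrite expf_neq0 ?circle_neq0// subr_eq0 circle_neq.
Qed.

Lemma disc_taylor (d : nat) s : normc s < r ->
  F s = \sum_(j < d) cauchy_coef F r j * s ^+ j + s ^+ d * taylor_rem F r d s.
Proof.
move=> sr; elim: d => [|d ->].
  rewrite big_ord0 add0r expr0 mul1r (disc_cauchy sr Fd) /taylor_rem.
  by apply: eq_cint => x _; rewrite expr0 invr1 mulr1.
rewrite big_ord_recr/= taylor_remS// mulrDr addrA; congr (_ + _ + _).
  by rewrite mulrC.
by rewrite exprSr mulrA.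
Qed.

Variable M : R.
Hypothesis FM : forall x, normc (F (circle r x)) <= M.

Lemma cauchy_coef_bound (j : nat) : normc (cauchy_coef F r j) <= M / r ^+ j.
Proof.
apply: le_trans (cint_norm (M := M / r ^+ j) _ _ _) _; first exact: ler01.
- exact: contin_coef.
- move=> x _; rewrite normcM normcV normcX normc_circle//.
  by rewrite ler_wpM2r// invr_ge0 exprn_ge0// ltW.
- by rewrite subr0 mul1r.
Qed.

Lemma taylor_rem_bound (d : nat) s : normc s <= r / 2 ->
  normc (taylor_rem F r d s) <= 2 * M / r ^+ d.
Proof.
move=> sr; have sr' : normc s < r by have := r0; lra.
apply: le_trans (cint_norm (M := 2 * M / r ^+ d) _ _ _) _; first exact: ler01.
- exact: contin_rem.
- move=> x _; rewrite normcM (normcM (F _)) (normcM (circle r x)) !normcV normcX normc_circle//.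
  have M0 : 0 <= M by apply: le_trans (normc_ge0 _) (FM x).
  have H : r / normc (circle r x - s) <= 2.
    rewrite ler_pdivrMr ?normc_gt0 ?subr_eq0 ?circle_neq//.
    by have := lerB_normc (circle r x) s; rewrite normc_circle//; lra.
  have H2 : normc (F (circle r x)) / r ^+ d <= M / r ^+ d.
    by rewrite ler_wpM2r// invr_ge0 exprn_ge0// ltW.
  have -> : 2 * M / r ^+ d = M / r ^+ d * 2 by ring.
  have rd0 : 0 <= r ^+ d by rewrite exprn_ge0// ltW.
  have rn0 : 0 <= r by exact: ltW.
  apply: ler_pM; [|apply: divr_ge0|exact: H2|exact: H] => //; last exact: normc_ge0.
  by apply: divr_ge0 => //; exact: normc_ge0.
- by rewrite subr0 mul1r.
Qed.

Lemma derive1_coef : derive1 (F : C^o -> C^o) 0 = cauchy_coef F r 1.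
Proof.
have H : (fun v : C^o => v^-1 * (F (0 + v) - F 0) : C^o) @ (0 : C^o)^' -->
    (cauchy_coef F r 1 : C^o).
  have F0 : F 0 = cauchy_coef F r 0.
    by rewrite (disc_taylor 1) ?normc_0// big_ord1 expr0 mulr1 expr1 mul0r addr0.
  apply: eps_cvg => e e0.
  have M0 : 0 <= M by apply: le_trans (normc_ge0 _) (FM 0).
  pose K := 2 * M / r ^+ 2 + 1.
  have K0 : 0 < K.
    rewrite ltr_wpDl//; apply: divr_ge0; first exact: mulr_ge0.
    by rewrite exprn_ge0// ltW.
  exists (Num.min (r / 2) (e / K)); first by rewrite lt_min !divr_gt0.
  move=> v; rewrite lt_min => /andP[vr vK]; rewrite add0r.
  have vr' : normc v < r by have := r0; lra.
  rewrite (disc_taylor 2 vr') !big_ord_recl big_ord0/= F0 expr0 mulr1 addr0.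
  have -> : cauchy_coef F r 0 + cauchy_coef F r 1 * v ^+ 1 +
      v ^+ 2 * taylor_rem F r 2 v - cauchy_coef F r 0 - v * cauchy_coef F r 1 =
      v * (v * taylor_rem F r 2 v) by ring.
  rewrite !normcM mulrC ler_wpM2r ?normc_ge0//.
  have := taylor_rem_bound 2 (ltW vr) => H.
  have : normc v * K <= e by rewrite -ler_pdivlMr// ltW.
  apply: le_trans; apply: ler_wpM2l; first exact: normc_ge0.
  by apply: le_trans H _; rewrite /K lerDl.
rewrite /derive1; apply/cvg_lim => //.
suff -> : (fun h : C^o => h^-1 *: (F (h + 0) - F 0) : C^o) =
   (fun v : C^o => v^-1 * (F (0 + v) - F 0) : C^o) by exact: H.
by apply/funext => v; rewrite addr0 add0r.
Qed.

End Taylor.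
End Disc.

(** * Holomorphic functions on normed spaces *)

Section Slices.
Context {R : realType}.
Local Notation C := R[i].
Context {V : normedModType C}.
Implicit Types (phi : V -> C) (x v h : V).

Definition slice phi x v : C -> C := fun s => phi (x + s *: v).

Record holo phi x : Prop := Holo { holoW : differentiable (phi : V -> C^o) x }.

Lemma holo_eps phi x : holo phi x -> forall e : R, 0 < e ->
  exists2 d : R, 0 < d & forall h, rnorm h < d -> normc (phi (x + h) - phi x) <= e.
Proof. by case=> /differentiable_continuous/(@continuous_epsP R V C^o). Qed.

Lemma rnorm_eq0 v : rnorm v = 0 -> v = 0.
Proof. by move=> v0; apply/eqP; rewrite -normr_eq0 normv_rnorm v0. Qed.

Lemma cdiff_slice phi x v s : holo phi (x + s *: v) -> cdiff (slice phi x v) s.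
Proof.
case=> hx; split.
apply: (@differentiable_comp C C^o V C^o (fun s : C^o => x + s *: v) phi); last exact: hx.
apply: differentiableD; first exact: differentiable_cst.
by apply: (@differentiableZl C C^o V id v s); exact: ex_diff.
Qed.

Lemma derive_slice phi x v s :
  'D_v (phi : V -> C^o) (x + s *: v) = derive1 (slice phi x v : C^o -> C^o) s.
Proof.
rewrite /derive /derive1.
suff -> : (fun h : C => h^-1 *: (((phi : V -> C^o) \o shift (x + s *: v)) (h *: v) -
      phi (x + s *: v))) =
    (fun h : C => h^-1 *: (slice phi x v (h + s) - slice phi x v s : C^o)) by [].
by apply/funext => h /=; rewrite /slice addrCA -scalerDl.
Qed.

Lemma derive_slice0 phi x v :
  'D_v (phi : V -> C^o) x = derive1 (slice phi x v : C^o -> C^o) 0.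
Proof. by rewrite -derive_slice scale0r addr0. Qed.

Section LocallyBounded.
Variables (phi : V -> C) (x : V) (r M : R).
Hypotheses (r0 : 0 < r) (hd : forall y, rnorm (y - x) < r -> holo phi y)
  (hM : forall y, rnorm (y - x) < r -> normc (phi y) <= M).

Let M0 : 0 <= M.
Proof. by apply: le_trans (normc_ge0 _) (hM _ : normc (phi x) <= M); rewrite subrr rnorm0. Qed.

Let slice_ball v s (q : R) : 0 < rnorm v -> q = r / (2 * rnorm v) -> normc s <= q ->
  rnorm (x + s *: v - x) < r.
Proof.
move=> v0 -> sr; rewrite addrAC subrr add0r rnormZ.
have : normc s * rnorm v <= r / (2 * rnorm v) * rnorm v by rewrite ler_wpM2r// ltW.
by rewrite invfM mulrA divfK ?gt_eqF//; have := r0; lra.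
Qed.

Lemma derive_bound v : normc ('D_v (phi : V -> C^o) x) <= 2 * M / r * rnorm v.
Proof.
have [v0|v0] := eqVneq (rnorm v) 0.
  by rewrite (rnorm_eq0 v0) derive0 normc_0 rnorm0 mulr0.
have {}v0 : 0 < rnorm v by rewrite lt_def v0 rnorm_ge0.
pose q := r / (2 * rnorm v); have q0 : 0 < q by rewrite divr_gt0// mulr_gt0.
have Fd w : normc w <= q -> cdiff (slice phi x v) w.
  by move=> wq; apply/cdiff_slice/hd/(slice_ball v0 erefl).
have FM t : normc (slice phi x v (circle q t)) <= M.
  by apply/hM/(slice_ball v0 erefl); rewrite normc_circle.
rewrite derive_slice0 (derive1_coef q0 Fd FM).
apply: le_trans (cauchy_coef_bound q0 Fd FM 1) _.
suff -> : M / q ^+ 1 = 2 * M / r * rnorm v by [].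
by rewrite /q; field; rewrite !gt_eqF.
Qed.

(** One-variable Taylor expansion at s = 1 on the slice through [h], in a disc of radius q = r / (2
    |h|): the remainder 2 M / q^2 is quadratic in |h|. The constant depends on r and M only, which
    allows integration over a parameter. *)
Lemma first_order h : rnorm h < r / 4 ->
  normc (phi (x + h) - phi x - 'D_h (phi : V -> C^o) x) <= 8 * M / r ^+ 2 * rnorm h ^+ 2.
Proof.
move=> hr; have [v0|v0] := eqVneq (rnorm h) 0.
  by rewrite (rnorm_eq0 v0) derive0 addr0 subrr subr0 normc_0 rnorm0 expr0n mulr0.
have {}v0 : 0 < rnorm h by rewrite lt_def v0 rnorm_ge0.
pose q := r / (2 * rnorm h); have q0 : 0 < q by rewrite divr_gt0// mulr_gt0.
have Fd w : normc w <= q -> cdiff (slice phi x h) w.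
  by move=> wq; apply/cdiff_slice/hd/(slice_ball v0 erefl).
have FM t : normc (slice phi x h (circle q t)) <= M.
  by apply/hM/(slice_ball v0 erefl); rewrite normc_circle.
have q2 : normc (1 : C) <= q / 2.
  rewrite normc_1 /q -mulrA -invfM ler_pdivlMr ?mulr_gt0//; lra.
rewrite derive_slice0 (derive1_coef q0 Fd FM).
have n1 : normc (1 : C) < q by move: q2; rewrite normc_1; lra.
have n0 : normc (0 : C) < q by rewrite normc_0.
have E1 : phi (x + h) = cauchy_coef (slice phi x h) q 0 +
    cauchy_coef (slice phi x h) q 1 + taylor_rem (slice phi x h) q 2 1.
  rewrite -[phi _]/(phi (x + h)) -[h in LHS](scale1r h) -[LHS]/(slice phi x h 1).
  by rewrite (disc_taylor q0 Fd 2 n1) !big_ord_recl big_ord0/= expr0 !expr1n; ring.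
have E0 : phi x = cauchy_coef (slice phi x h) q 0.
  rewrite -[x in LHS]addr0 -[0 in LHS](scale0r h) -[LHS]/(slice phi x h 0).
  by rewrite (disc_taylor q0 Fd 1 n0) big_ord1 expr0 expr1; ring.
rewrite E1 E0; set a0 := cauchy_coef _ _ 0; set a1 := cauchy_coef _ _ 1.
have -> : a0 + a1 + taylor_rem (slice phi x h) q 2 1 - a0 - a1 =
  taylor_rem (slice phi x h) q 2 1 by ring.
apply: le_trans (taylor_rem_bound q0 Fd FM 2 q2) _.
suff -> : 2 * M / q ^+ 2 = 8 * M / r ^+ 2 * rnorm h ^+ 2 by [].
by rewrite /q; field; rewrite !gt_eqF.
Qed.

End LocallyBounded.

Lemma linear_ex (L : V -> C^o) : linear L -> exists L' : {linear V -> C^o}, L' =1 L.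
Proof.
move=> Ll; pose Lm := GRing.isLinear.Build C V C^o *:%R L Ll.
by exists (HB.pack L Lm : {linear V -> C^o}).
Qed.

Lemma contin_uniform (f : R -> C) a b :
  (forall e : R, 0 < e -> exists2 g : R -> C, contin a b g &
    forall t, normc (f t - g t) <= e) -> contin a b f.
Proof.
move=> fg; split=> t tab; apply/cvg_rnormP => e e0.
have [|g gc H] := fg (e / 3); first by rewrite divr_gt0.
have /cvg_rnormP/(_ (e / 3)) gt := continP gc tab.
have e3 : 0 < e / 3 by rewrite divr_gt0.
apply: filterS (gt e3) => t'; rewrite !rnormc => gtt.
have -> : f t' - f t = (f t' - g t') + (g t' - g t) - (f t - g t) by ring.
apply: le_trans (normcD _ _) _; rewrite normcN.
have := normcD (f t' - g t') (g t' - g t).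
have := H t; have := H t'; lra.
Qed.

Lemma holo_derive_linear phi x (c : C) u v : holo phi x ->
  'D_(c *: u + v) (phi : V -> C^o) x =
  c * 'D_u (phi : V -> C^o) x + 'D_v (phi : V -> C^o) x.
Proof.
by case=> hx; rewrite !deriveE// linearP.
Qed.

Section UnderIntegral.
Variables (k : V -> R -> C) (x : V) (r M : R).
Hypotheses (r0 : 0 < r)
  (kd : forall y t, rnorm (y - x) < r -> holo (k^~ t) y)
  (kM : forall y t, rnorm (y - x) < r -> normc (k y t) <= M)
  (kc : forall y, rnorm (y - x) < r -> contin 0 1 (k y)).

Let xx : rnorm (x - x) < r. Proof. by rewrite subrr rnorm0. Qed.
Let M0 : 0 <= M. Proof. exact: le_trans (normc_ge0 _) (kM 0 xx). Qed.
Let D v t : C := 'D_v (k^~ t : V -> C^o) x.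

Let first h t : rnorm h < r / 4 ->
  normc (k (x + h) t - k x t - D h t) <= 8 * M / r ^+ 2 * rnorm h ^+ 2.
Proof.
by move=> hr; apply: (@first_order (k^~ t) x r M r0) => // y yr; [exact: kd|exact: kM].
Qed.

Let Dlin c u v t : D (c *: u + v) t = c * D u t + D v t.
Proof. exact: holo_derive_linear (kd t xx). Qed.

Let DZ c u t : D (c *: u) t = c * D u t.
Proof. by rewrite -[c *: u]addr0 Dlin /D derive0 addr0. Qed.

(** By [first], the derivative is a limit of difference quotients, uniformly in t. *)
Lemma contin_derive v : contin 0 1 (fun t => 'D_v (k^~ t : V -> C^o) x).
Proof.
apply: contin_uniform => e e0.
have [v0|v0] := eqVneq (rnorm v) 0.
  exists (fun=> 0); first exact: contin_cst.
  by move=> t; rewrite (rnorm_eq0 v0) derive0 subr0 normc_0 ltW.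
have {}v0 : 0 < rnorm v by rewrite lt_def v0 rnorm_ge0.
pose K := 8 * M / r ^+ 2 * rnorm v ^+ 2.
have K0 : 0 <= K.
  rewrite /K mulr_ge0 ?exprn_ge0 ?rnorm_ge0//; apply: divr_ge0; first exact: mulr_ge0.
  by rewrite exprn_ge0// ltW.
(* The first bound gives s |v| < r / 4, as [first] requires; the second makes the error [s * K] at
   most [e]. *)
pose s := Num.min (r / (8 * rnorm v)) (e / (K + 1)).
have s0 : 0 < s by rewrite /s lt_min !divr_gt0// ?mulr_gt0// ltr_wpDl.
have sr : s * rnorm v < r / 4.
  have : s <= r / (8 * rnorm v) by rewrite /s ge_min lexx.
  by rewrite ler_pdivlMr ?mulr_gt0//; have := r0; lra.
have sK : s * K <= e.
  have : s <= e / (K + 1) by rewrite /s ge_min lexx orbT.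
  by rewrite ler_pdivlMr ?ltr_wpDl//; lra.
have sn : rnorm (s%:C *: v) = s * rnorm v.
  by rewrite rnormZ normc_real gtr0_norm.
have sC : s%:C != 0 :> C by rewrite -normc_gt0 normc_real gtr0_norm.
have sx : rnorm (x + s%:C *: v - x) < r.
  by rewrite addrAC subrr add0r sn; have := r0; lra.
exists (fun t => s%:C^-1 * (k (x + s%:C *: v) t - k x t)).
  by apply: continM; [exact: contin_cst|apply: continB; exact: kc].
move=> t; have := @first (s%:C *: v) t; rewrite sn => /(_ sr); rewrite DZ => H.
have -> : 'D_v (k^~ t : V -> C^o) x - s%:C^-1 * (k (x + s%:C *: v) t - k x t) =
    - s%:C^-1 * (k (x + s%:C *: v) t - k x t - s%:C * D v t).
  by rewrite /D; field.
rewrite normcM normcN normcV normc_real gtr0_norm// ler_pdivrMl//.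
apply: le_trans H _; apply: le_trans (_ : s * (s * K) <= _); last by rewrite ler_pM2l.
by rewrite /K le_eqVlt; apply/orP; left; apply/eqP; ring.
Qed.

(** The candidate differential is the integral of the differentials; the first-order remainders are
    at most K |h|^2 uniformly in t and stay so after integration. *)
Lemma derive_under_cint : holo (fun y => cint 0 1 (k y)) x /\
  forall v, 'D_v (fun y => cint 0 1 (k y) : C^o) x =
    cint 0 1 (fun t => 'D_v (k^~ t : V -> C^o) x).
Proof.
pose L v : C^o := cint 0 1 (D v).
have Llin : linear L.
  move=> c u v; transitivity (c * L u + L v : C); last by [].
  rewrite /L.
  rewrite -(cintZ c (contin_derive u)) -cintD; last 2 first.
  - by apply: continM; [exact: contin_cst|exact: contin_derive].
  - exact: contin_derive.
  by apply: eq_cint => t _; exact: Dlin.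
have [L' LE] := linear_ex Llin.
have Lb v : normc (L v) <= 2 * M / r * rnorm v.
  apply: le_trans (cint_norm (M := 2 * M / r * rnorm v) _ _ _) _; first exact: ler01.
  - exact: contin_derive.
  - move=> t _; apply: (@derive_bound (k^~ t) x r M r0) => y yr; [exact: kd|exact: kM].
  - by rewrite subr0 mul1r.
have Lc : continuous L'.
  move=> y; apply/continuous_epsP => e e0.
  have K0 : 0 < 2 * M / r + 1.
    by rewrite ltr_wpDl//; apply: divr_ge0; [exact: mulr_ge0|exact: ltW].
  exists (e / (2 * M / r + 1)); first by rewrite divr_gt0.
  move=> h hr; rewrite linearD addrAC subrr add0r LE.
  apply: le_trans (Lb h) _.
  apply: le_trans (_ : (2 * M / r + 1) * rnorm h <= _).
    by rewrite ler_wpM2r ?rnorm_ge0// lerDl.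
  by rewrite mulrC -ler_pdivlMr// ltW.
have [dpsi dE] : differentiable (fun y => cint 0 1 (k y) : C^o) x /\
    'd (fun y => cint 0 1 (k y) : C^o) x = L' :> (V -> C^o).
  apply: eps_differentiable => // e e0.
  pose K := 8 * M / r ^+ 2.
  have K0 : 0 < K + 1.
    rewrite ltr_wpDl//; apply: divr_ge0; first exact: mulr_ge0.
    by rewrite exprn_ge0// ltW.
  exists (Num.min (r / 4) (e / (K + 1))); first by rewrite lt_min !divr_gt0.
  move=> h; rewrite lt_min => /andP[hr hK]; rewrite LE rnormc.
  have xh : rnorm (x + h - x) < r by rewrite addrAC subrr add0r; have := r0; lra.
  rewrite -(cintB (kc xh) (kc xx)) -(cintB (continB (kc xh) (kc xx)) (contin_derive h)).
  apply: le_trans (cint_norm (M := K * rnorm h ^+ 2) _ _ _) _; first exact: ler01.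
  - by apply: continB; [apply: continB; exact: kc|exact: contin_derive].
  - by move=> t _; exact: first.
  - rewrite subr0 mul1r expr2 mulrA ler_wpM2r ?rnorm_ge0//.
    apply: le_trans (_ : (K + 1) * rnorm h <= _).
      by rewrite ler_wpM2r ?rnorm_ge0// lerDl.
    by rewrite mulrC -ler_pdivlMr// ltW.
split; first by split.
by move=> v; rewrite deriveE// dE LE.
Qed.

End UnderIntegral.
End Slices.

(** * Derivatives of holomorphic functions as Cauchy integrals *)

Section HoloRules.
Context {R : realType}.
Local Notation C := R[i].
Context {V : normedModType C}.
Implicit Types (phi psi : V -> C) (x v h : V).

Lemma derive_near phi psi x u : (exists2 d : R, 0 < d &
    forall h, rnorm h < d -> phi (x + h) = psi (x + h)) ->
  'D_u (phi : V -> C^o) x = 'D_u (psi : V -> C^o) x.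
Proof.
move=> [d d0 hd]; apply: near_eq_derive; apply: (near_rnormP x _).2.
by exists d.
Qed.

Lemma holo_near phi psi x : (exists2 d : R, 0 < d &
    forall h, rnorm h < d -> phi (x + h) = psi (x + h)) -> holo phi x -> holo psi x.
Proof.
move=> [d d0 hd] [dphi]; split.
have [] // := @eps_differentiable R V C^o psi x ('d (phi : V -> C^o) x).
  exact: diff_continuous.
move=> e e0; have [d1 d10 h1] := differentiable_eps dphi e0.
exists (Num.min d d1); first by rewrite lt_min d0.
move=> h; rewrite lt_min => /andP[hd' hd1].
have -> : psi x = phi x by rewrite -[x]addr0 hd// rnorm0.
by rewrite -hd//; exact: h1.
Qed.

Lemma holo_cst (c : C) x : holo (fun=> c) x.
Proof. by split; exact: differentiable_cst. Qed.

Lemma holoM phi psi x : holo phi x -> holo psi x -> holo (fun y => phi y * psi y) x.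
Proof. by case=> hx [hy]; split; exact: (@differentiableM C V). Qed.

Lemma holoD phi psi x : holo phi x -> holo psi x -> holo (fun y => phi y + psi y) x.
Proof. by case=> hx [hy]; split; exact: differentiableD. Qed.

Lemma holo_shift phi x w : holo phi (x + w) -> holo (fun y => phi (y + w)) x.
Proof.
case=> hx; split.
apply: (@differentiable_comp C V V C^o (fun y => y + w) phi); last exact: hx.
by apply: differentiableD; [exact: ex_diff|exact: differentiable_cst].
Qed.

Lemma derive_translate phi x w u :
  'D_u (fun y => phi (y + w) : C^o) x = 'D_u (phi : V -> C^o) (x + w).
Proof.
rewrite /derive.
suff -> : (fun h : C => h^-1 *: (((fun y => phi (y + w) : C^o) \o shift x) (h *: u) -
     phi (x + w))) = (fun h : C => h^-1 *: (((phi : V -> C^o) \o shift (x + w)) (h *: u) -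
     phi (x + w))) by [].
by apply/funext => h /=; rewrite addrA.
Qed.

Lemma derive_mulr phi x u (a : C) : holo phi x ->
  'D_u (fun y => phi y * a : C^o) x = 'D_u (phi : V -> C^o) x * a.
Proof.
case=> hs.
have -> : (fun y => phi y * a : C^o) = a *: (phi : V -> C^o).
  by apply/funext => y; rewrite mulrC.
rewrite deriveZ; last exact: diff_derivable.
by rewrite [RHS]mulrC.
Qed.

Lemma holo_locally_bounded (Om : set V) phi x : open Om -> Om x ->
  (forall y, Om y -> holo phi y) -> exists r : R, exists M : R, [/\ 0 < r,
   forall y, rnorm (y - x) < r -> Om y,
   forall y, rnorm (y - x) < r -> holo phi y &
   forall y, rnorm (y - x) < r -> normc (phi y) <= M].
Proof.
move=> Oo Ox hphi.
have /near_rnormP[d d0 hd] : \forall y \near x, Om y by exact: open_nbhs_nbhs.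
have [d1 d10 h1] := holo_eps (hphi _ Ox) ltr01.
have dE y : y = x + (y - x) by rewrite addrCA subrr addr0.
exists (Num.min d d1), (normc (phi x) + 1); split.
- by rewrite lt_min d0.
- by move=> y; rewrite lt_min => /andP[yd _]; rewrite (dE y); exact: hd.
- by move=> y; rewrite lt_min => /andP[yd _]; apply/hphi; rewrite (dE y); exact: hd.
- move=> y; rewrite lt_min => /andP[_ yd]; have := h1 _ yd; rewrite -dE => H.
  by have := lerB_normc (phi y) (phi x); lra.
Qed.

(** A circle of this radius in the direction [v] moves a point by at most r / 2; the [+ 1] admits v
    = 0. *)
Definition derive_radius v (r : R) := r / (2 * (rnorm v + 1)).

(** One radius serves all y near x. The derivative thus becomes an integral of translates of [phi],
    which can be differentiated again under the integral sign. *)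
Lemma derive_formula phi x v (r M : R) : 0 < r ->
  (forall y, rnorm (y - x) < r -> holo phi y) ->
  (forall y, rnorm (y - x) < r -> normc (phi y) <= M) ->
  let q := derive_radius v r in [/\ 0 < q,
    forall y t, rnorm (y - x) < r / 2 -> rnorm (y + circle q t *: v - x) < r,
    forall y, rnorm (y - x) < r / 2 ->
      contin 0 1 (fun t => phi (y + circle q t *: v) * circle q t ^- 1) &
    forall y, rnorm (y - x) < r / 2 ->
     'D_v (phi : V -> C^o) y = cint 0 1 (fun t => phi (y + circle q t *: v) * circle q t ^- 1)].
Proof.
move=> r0 hd hM q; have v1 : 0 < rnorm v + 1 by rewrite ltr_wpDl// rnorm_ge0.
have q0 : 0 < q by rewrite divr_gt0// mulr_gt0.
have qv : q * rnorm v <= r / 2.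
  have : q * (rnorm v + 1) = r / 2 by rewrite /q /derive_radius; field; rewrite gt_eqF.
  by lra.
have inball y w : rnorm (y - x) < r / 2 -> normc w <= q -> rnorm (y + w *: v - x) < r.
  move=> yx wq; rewrite addrAC; apply: le_lt_trans (rnormD _ _) _; rewrite rnormZ.
  have : normc w * rnorm v <= q * rnorm v by rewrite ler_wpM2r// rnorm_ge0.
  by lra.
have Fd y : rnorm (y - x) < r / 2 -> forall w, normc w <= q -> cdiff (slice phi y v) w.
  by move=> yx w wq; apply/cdiff_slice/hd/inball.
have FM y : rnorm (y - x) < r / 2 -> forall t, normc (slice phi y v (circle q t)) <= M.
  by move=> yx t; apply/hM/inball => //; rewrite normc_circle.
split => //.
- by move=> y t yx; apply: inball => //; rewrite normc_circle.
- by move=> y yx; exact: (contin_coef q0 (Fd y yx) 1).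
- by move=> y yx; rewrite derive_slice0 (derive1_coef q0 (Fd y yx) (FM y yx)).
Qed.

Section DeriveHolo.
Variables (Om : set V) (phi : V -> C).
Hypotheses (Oo : open Om) (hphi : forall y, Om y -> holo phi y).

Lemma holo_derive v x : Om x -> holo (fun y => 'D_v (phi : V -> C^o) y) x.
Proof.
move=> Ox; have [r [M [r0 _ hd hM]]] := holo_locally_bounded Oo Ox hphi.
set q := derive_radius v r; have [q0 inb cont E] := derive_formula v r0 hd hM.
have r2 : 0 < r / 2 by rewrite divr_gt0.
apply: (@holo_near (fun y => cint 0 1 (fun t => phi (y + circle q t *: v) * circle q t ^- 1))).
  exists (r / 2) => // h hr; rewrite E//.
  by rewrite addrAC subrr add0r.
apply: (@derive_under_cint _ _
  (fun y t => phi (y + circle q t *: v) * circle q t ^- 1) x (r / 2) (M / q) _ _ _ _).1 => //.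
- move=> y t yx; apply: holoM; last exact: holo_cst.
  by apply/holo_shift/hd/inb.
- move=> y t yx; rewrite normcM normcV normcX normc_circle//.
  by rewrite ler_wpM2r ?invr_ge0 ?expr1 ?(ltW q0)//; apply/hM/inb.
Qed.

(** The inner derivative is a Cauchy integral of translates of [phi]; ['D_u] passes under the
    integral and commutes with translations. *)
Lemma deriveC u v x : Om x ->
  'D_u (fun y => 'D_v (phi : V -> C^o) y : C^o) x =
  'D_v (fun y => 'D_u (phi : V -> C^o) y : C^o) x.
Proof.
move=> Ox; have [r1 [M1 [r10 _ hd1 hM1]]] := holo_locally_bounded Oo Ox hphi.
have hDu y : Om y -> holo (fun y => 'D_u (phi : V -> C^o) y) y by exact: holo_derive.
have [r2 [M2 [r20 _ hd2 hM2]]] := holo_locally_bounded Oo Ox hDu.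
pose r := Num.min r1 r2; have r0 : 0 < r by rewrite lt_min r10.
have rr1 y : rnorm (y - x) < r -> rnorm (y - x) < r1 by rewrite lt_min => /andP[].
have rr2 y : rnorm (y - x) < r -> rnorm (y - x) < r2 by rewrite lt_min => /andP[].
have hd y : rnorm (y - x) < r -> holo phi y by move=> /rr1; exact: hd1.
have hM y : rnorm (y - x) < r -> normc (phi y) <= M1 by move=> /rr1; exact: hM1.
pose q := derive_radius v r.
have [q0 inb cont E] := derive_formula v r0 hd hM.
have [_ _ _ E2] := derive_formula v r0 (fun y yr => hd2 y (rr2 y yr)) (fun y yr => hM2 y (rr2 y yr)).
have r2' : 0 < r / 2 by rewrite divr_gt0.
have xx : rnorm (x - x) < r / 2 by rewrite subrr rnorm0.
transitivity ('D_u (fun y => cint 0 1 (fun t =>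
    phi (y + circle q t *: v) * circle q t ^- 1) : C^o) x).
  by apply: derive_near; exists (r / 2) => // h hr; rewrite E// addrAC subrr add0r.
rewrite (@derive_under_cint _ _
  (fun y t => phi (y + circle q t *: v) * circle q t ^- 1) x (r / 2) (M1 / q) _ _ _ _).2; last 4 first.
- exact: r2'.
- move=> y t yx; apply: holoM; last exact: holo_cst.
  by apply/holo_shift/hd/inb.
- move=> y t yx; rewrite normcM normcV normcX normc_circle//.
  by rewrite ler_wpM2r ?invr_ge0 ?expr1 ?(ltW q0)//; apply/hM/inb.
- exact: cont.
rewrite (E2 _ xx); apply: eq_cint => t _.
rewrite derive_mulr; last exact/holo_shift/hd/inb.
by rewrite derive_translate.
Qed.

End DeriveHolo.

End HoloRules.

(** * Higher derivatives in one variable *)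

Section IteratedDerivative.
Context {R : realType}.
Local Notation C := R[i].

Lemma derive_inv_pow (c s : C) (n : nat) : c != s ->
  'D_1 (fun y : C^o => ((c - y) ^+ n.+1)^-1 : C^o) s = n.+1%:R * ((c - s) ^+ n.+2)^-1.
Proof.
move=> cs; have cs0 : c - s != 0 by rewrite subr_eq0.
have Hs : is_derive (s : C^o) (1 : C^o) (fun y : C^o => c - y : C^o) (-1).
  by apply: is_derive_eq; rewrite sub0r.
have E : (fun y : C^o => (c - y) ^+ n.+1 : C^o) = (fun y : C^o => c - y : C^o) ^+ n.+1.
  by apply/funext => y; rewrite exprfctE.
have H := @is_deriveX C C^o _ n.+1 s 1 _ Hs.
rewrite -E in H.
have P0 : (c - s) ^+ n.+1 != 0 by rewrite expf_neq0.
have dn : derivable (fun y : C^o => (c - y) ^+ n.+1 : C^o) s 1 by exact: ex_derive.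
rewrite (@deriveV C C^o (fun y : C^o => (c - y) ^+ n.+1 : C^o) s 1 P0 dn).
rewrite derive_val -[RHS]mulr1.
rewrite /GRing.scale/= !(exprS (c - s)).
have Pn := expf_neq0 n cs0.
move: (c - s) Pn cs0 {P0 E H dn Hs} => X; move: (X ^+ n) => P P1 X0.
by field; rewrite P1 X0.
Qed.

Section OneVariable.
Variables (F : C -> C) (r M : R).
Hypotheses (r0 : 0 < r) (Fd : forall w, normc w <= r -> cdiff F w).
Hypothesis FM : forall x, normc (F (circle r x)) <= M.

(** Cauchy's integral for the j-th derivative divided by j!; the factor [circle r x] is dw / (2 pi i
    dx). *)
Definition cauchy_deriv (j : nat) (s : C) : C :=
  cint 0 1 (fun x => F (circle r x) * circle r x * ((circle r x - s) ^+ j.+1)^-1).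

Let kd (j : nat) s t : normc s < r ->
  holo (V := C^o) (fun s => F (circle r t) * circle r t * ((circle r t - s) ^+ j.+1)^-1) s.
Proof.
move=> sr; apply: holoM; first exact: holo_cst.
have [H] : cdiff (fun s => ((circle r t - s) ^+ j.+1)^-1) s; last by split.
have cs : circle r t - s != 0 by rewrite subr_eq0 circle_neq.
apply: (@cdiff_comp _ (fun s => circle r t - s) (fun w => w ^- j.+1)).
  by apply: cdiffB; [exact: cdiff_cst|exact: cdiff_id].
exact: cdiff_expV.
Qed.

Let kc (j : nat) s : normc s < r ->
  contin 0 1 (fun t => F (circle r t) * circle r t * ((circle r t - s) ^+ j.+1)^-1).
Proof.
move=> sr; apply: continM; last first.
  apply: (@contin_circle _ r (fun w => ((w - s) ^+ j.+1)^-1)) => x.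
  apply: cdiff_continuous; apply: (@cdiff_comp _ (fun w => w - s) (fun w => w ^- j.+1)).
    by apply: cdiffB; [exact: cdiff_id|exact: cdiff_cst].
  by apply: cdiff_expV; rewrite subr_eq0 circle_neq.
apply: (@contin_circle _ r (fun w => F w * w)) => x; apply: cdiff_continuous.
by apply: cdiffM; [apply: Fd; rewrite normc_circle|exact: cdiff_id].
Qed.

Lemma derive_cauchy_deriv (j : nat) s : normc s < r ->
  holo (V := C^o) (cauchy_deriv j) s /\
  'D_1 (cauchy_deriv j : C^o -> C^o) s = j.+1%:R * cauchy_deriv j.+1 s.
Proof.
move=> sr; pose q := (r - normc s) / 2.
have q0 : 0 < q by rewrite divr_gt0// subr_gt0.
have ball (y : C^o) : rnorm (y - s) < q -> normc y < r - q.
  rewrite rnormc => yq; have := lerB_normc y s; rewrite /q in yq *; lra.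
have rq : r - q < r by rewrite ltrBlDr ltrDl.
have [|||| h1 h2] := @derive_under_cint R C^o
  (fun s t => F (circle r t) * circle r t * ((circle r t - s) ^+ j.+1)^-1)
  s q (M * r / q ^+ j.+1).
- exact: q0.
- by move=> y t /ball yr; apply: kd; exact: lt_trans yr rq.
- move=> y t /ball yr; rewrite normcM normcV normcX normcM.
  rewrite normc_circle//; apply: ler_pM.
  + by rewrite mulr_ge0 ?normc_ge0// ltW.
  + by rewrite invr_ge0 exprn_ge0// normc_ge0.
  + by rewrite ler_wpM2r// ltW.
  + rewrite lef_pV2 ?posrE ?exprn_gt0//; last first.
      by rewrite normc_gt0 subr_eq0 circle_neq// (lt_trans yr).
    apply: lerXn2r; rewrite ?nnegrE ?normc_ge0 ?ltW//.
    have := lerB_normc (circle r t) y; rewrite normc_circle// => H.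
    by apply: lt_le_trans H; lra.
- by move=> y /ball yr; apply: kc; exact: lt_trans yr rq.
split; first exact: h1.
rewrite h2 /cauchy_deriv -cintZ; last exact: kc.
apply: eq_cint => t _.
have -> : (fun s0 : C^o => F (circle r t) * circle r t * ((circle r t - s0) ^+ j.+1)^-1 : C^o)
  = (fun s0 : C^o => ((circle r t - s0) ^+ j.+1)^-1 * (F (circle r t) * circle r t)).
  by apply/funext => y; rewrite mulrC.
have cs : circle r t != s by exact: circle_neq.
rewrite (@derive_mulr R C^o); last first.
  have [H] : cdiff (fun s => ((circle r t - s) ^+ j.+1)^-1) s; last by split.
  have cs' : circle r t - s != 0 by rewrite subr_eq0.
  apply: (@cdiff_comp _ (fun s => circle r t - s) (fun w => w ^- j.+1)).
    by apply: cdiffB; [exact: cdiff_cst|exact: cdiff_id].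
  exact: cdiff_expV.
rewrite derive_inv_pow//.
by move: (_ ^- _) => a; ring.
Qed.

Definition diter1 n (F : C -> C) := iter n (fun G : C -> C => derive1 (G : C^o -> C^o)) F.

Lemma iter_derive1 (j : nat) s : normc s < r ->
  diter1 j F s = j`!%:R * cauchy_deriv j s.
Proof.
elim: j s => [|j IH] s sr.
  rewrite fact0 mul1r /= (disc_cauchy sr Fd); apply: eq_cint => x _.
  by rewrite expr1 mulrA.
rewrite /diter1/= derive1E.
rewrite (@derive_near R C^o _ (fun s => cauchy_deriv j s * j`!%:R)); last first.
  exists (r - normc s); first by rewrite subr_gt0.
  move=> h hr; rewrite -[LHS]/(diter1 j F (s + h)) IH; first by rewrite mulrC.
  by apply: le_lt_trans (normcD _ _) _; move: hr; rewrite rnormc; lra.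
have [hj dj] := derive_cauchy_deriv j sr.
by rewrite (@derive_mulr R C^o)// dj factS natrM; ring.
Qed.

End OneVariable.
End IteratedDerivative.

(** * Taylor expansion along a direction *)

Section DirectionalTaylor.
Context {R : realType}.
Local Notation C := R[i].
Context {V : normedModType C}.
Implicit Types (phi psi : V -> C) (x v u : V) (Om : set V).

Definition dirderiv v phi : V -> C := fun y => 'D_v (phi : V -> C^o) y.

Definition diter v n phi := iter n (dirderiv v) phi.

Lemma slice_diter phi x v n : slice (diter v n phi) x v = diter1 n (slice phi x v).
Proof.
elim: n => [//|n IH]; rewrite /diter /diter1 !iterS -/(diter v n phi) -/(diter1 n _) -IH.
by apply/funext => s; rewrite -derive_slice.
Qed.

Definition holo_on Om phi := forall y, Om y -> holo phi y.

Lemma holo_dirderiv Om v phi : open Om -> holo_on Om phi -> holo_on Om (dirderiv v phi).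
Proof. by move=> Oo hphi y; exact: holo_derive. Qed.

Lemma holo_diter Om v n phi : open Om -> holo_on Om phi -> holo_on Om (diter v n phi).
Proof.
move=> Oo hphi; elim: n => [|n IH]; first exact: hphi.
exact: holo_dirderiv Oo IH.
Qed.

Lemma dirderiv_eq Om v phi psi : open Om -> (forall y, Om y -> phi y = psi y) ->
  forall y, Om y -> dirderiv v phi y = dirderiv v psi y.
Proof.
move=> Oo E y Oy; apply: derive_near.
have /near_rnormP[d d0 hd] : \forall z \near y, Om z by exact: open_nbhs_nbhs.
by exists d => // h /hd /E.
Qed.

Lemma diter_eq Om v n phi psi : open Om -> (forall y, Om y -> phi y = psi y) ->
  forall y, Om y -> diter v n phi y = diter v n psi y.
Proof.
move=> Oo E; elim: n => [|n IH] y Oy; first exact: E.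
exact: (dirderiv_eq v Oo IH Oy).
Qed.

Lemma dirderiv_diter Om u v n phi : open Om -> holo_on Om phi ->
  forall y, Om y -> dirderiv u (diter v n phi) y = diter v n (dirderiv u phi) y.
Proof.
move=> Oo hphi; elim: n => [//|n IH] y Oy.
transitivity (dirderiv v (dirderiv u (diter v n phi)) y).
  exact: (deriveC Oo (holo_diter v n Oo hphi) u v Oy).
exact: (dirderiv_eq v Oo IH Oy).
Qed.

(** The constant depends on r, M, n and [v] but not on the point, so that the estimate can be used
    at a base point that itself moves with s. *)
Lemma taylor_leading phi x v (r M : R) n : 0 < r ->
  (forall y, rnorm (y - x) < r -> holo phi y) ->
  (forall y, rnorm (y - x) < r -> normc (phi y) <= M) ->
  (forall j, (j < n)%N -> diter v j phi x = 0) ->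
  let q := derive_radius v r in
  forall s : C, normc s <= q / 2 ->
  normc (phi (x + s *: v) - s ^+ n * (n`!%:R^-1 * diter v n phi x)) <=
    2 * M / q ^+ n.+1 * normc s ^+ n.+1.
Proof.
move=> r0 hd hM hv q s sq; have v1 : 0 < rnorm v + 1 by rewrite ltr_wpDl// rnorm_ge0.
have q0 : 0 < q by rewrite divr_gt0// mulr_gt0.
have qv : q * rnorm v <= r / 2.
  have : q * (rnorm v + 1) = r / 2 by rewrite /q /derive_radius; field; rewrite gt_eqF.
  by lra.
have inball w : normc w <= q -> rnorm (x + w *: v - x) < r.
  move=> wq; rewrite addrAC subrr add0r rnormZ.
  have : normc w * rnorm v <= q * rnorm v by rewrite ler_wpM2r// rnorm_ge0.
  by lra.
have Fd w : normc w <= q -> cdiff (slice phi x v) w.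
  by move=> wq; apply/cdiff_slice/hd/inball.
have FM t : normc (slice phi x v (circle q t)) <= M.
  by apply/hM/inball => //; rewrite normc_circle.
have cE j : j`!%:R^-1 * diter v j phi x = cauchy_coef (slice phi x v) q j.
  have -> : diter v j phi x = slice (diter v j phi) x v 0 by rewrite /slice scale0r addr0.
  rewrite slice_diter (iter_derive1 q0 Fd FM) ?normc_0// mulrA mulVf ?mul1r.
    rewrite /cauchy_deriv /cauchy_coef; apply: eq_cint => t _.
    rewrite subr0 exprS; have := circle_neq0 t q0 => c0.
    by move: (slice _ _ _ _) => a; field; rewrite expf_neq0.
  by rewrite pnatr_eq0 -lt0n fact_gt0.
have sq' : normc s < q by lra.
rewrite cE -[phi _]/(slice phi x v s) (disc_taylor q0 Fd n.+1 sq') big_ord_recr/=.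
rewrite big1 ?add0r; last by move=> j _; rewrite -cE hv ?mulr0 ?mul0r.
rewrite [_ * s ^+ n]mulrC addrAC subrr add0r normcM normcX mulrC.
by rewrite ler_wpM2r ?exprn_ge0 ?normc_ge0//; exact: taylor_rem_bound.
Qed.

End DirectionalTaylor.

(** * Mixed partial derivatives *)

Section MultiIndex.
Context {R : realType}.
Local Notation C := R[i].
Context {V : normedModType C}.
Implicit Types (phi psi : V -> C) (x v u : V).

Lemma holo_sum (I : Type) (s : seq I) (P : pred I) (psi : I -> V -> C) x :
  (forall i, holo (psi i) x) -> holo (fun y => \sum_(i <- s | P i) psi i y) x.
Proof.
move=> hpsi; elim: s => [|i s IH].
  apply: (@holo_near _ _ (fun=> 0)); last exact: holo_cst.
  by exists 1 => // h _; rewrite big_nil.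
apply: (@holo_near _ _ (fun y => (if P i then psi i y else 0) + \sum_(i <- s | P i) psi i y)).
  by exists 1 => // h _; rewrite big_cons; case: ifP; rewrite ?add0r.
apply: holoD; last exact: IH.
by case: (P i); [exact: hpsi|exact: holo_cst].
Qed.

Lemma dirderivD v phi psi x : holo phi x -> holo psi x ->
  dirderiv v (fun y => phi y + psi y) x = dirderiv v phi x + dirderiv v psi x.
Proof.
case=> hx [hy].
exact: (@deriveD C V C^o phi psi x v (diff_derivable hx) (diff_derivable hy)).
Qed.

Lemma dirderiv_cst v (c : C) x : dirderiv v (fun=> c) x = 0.
Proof. exact: (@derive_cst C V C^o c x v). Qed.

Lemma dirderivZ v (c : C) phi x : holo phi x ->
  dirderiv v (fun y => c * phi y) x = c * dirderiv v phi x.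
Proof.
move=> hx; rewrite [RHS]mulrC.
transitivity (dirderiv v (fun y => phi y * c) x); last exact: derive_mulr.
by congr (dirderiv v _ x); apply/funext => y; rewrite mulrC.
Qed.

Lemma dirderiv_sum v (I : Type) (s : seq I) (P : pred I) (psi : I -> V -> C) x :
  (forall i, holo (psi i) x) ->
  dirderiv v (fun y => \sum_(i <- s | P i) psi i y) x =
  \sum_(i <- s | P i) dirderiv v (psi i) x.
Proof.
move=> hpsi; elim: s => [|i s IH].
  rewrite big_nil -[RHS](dirderiv_cst v 0 x); congr (dirderiv v _ x).
  by apply/funext => y; rewrite big_nil.
rewrite big_cons -IH; case: ifP => Pi.
  rewrite -dirderivD; [|exact: hpsi|exact: holo_sum].
  by congr (dirderiv v _ x); apply/funext => y; rewrite big_cons Pi.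
by congr (dirderiv v _ x); apply/funext => y; rewrite big_cons Pi.
Qed.

Lemma dirderiv_comb (I : Type) (s : seq I) (z : I -> C) (E : I -> V) phi x : holo phi x ->
  dirderiv (\sum_(i <- s) z i *: E i) phi x = \sum_(i <- s) z i * dirderiv (E i) phi x.
Proof.
move=> hx; elim: s => [|i s IH]; first by rewrite !big_nil /dirderiv derive0.
by rewrite !big_cons -IH -holo_derive_linear.
Qed.

Section MixedPartials.
Variables (N : nat) (E : 'I_N -> V) (Om : set V) (phi : V -> C).
Hypotheses (Oo : open Om) (hphi : holo_on Om phi).

(** The same fold as in [partial], for arbitrary directions [E]; the list of indices is a parameter
    for the sake of induction. *)
Definition mixed_on (s : seq 'I_N) (m : multinom N) (psi : V -> C) : V -> C :=
  foldr (fun b G => diter (E b) (m b) G) psi s.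

Definition mixed (m : multinom N) (psi : V -> C) : V -> C := mixed_on (enum 'I_N) m psi.

Lemma holo_mixed_on s m : holo_on Om (mixed_on s m phi).
Proof.
elim: s => [|a s IH]; first exact: hphi.
exact: (holo_diter (E a) (m a) Oo IH).
Qed.

Lemma mixed_on_notin s m b : b \notin s ->
  mixed_on s (mnm_add m (mnm1 b)) phi = mixed_on s m phi.
Proof.
elim: s => [//|a s IH]; rewrite inE negb_or => /andP[ba /IH E'].
by rewrite /= E' mnmDE mnm1E (negbTE ba) addn0.
Qed.

Lemma dirderiv_mixed_on s m b x : uniq s -> b \in s -> Om x ->
  dirderiv (E b) (mixed_on s m phi) x = mixed_on s (mnm_add m (mnm1 b)) phi x.
Proof.
elim: s x => [//|a s IH] x /= /andP[as_ us]; rewrite inE => bs Ox.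
rewrite mnmDE mnm1E.
have [ba|ba] := eqVneq b a.
  by rewrite addn1 -ba mixed_on_notin// ba.
rewrite addn0 (dirderiv_diter (E b) (E a) (m a) Oo (holo_mixed_on s m) Ox).
apply: (diter_eq (E a) (m a) Oo _ Ox) => y Oy.
by apply: IH => //; move: bs; rewrite (negbTE ba).
Qed.

Lemma dirderiv_mixed m b x : Om x ->
  dirderiv (E b) (mixed m phi) x = mixed (mnm_add m (mnm1 b)) phi x.
Proof.
by move=> Ox; apply: dirderiv_mixed_on; rewrite ?enum_uniq ?mem_enum.
Qed.

Lemma holo_mixed m : holo_on Om (mixed m phi).
Proof. exact: holo_mixed_on. Qed.

Variable z : 'I_N -> C.

Definition mweight (m : multinom N) : C := \prod_(b < N) (z b ^+ m b / (m b)`!%:R).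

Let mweightB (m : multinom N) b : (0 < m b)%N ->
  z b * mweight (mnm_sub m (mnm1 b)) = (m b)%:R * mweight m.
Proof.
move=> mb; rewrite /mweight (bigD1 b)//= [in RHS](bigD1 b)//= !mulrA; congr (_ * _).
  rewrite mnmBE mnm1E eqxx subn1; case: (m b) mb => // k _ /=.
  rewrite factS natrM exprS; field.
  by rewrite -mulrS !pnatr_eq0 -!lt0n fact_gt0.
apply: eq_bigr => i ib.
by rewrite mnmBE mnm1E eq_sym (negbTE ib) subn0.
Qed.

(** Adding the b-th unit vector is a bijection onto the multi-indices with positive b-th entry.
    Bounds of [bmultinom] are strict, so [n.+1] and [n.+2] admit the degrees n and n + 1; the
    defaults of [insubd] are not taken in the range of summation. *)
Let reindex_shift n b (c g : multinom N -> C) :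
  \sum_(m : bmultinom N n.+1 | mdeg m == n) c m * g (mnm_add m (mnm1 b)) =
  \sum_(m : bmultinom N n.+2 | (mdeg m == n.+1) && (0 < m b)%N)
    c (mnm_sub m (mnm1 b)) * g m.
Proof.
pose h (m : bmultinom N n.+1) : bmultinom N n.+2 :=
  insubd (@bm0 N n.+1) (mnm_add m (mnm1 b)).
pose h' (m : bmultinom N n.+2) : bmultinom N n.+1 :=
  insubd (@bm0 N n) (mnm_sub m (mnm1 b)).
have hE m : bmnm (h m) = mnm_add m (mnm1 b).
  by rewrite /h -[bmnm _]/(val _) val_insubd mdegD mdeg1 addn1 ltnS bmdeg.
have le1 (m : multinom N) : (0 < m b)%N -> mnm_add (mnm_sub m (mnm1 b)) (mnm1 b) = m.
  move=> mb; apply/mnmP => i; rewrite mnmDE mnmBE mnm1E.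
  by case: eqVneq => [<-|_]; rewrite ?subnK ?subn0 ?addn0.
have h'E (m : bmultinom N n.+2) : (0 < m b)%N -> bmnm (h' m) = mnm_sub m (mnm1 b).
  move=> mb; rewrite /h' -[bmnm _]/(val _) val_insubd.
  suff -> : (mdeg (mnm_sub m (mnm1 b)) < n.+1)%N by [].
  by have := bmdeg m; rewrite -{1}(le1 _ mb) mdegD mdeg1 addn1 ltnS.
rewrite (reindex_onto h h') /=; last first.
  by move=> m /andP[_ mb]; apply/val_inj; rewrite /= hE h'E// le1.
apply: eq_big => [m|m _].
  have mb : (0 < (h m : multinom N) b)%N by rewrite hE mnmDE mnm1E eqxx addn1.
  rewrite mb hE mdegD mdeg1 addn1 eqSS andbT.
  suff -> : h' (h m) == m by rewrite andbT.
  apply/eqP/val_inj; rewrite /= h'E// hE.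
  by apply/mnmP => i; rewrite mnmBE mnmDE addnK.
rewrite hE; congr (c _ * _).
by apply/mnmP => i; rewrite mnmBE mnmDE addnK.
Qed.

(** The multinomial theorem for commuting derivations. In the induction step a multi-index m of
    degree n + 1 collects, from every b, its weight times m_b, and these m_b add up to n + 1. *)
Lemma diter_mixed n x : Om x ->
  diter (\sum_(b < N) z b *: E b) n phi x =
  n`!%:R * \sum_(m : bmultinom N n.+1 | mdeg m == n) mweight m * mixed m phi x.
Proof.
elim: n x => [|n IH] x Ox.
  rewrite fact0 mul1r (bigD1 (@bm0 N 0)) ?mdeg0//= big1 ?addr0; last first.
    move=> m /andP[m0]; rewrite -val_eqE/= => /negP[].
    by rewrite -mdeg_eq0.
  have -> : mweight (@mnm0 N) = 1.
    by rewrite /mweight big1// => b _; rewrite mnm0E expr0 fact0 divr1.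
  rewrite mul1r /mixed; elim: (enum _) => //= a s ->.
  by rewrite mnm0E.
have step y : Om y -> dirderiv (\sum_(b < N) z b *: E b)
    (diter (\sum_(b < N) z b *: E b) n phi) y = dirderiv (\sum_(b < N) z b *: E b)
    (fun y => n`!%:R * \sum_(m : bmultinom N n.+1 | mdeg m == n) mweight m * mixed m phi y) y.
  by move=> Oy; exact: (dirderiv_eq _ Oo IH Oy).
rewrite [LHS](step x Ox).
have hm (m : bmultinom N n.+1) : holo (fun y => mweight m * mixed m phi y) x.
  by apply: holoM; [exact: holo_cst|exact: holo_mixed].
rewrite dirderivZ; last exact: holo_sum.
rewrite dirderiv_sum//.
rewrite factS [(n.+1 * _)%N]mulnC natrM -mulrA; congr (_ * _).
transitivity (\sum_(b < N) z b * \sum_(m : bmultinom N n.+1 | mdeg m == n)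
    mweight m * mixed (mnm_add m (mnm1 b)) phi x).
  under [RHS]eq_bigr do rewrite mulr_sumr.
  rewrite exchange_big/=; apply: eq_bigr => m _.
  rewrite dirderivZ; last exact: holo_mixed.
  rewrite dirderiv_comb; last exact: holo_mixed.
  rewrite mulr_sumr; apply: eq_bigr => b _.
  by rewrite dirderiv_mixed// mulrCA.
transitivity (\sum_(b < N) \sum_(m : bmultinom N n.+2 | mdeg m == n.+1)
    (m b)%:R * (mweight m * mixed m phi x)).
  apply: eq_bigr => b _; rewrite (reindex_shift n b mweight (fun m => mixed m phi x)).
  rewrite mulr_sumr [RHS](bigID (fun m : bmultinom N n.+2 => (0 < m b)%N))/=.
  rewrite [X in _ = _ + X]big1 ?addr0; last first.
    by move=> m /andP[_]; rewrite -eqn0Ngt => /eqP->; rewrite mul0r.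
  by apply: eq_bigr => m /andP[_ mb]; rewrite mulrA mweightB// mulrA.
rewrite exchange_big/= mulr_sumr; apply: eq_bigr => m /eqP mn.
by rewrite -mulr_suml -natr_sum -mdegE mn.
Qed.

End MixedPartials.
End MultiIndex.

(** * The action of the symplectic group *)

Section SiegelAction.
Context {R : realType}.
Local Notation C := R[i].

Lemma quadE (K : pzRingType) (g : nat) (x : 'rV[K]_g) (Y : 'M[K]_g) (z : 'rV[K]_g) :
  (x *m Y *m z^T) 0 0 = \sum_j \sum_i x 0 i * Y i j * z 0 j.
Proof.
rewrite !mxE; apply: eq_bigr => j _; rewrite !mxE mulr_suml.
by apply: eq_bigr.
Qed.

Lemma ReM_conj (x y : C) (r : R) :
  complex.Re (x * r%:C * conjc y) = r * (complex.Re x * complex.Re y + complex.Im x * complex.Im y).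
Proof. by case: x y => [a b] [c d] /=; ring. Qed.

(** For x = a + i b the real part is the quadratic form at a plus that at b. *)
Lemma posdef_hermitian (g : nat) (Y : 'M[R]_g) (x : 'rV[C]_g) : posdef Y -> x != 0 ->
  0 < complex.Re ((x *m map_mx (real_complex R) Y *m (map_mx conjc x)^T) 0 0).
Proof.
move=> pY x0.
pose a := map_mx (@complex.Re R) x; pose b := map_mx (@complex.Im R) x.
have -> : complex.Re ((x *m map_mx (real_complex R) Y *m (map_mx conjc x)^T) 0 0) =
    (a *m Y *m a^T) 0 0 + (b *m Y *m b^T) 0 0.
  rewrite !quadE raddf_sum -big_split/=; apply: eq_bigr => j _.
  rewrite raddf_sum -big_split/=; apply: eq_bigr => i _.
  by rewrite !mxE ReM_conj; ring.
have nn (v : 'rV[R]_g) : 0 <= (v *m Y *m v^T) 0 0.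
  by have [->|/pY/ltW//] := eqVneq v 0; rewrite !mul0mx mxE.
have [a0|/pY ap] := eqVneq a 0; last by rewrite ltr_pwDl.
have [b0|/pY bp] := eqVneq b 0; last by rewrite ltr_wpDl.
case/eqP: x0; apply/matrixP => i j; rewrite ord1 mxE.
have := congr1 (fun M : 'rV[R]_g => M 0 j) a0; have := congr1 (fun M : 'rV[R]_g => M 0 j) b0.
by rewrite !mxE; case: (x 0 j) => u v /= -> ->.
Qed.

Lemma unitmx_rowP (K : fieldType) (g : nat) (A : 'M[K]_g) :
  (forall x : 'rV[K]_g, x *m A = 0 -> x = 0) -> A \in unitmx.
Proof. by move=> Ax; rewrite -row_free_unit; exact: inj_row_free. Qed.

Lemma posdef_unit (g : nat) (Y : 'M[R]_g) : posdef Y -> Y \in unitmx.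
Proof.
move=> pY; apply: unitmx_rowP => x xY; apply/eqP; apply/negPn/negP => /pY.
by rewrite xY mul0mx mxE ltxx.
Qed.

Lemma std_symplectic_pairing (K : comNzRingType) (g : nat) (P J P' J' : 'M[K]_g) :
  (col_mx P J)^T *m block_mx 0 1%:M (- 1%:M) 0 *m col_mx P' J' =
  P^T *m J' - J^T *m P'.
Proof.
rewrite tr_col_mx mul_row_block mul_row_col !mulmx0 add0r addr0 mulmx1.
by rewrite mulmxN mulmx1 mulNmx addrC.
Qed.

Lemma symplectic_blockP (g : nat) (a b c d : 'M[int]_g) :
  symplectic (block_mx a b c d) <->
  [/\ a^T *m c = c^T *m a, b^T *m d = d^T *m b & a^T *m d - c^T *m b = 1%:M].
Proof.
rewrite /symplectic/= /std_symplectic tr_block_mx !mulmx_block !mulmx0 !add0r !addr0.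
rewrite !mulmxN !mulmx1 !mulNmx.
split=> [/eq_block_mx[E1 E2 E3 E4]|[E1 E2 E3]].
  split.
  - by apply/eqP; rewrite -subr_eq0 -E1 addrC.
  - by apply/eqP; rewrite -subr_eq0 -E4 addrC.
  - by rewrite -E2 addrC.
congr block_mx.
- by rewrite E1 addNr.
- by rewrite -E3 addrC.
- have E3' : d^T *m a - b^T *m c = 1%:M.
    by rewrite -[1%:M]trmx1 -E3 linearB/= !trmx_mul !trmxK.
  by rewrite -E3' opprB addrC.
- by rewrite E2 addNr.
Qed.

Lemma map_intr_trC (g : nat) (A : 'M[int]_g) : (intC A)^T = map_mx (intr : int -> C) A^T.
Proof. by rewrite map_trmx. Qed.

Lemma conj_intC (g : nat) (A : 'M[int]_g) : map_mx conjc (intC A : 'M[C]_g) = intC A.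
Proof. by apply/matrixP => i j; rewrite !mxE rmorph_int. Qed.

Definition act_num (g : nat) (M : 'M[int]_(g + g)) (tau : 'M[C]_g) : 'M[C]_g :=
  intC (ulsubmx M) *m tau + intC (ursubmx M).

Lemma two_i_neq0 : 2 * 'i != 0 :> C.
Proof.
rewrite mulf_neq0 ?pnatr_eq0//.
by rewrite eq_complex/= oner_eq0 andbF.
Qed.

Section Action.
Variables (g : nat) (M : 'M[int]_(g + g)) (tau : 'M[C]_g).
Hypotheses (sM : symplectic M) (st : siegel tau).

Let P := act_num M tau.
Let J := autom_factor M tau.
Let Mc := map_mx (intr : int -> C) M.

Let symMc : Mc^T *m block_mx 0 1%:M (- 1%:M) 0 *m Mc = block_mx 0 1%:M (- 1%:M) 0.
Proof.
have E : map_mx (intr : int -> C) (std_symplectic g) = block_mx 0 1%:M (- 1%:M) 0.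
  by rewrite map_block_mx map_mxN map_mx1 !map_mx0.
by rewrite -E /Mc map_trmx -!map_mxM sM.
Qed.

Let McE t : Mc *m col_mx t 1%:M = col_mx (act_num M t) (autom_factor M t).
Proof.
rewrite /Mc -{1}[M]submxK map_block_mx mul_block_col !mulmx1.
by [].
Qed.

(** [M] preserves the symplectic pairing and sends the column (t, 1) to ([act_num M t],
    [autom_factor M t]); the pairing of (t, 1) with (t', 1) is t^T - t'. *)
Let pairing t t' : (act_num M t)^T *m autom_factor M t' -
  (autom_factor M t)^T *m act_num M t' = t^T - t'.
Proof.
rewrite -std_symplectic_pairing -!McE trmx_mul.
have sE := symMc; set S := block_mx _ _ _ _ in sE *; set X := col_mx t _; set Y := col_mx t' _.
have -> : X^T *m Mc^T *m S *m (Mc *m Y) = X^T *m (Mc^T *m S *m Mc) *m Y.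
  by rewrite !mulmxA.
by rewrite sE std_symplectic_pairing mulmx1 trmx1 mul1mx.
Qed.

Lemma pairing_conj : P^T *m map_mx conjc J - J^T *m map_mx conjc P = tau - map_mx conjc tau.
Proof.
have -> : map_mx conjc J = autom_factor M (map_mx conjc tau).
  by rewrite /J /autom_factor map_mxD map_mxM !conj_intC.
have -> : map_mx conjc P = act_num M (map_mx conjc tau).
  by rewrite /P /act_num map_mxD map_mxM !conj_intC.
by rewrite pairing st.1.
Qed.

Lemma pairing_self : P^T *m J = J^T *m P.
Proof. by apply/eqP; rewrite -subr_eq0 pairing st.1 subrr. Qed.

Lemma sub_conj_siegel (t : 'M[C]_g) :
  t - map_mx conjc t = (2 * 'i) *: map_mx (real_complex R) (map_mx (@complex.Im R) t).
Proof.
apply/matrixP => i j; rewrite !mxE; case: (t i j) => a b.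
by apply/eqP; rewrite eq_complex/=; apply/andP; split; apply/eqP; ring.
Qed.

(** If x J^T = 0, then [pairing_conj] makes the hermitian form of tau - conj tau vanish at x,
    against the positivity of Im tau. *)
Lemma autom_factor_unit : J \in unitmx.
Proof.
rewrite -unitmx_tr; apply: unitmx_rowP => x xJ; apply/eqP/negPn/negP => x0.
have H : x *m (tau - map_mx conjc tau) *m (map_mx conjc x)^T = 0.
  have Jx : map_mx conjc J *m (map_mx conjc x)^T = 0.
    rewrite -[map_mx conjc J]trmxK -trmx_mul map_trmx -map_mxM xJ.
    by rewrite map_mx0 trmx0.
  rewrite -pairing_conj mulmxBr mulmxBl -!mulmxA Jx !mulmx0 sub0r.
  by rewrite !mulmxA xJ !mul0mx oppr0.
have := posdef_hermitian st.2 x0.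
move: H; rewrite sub_conj_siegel -scalemxAr -scalemxAl => /matrixP/(_ 0 0).
rewrite mxE [in RHS]mxE => /eqP.
by rewrite mulf_eq0 (negbTE two_i_neq0)/= => /eqP->; rewrite ltxx.
Qed.

Lemma siegel_actP : siegel_act M tau *m J = P.
Proof. by rewrite mulmxKV// autom_factor_unit. Qed.

Lemma siegel_act_unique (T : 'M[C]_g) : T *m J = P -> siegel_act M tau = T.
Proof.
by move=> TJ; rewrite /siegel_act -/(act_num M tau) -/P -TJ mulmxK// autom_factor_unit.
Qed.

Lemma siegel_act_sym : (siegel_act M tau)^T = siegel_act M tau.
Proof.
have JU := autom_factor_unit; have JTU : J^T \in unitmx by rewrite unitmx_tr.
set T := siegel_act M tau.
have E : J^T *m T^T *m J = J^T *m T *m J.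
  by rewrite -trmx_mul siegel_actP pairing_self -mulmxA siegel_actP.
rewrite -[LHS](mulKmx JTU) -[RHS](mulKmx JTU); congr (_ *m _).
exact: (can_inj (mulmxK JU) E).
Qed.

(** With T the image of tau, [pairing_conj] reads J^T (T - conj T) conj J = tau - conj tau, so that
    Im T is congruent to Im tau. *)
Lemma siegel_act_siegel : siegel (siegel_act M tau).
Proof.
split; first exact: siegel_act_sym.
move=> v v0; set T := siegel_act M tau.
have JU := autom_factor_unit.
have JTU : J^T \in unitmx by rewrite unitmx_tr.
pose w := map_mx (real_complex R) v.
have wc : map_mx conjc w = w.
  by apply/matrixP => i j; rewrite !mxE; exact: conjc_real.
pose x := w *m invmx J^T.
have w0 : w != 0.
  apply: contraNneq v0 => /matrixP E; apply/eqP/matrixP => i j.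
  by have := E i j; rewrite !mxE => -[].
have x0 : x != 0.
  by apply: contraNneq w0 => E; rewrite -[w](mulmxKV JTU) -/x E mul0mx.
have wE : w = x *m J^T by rewrite mulmxKV.
have H : w *m (T - map_mx conjc T) *m w^T = x *m (tau - map_mx conjc tau) *m (map_mx conjc x)^T.
  have wtE : w^T = map_mx conjc J *m (map_mx conjc x)^T.
    by rewrite -{1}wc wE map_mxM trmx_mul [(map_mx conjc J^T)^T]map_trmx trmxK.
  have K : J^T *m (T - map_mx conjc T) *m map_mx conjc J = tau - map_mx conjc tau.
    rewrite -pairing_conj mulmxBr mulmxBl; congr (_ - _).
      have TT : T^T = T by exact: siegel_act_sym.
      by rewrite -{1}TT -trmx_mul siegel_actP.
    by rewrite -mulmxA -map_mxM siegel_actP.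
  by rewrite wtE wE -K !mulmxA.
have := posdef_hermitian st.2 x0.
move: H; rewrite !sub_conj_siegel -!scalemxAr -!scalemxAl => /scalerI H.
by rewrite -(H two_i_neq0) /w map_trmx -!map_mxM mxE.
Qed.

End Action.

Lemma symplectic_translation (g : nat) (S : 'M[int]_g) : S^T = S ->
  symplectic (block_mx 1%:M S 0 1%:M).
Proof.
move=> SS; apply/symplectic_blockP; split.
- by rewrite mulmx0 trmx0 mul0mx.
- by rewrite SS trmx1 mulmx1 mul1mx.
- by rewrite trmx1 trmx0 mul0mx subr0 mulmx1.
Qed.

Lemma symplectic_unimodular (g : nat) (U W : 'M[int]_g) : U^T *m W = 1%:M ->
  symplectic (block_mx U 0 0 W).
Proof.
move=> UW; apply/symplectic_blockP; split.
- by rewrite mulmx0 trmx0 mul0mx.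
- by rewrite mulmx0 trmx0 mul0mx.
- by rewrite UW trmx0 mul0mx subr0.
Qed.

Section Invariance.
Variables (g : nat) (k : int) (f : 'M[C]_g -> C^o).
Hypothesis ftr : forall M tau, symplectic M -> siegel tau ->
  f (siegel_act M tau) = det_rep k (autom_factor M tau) (f tau).

Lemma form_translation (S : 'M[int]_g) tau : S^T = S -> siegel tau ->
  f (tau + intC S) = f tau.
Proof.
move=> SS st; have sM := symplectic_translation SS.
have J1 : autom_factor (block_mx 1%:M S 0 1%:M) tau = 1%:M.
  by rewrite /autom_factor block_mxKdl block_mxKdr /intC map_mx0 map_mx1 mul0mx add0r.
have := ftr sM st; rewrite (@siegel_act_unique _ _ _ sM st (tau + intC S)); last first.
  by rewrite J1 mulmx1 /act_num block_mxKul block_mxKur /intC map_mx1 mul1mx.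
by rewrite J1 /det_rep det1 exp1rz scale1r.
Qed.

Lemma form_unimodular (U W : 'M[int]_g) tau : U^T *m W = 1%:M -> siegel tau ->
  f (intC U *m tau *m (intC U)^T) = (\det (intC W : 'M[C]_g)) ^ k * f tau.
Proof.
move=> UW st; have sM := symplectic_unimodular UW.
have J1 : autom_factor (block_mx U 0 0 W) tau = intC W.
  by rewrite /autom_factor block_mxKdl block_mxKdr /intC map_mx0 mul0mx add0r.
have := ftr sM st.
rewrite (@siegel_act_unique _ _ _ sM st (intC U *m tau *m (intC U)^T)); last first.
  rewrite J1 /act_num block_mxKul block_mxKur -!mulmxA map_intr_trC -map_mxM UW.
  by rewrite map_mx1 mulmx1 /intC map_mx0 addr0.
by rewrite J1.
Qed.

End Invariance.
End SiegelAction.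

(** * The embedding of Sp(2p) x Sp(2q) into Sp(2(p + q)) *)

Section Embedding.
Context {R : realType}.
Local Notation C := R[i].

Lemma symplectic_intC (g : nat) (M : 'M[int]_(g + g)) : symplectic M ->
  let a : 'M[C]_g := intC (ulsubmx M) in let b : 'M[C]_g := intC (ursubmx M) in
  let c : 'M[C]_g := intC (dlsubmx M) in let d : 'M[C]_g := intC (drsubmx M) in
  c^T *m a = a^T *m c /\ d^T *m a - b^T *m c = 1%:M.
Proof.
rewrite -{1}[M]submxK => /symplectic_blockP[E1 _ E3] a b c d; split.
  by rewrite /a /c !map_intr_trC /intC -!map_mxM E1.
rewrite /a /b /c /d !map_intr_trC /intC -!map_mxM -map_mxB.
have -> : (drsubmx M)^T *m ulsubmx M - (ursubmx M)^T *m dlsubmx M = 1%:M.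
  by rewrite -[1%:M]trmx1 -E3 linearB/= !trmx_mul !trmxK.
by rewrite map_mx1.
Qed.

(** After multiplication by J^T this is a consequence of the symplectic relations. It rewrites the
    block a z in the action on a block matrix as T c z + (J^-1)^T z, whence the new off-diagonal
    block (J^-1)^T z. *)
Lemma siegel_act_numerator (g : nat) (M : 'M[int]_(g + g)) (tau : 'M[C]_g) :
  symplectic M -> siegel tau ->
  intC (ulsubmx M) = siegel_act M tau *m intC (dlsubmx M) + (invmx (autom_factor M tau))^T.
Proof.
move=> sM st; have [E1 E2] := symplectic_intC sM.
have JU := autom_factor_unit sM st.
set J := autom_factor M tau in JU *; have JTU : J^T \in unitmx by rewrite unitmx_tr.
rewrite -[LHS](mulKmx JTU) -[RHS](mulKmx JTU); congr (_ *m _).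
rewrite mulmxDr trmx_inv mulmxV// mulmxA -siegel_act_sym//.
rewrite -trmx_mul siegel_actP// /act_num /J /autom_factor !linearD/= !trmx_mul st.1.
rewrite !mulmxDl -!mulmxA E1 -[RHS]addrA; congr (_ + _).
by rewrite -E2 addrCA subrr addr0.
Qed.

Variables (p q : nat).

Definition symplectic_sum (M1 : 'M[int]_(p + p)) (M2 : 'M[int]_(q + q)) :
    'M[int]_((p + q) + (p + q)) :=
  block_mx (block_mx (ulsubmx M1) 0 0 (ulsubmx M2)) (block_mx (ursubmx M1) 0 0 (ursubmx M2))
           (block_mx (dlsubmx M1) 0 0 (dlsubmx M2)) (block_mx (drsubmx M1) 0 0 (drsubmx M2)).

Lemma symplectic_sumP M1 M2 : symplectic M1 -> symplectic M2 ->
  symplectic (symplectic_sum M1 M2).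
Proof.
rewrite -{1}[M1]submxK => /symplectic_blockP[A1 A2 A3].
rewrite -{1}[M2]submxK => /symplectic_blockP[B1 B2 B3].
apply/symplectic_blockP; rewrite !tr_block_mx !trmx0 !mulmx_block.
rewrite !mulmx0 !mul0mx !addr0 !add0r; split.
- by rewrite A1 B1.
- by rewrite A2 B2.
- by rewrite opp_block_mx add_block_mx A3 B3 !subr0 -scalar_mx_block.
Qed.

Lemma symplectic1 (g : nat) : symplectic (1%:M : 'M[int]_(g + g)).
Proof. by rewrite /symplectic/= trmx1 mul1mx mulmx1. Qed.

Definition gen_block (tau1 : 'M[C]_p) (z : 'M[C]_(p, q)) (tau2 : 'M[C]_q) : 'M[C]_(p + q) :=
  block_mx tau1 z z^T tau2.

Section Act.
Variables (tau1 : 'M[C]_p) (z : 'M[C]_(p, q)) (tau2 : 'M[C]_q).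
Hypothesis st : siegel (gen_block tau1 z tau2).

Lemma autom_factor_left (M1 : 'M[int]_(p + p)) :
  autom_factor (symplectic_sum M1 1%:M) (gen_block tau1 z tau2) =
  block_mx (autom_factor M1 tau1) (intC (dlsubmx M1) *m z) 0 1%:M.
Proof.
rewrite /autom_factor /symplectic_sum block_mxKdl block_mxKdr.
rewrite [1%:M]scalar_mx_block block_mxKdl block_mxKdr.
rewrite /intC !map_block_mx !map_mx0 map_mx1 mulmx_block !mul0mx !addr0 add_block_mx.
by rewrite !addr0 !add0r.
Qed.

Lemma act_left (M1 : 'M[int]_(p + p)) : symplectic M1 -> siegel tau1 ->
  let u := (invmx (autom_factor M1 tau1))^T *m z in
  siegel_act (symplectic_sum M1 1%:M) (gen_block tau1 z tau2) =
  gen_block (siegel_act M1 tau1) u (tau2 - u^T *m intC (dlsubmx M1) *m z).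
Proof.
move=> sM st1 u; apply: siegel_act_unique => //.
  by apply: symplectic_sumP => //; exact: symplectic1.
rewrite autom_factor_left mulmx_block !mulmx0 !mulmx1 !addr0.
rewrite /act_num /symplectic_sum block_mxKul block_mxKur.
rewrite [1%:M]scalar_mx_block block_mxKul block_mxKur.
rewrite /intC !map_block_mx !map_mx0 map_mx1 mulmx_block !mul0mx !mul1mx !addr0 !add0r.
rewrite add_block_mx !addr0; congr block_mx.
- exact: siegel_actP.
- rewrite -/(intC (ulsubmx M1)) (siegel_act_numerator sM st1) mulmxDl.
  by rewrite mulmxA.
- by rewrite /u trmx_mul trmxK mulmxKV// autom_factor_unit.
- by rewrite -/(intC (dlsubmx M1)) mulmxA addrC subrK.
Qed.

Lemma autom_factor_right (M2 : 'M[int]_(q + q)) :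
  autom_factor (symplectic_sum 1%:M M2) (gen_block tau1 z tau2) =
  block_mx 1%:M 0 (intC (dlsubmx M2) *m z^T) (autom_factor M2 tau2).
Proof.
rewrite /autom_factor /symplectic_sum block_mxKdl block_mxKdr.
rewrite [1%:M]scalar_mx_block block_mxKdl block_mxKdr.
rewrite /intC !map_block_mx !map_mx0 map_mx1 mulmx_block !mul0mx !add0r add_block_mx.
by rewrite !addr0 !add0r.
Qed.

Lemma act_right (M2 : 'M[int]_(q + q)) : symplectic M2 -> siegel tau2 ->
  let u := z *m invmx (autom_factor M2 tau2) in
  siegel_act (symplectic_sum 1%:M M2) (gen_block tau1 z tau2) =
  gen_block (tau1 - u *m intC (dlsubmx M2) *m z^T) u (siegel_act M2 tau2).
Proof.
move=> sM st2 u; apply: siegel_act_unique => //.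
  by apply: symplectic_sumP => //; exact: symplectic1.
rewrite autom_factor_right mulmx_block !mulmx0 !mulmx1 !add0r.
rewrite /act_num /symplectic_sum block_mxKul block_mxKur.
rewrite [1%:M]scalar_mx_block block_mxKul block_mxKur.
rewrite /intC !map_block_mx !map_mx0 map_mx1 mulmx_block !mul0mx !mul1mx !addr0 !add0r.
rewrite add_block_mx !addr0; congr block_mx.
- by rewrite -/(intC (dlsubmx M2)) mulmxA subrK.
- by rewrite /u mulmxKV// autom_factor_unit.
- rewrite -/(intC (ulsubmx M2)) (siegel_act_numerator sM st2) mulmxDl.
  by rewrite /u trmx_mul addrC mulmxA.
- exact: siegel_actP.
Qed.

End Act.

Variables (k : int) (f : 'M[C]_(p + q) -> C^o).
Hypothesis ftr : forall M tau, symplectic M -> siegel tau ->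
  f (siegel_act M tau) = det_rep k (autom_factor M tau) (f tau).

Lemma form_left M1 tau1 z tau2 : symplectic M1 -> siegel tau1 ->
  siegel (gen_block tau1 z tau2) ->
  let u := (invmx (autom_factor M1 tau1))^T *m z in
  f (gen_block (siegel_act M1 tau1) u (tau2 - u^T *m intC (dlsubmx M1) *m z)) =
  (\det (autom_factor M1 tau1)) ^ k * f (gen_block tau1 z tau2).
Proof.
move=> sM st1 st u; have := ftr (symplectic_sumP sM (symplectic1 q)) st.
rewrite (act_left st sM st1) autom_factor_left /det_rep det_ublock det1 mulr1.
exact.
Qed.

Lemma form_right M2 tau1 z tau2 : symplectic M2 -> siegel tau2 ->
  siegel (gen_block tau1 z tau2) ->
  let u := z *m invmx (autom_factor M2 tau2) in
  f (gen_block (tau1 - u *m intC (dlsubmx M2) *m z^T) u (siegel_act M2 tau2)) =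
  (\det (autom_factor M2 tau2)) ^ k * f (gen_block tau1 z tau2).
Proof.
move=> sM st2 st u; have := ftr (symplectic_sumP (symplectic1 p) sM) st.
rewrite (act_right st sM st2) autom_factor_right /det_rep det_lblock det1 mul1r.
exact.
Qed.

End Embedding.

(** * The Siegel space as an open condition *)

Section SiegelOpen.
Context {R : realType}.
Local Notation C := R[i].

Lemma continuous_big_sum (T : topologicalType) (I : Type) (s : seq I) (F : I -> T -> R) :
  (forall i, continuous (F i)) -> continuous (fun x => \sum_(i <- s) F i x).
Proof.
move=> Fc; elim: s => [|i s IH].
  have -> : (fun x => \sum_(i <- [::]) F i x) = (fun=> 0).
    by apply/funext => y; rewrite big_nil.
  by move=> x; exact: cst_continuous.
have -> : (fun x => \sum_(i <- i :: s) F i x) = (fun y => F i y + \sum_(i <- s) F i y).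
  by apply/funext => y; rewrite big_cons.
by move=> x; apply: continuousD; [exact: Fc|exact: IH].
Qed.

(** The preimage of the Siegel space under the projection to symmetric matrices: the domain on which
    derivatives in the space of all matrices make sense. *)
Definition sym_siegel (g : nat) : set 'M[C]_g := [set w | siegel (sym_part w)].

Lemma sym_partK (g : nat) (w : 'M[C]_g) : w^T = w -> sym_part w = w.
Proof.
by move=> ww; apply/matrixP => i j; rewrite /sym_part ww !mxE; field.
Qed.

Lemma sym_part_sym (g : nat) (w : 'M[C]_g) : (sym_part w)^T = sym_part w.
Proof. by rewrite /sym_part linearZ/= linearD/= trmxK addrC. Qed.

Lemma siegel_sym_siegel (g : nat) (w : 'M[C]_g) : siegel w -> sym_siegel w.
Proof. by move=> sw; rewrite /sym_siegel/= sym_partK//; exact: sw.1. Qed.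

Local Notation MC g := ('M[C]_g : normedModType C).

(** Positivity on the compact unit sphere persists for nearby matrices, and homogeneity extends it
    to all nonzero vectors. *)
Lemma open_sym_siegel (g : nat) : open (@sym_siegel g : set (MC g)).
Proof.
rewrite openE => w sw; rewrite /interior.
pose S : set 'rV[R]_g := [set v | `|v| = 1].
have cS : compact S.
  apply: bounded_closed_compact.
    by exists 1; split; [exact: num_real|move=> x x1 v /= ->; exact: ltW].
  apply: (@closed_comp _ _ (fun v : 'rV[R]_g => `|v|) [set 1]); last exact: closed_eq.
  by move=> v _; exact: norm_continuous.
pose Q (p : 'rV[R]_g * MC g) : R :=
  \sum_j \sum_i p.1 0 i * complex.Im (sym_part p.2 i j) * p.1 0 j.
have QE (v : 'rV[R]_g) (w' : 'M[C]_g) :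
    (v *m map_mx (@complex.Im R) (sym_part w') *m v^T) 0 0 = Q (v, w').
  by rewrite quadE /Q; apply: eq_bigr => j _; apply: eq_bigr => i _; rewrite mxE.
have Qc : continuous Q.
  have c1 l : continuous (fun p : 'rV[R]_g * MC g => p.1 0 l).
    move=> p; apply: (@continuous_comp _ _ _ (fun p : 'rV[R]_g * MC g => p.1)
      (fun v : 'rV[R]_g => v 0 l)); first exact: cvg_fst.
    exact: coord_continuous.
  have c2 l m : continuous (fun p : 'rV[R]_g * MC g => complex.Im (p.2 l m)).
    move=> p; apply: (@continuous_comp _ C^o _ (fun p : 'rV[R]_g * MC g => p.2 l m)
      (@complex.Im R)); last exact: continuous_Im.
    apply: (@continuous_comp _ (MC g) C^o (fun p : 'rV[R]_g * MC g => p.2)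
      (fun v : MC g => v l m)); first exact: cvg_snd.
    exact: coord_continuous.
  apply: continuous_big_sum => j; apply: continuous_big_sum => i.
  have -> : (fun p : 'rV[R]_g * MC g =>
      p.1 0 i * complex.Im (sym_part p.2 i j) * p.1 0 j) =
    (fun p : 'rV[R]_g * MC g =>
    p.1 0 i * (2^-1 * (complex.Im (p.2 i j) + complex.Im (p.2 j i))) * p.1 0 j).
    apply/funext => p'; rewrite /sym_part !mxE; congr (_ * _ * _).
    have -> : 2^-1 = (2^-1 : R)%:C :> C.
      by rewrite rmorphV/= ?unitfE ?pnatr_eq0// rmorph_nat.
    case: (p'.2 i j) (p'.2 j i) => [a b] [c d].
    by rewrite /= mul0r addr0.
  move=> p; apply: cvgM; last exact: c1.
  apply: cvgM; first exact: c1.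
  apply: cvgM; first exact: cvg_cst.
  by apply: cvgD; exact: c2.
have H : \forall w' \near (w : MC g), S `<=` (fun v => 0 < Q (v, w')).
  have /compact_near_coveringP cov := cS.
  apply: (cov _ (nbhs (w : MC g)) (fun w' v => 0 < Q (v, w'))) => v Sv.
  have Q0 : 0 < Q (v, w).
    rewrite -QE; apply: sw.2; apply/eqP => v0; move: Sv.
    by rewrite /S/= v0 normr0 => /eqP; rewrite eq_sym oner_eq0.
  have : \forall p \near (v, w : MC g), 0 < Q p.
    apply: (Qc (v, w : MC g) [set y | 0 < y]); apply: open_nbhs_nbhs.
    by split; [exact: open_gt|exact: Q0].
  by case=> -[A B] [/= nA nB] AB; exists (A, B) => //= -[a b] /= ab; exact: (AB (a, b)).
apply: filterS H => w' hw'; split; first exact: sym_part_sym.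
move=> v v0; have nv : 0 < `|v| by rewrite normr_gt0.
have := hw' (`|v|^-1 *: v); rewrite /S/= normrZ normfV normr_id mulVf ?gt_eqF//.
move=> /(_ erefl); rewrite -QE linearZ/= -!scalemxAl -!scalemxAr !mxE.
by rewrite !pmulr_rgt0 ?invr_gt0.
Qed.

End SiegelOpen.

(** * Taylor polynomials in the off-diagonal block *)

Section MevalInjective.

Lemma base_digits_inj (K n : nat) (a b : 'I_n -> nat) :
  (forall i, (a i < K)%N) -> (forall i, (b i < K)%N) ->
  (\sum_(i < n) a i * K ^ i = \sum_(i < n) b i * K ^ i)%N -> forall i, a i = b i.
Proof.
elim: n a b => [a b _ _ _ []//|n IH] a b aK bK.
have expand (c : 'I_n.+1 -> nat) : (\sum_(i < n.+1) c i * K ^ i =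
    (\sum_(i < n) c (lift ord0 i) * K ^ i) * K + c ord0)%N.
  rewrite big_ord_recl expn0 muln1 addnC; congr (_ + _)%N.
  rewrite big_distrl/=; apply: eq_bigr => i _.
  by rewrite /bump/= add1n expnSr mulnA.
rewrite !expand => E i; have K0 : (0 < K)%N by exact: leq_ltn_trans (leq0n _) (aK ord0).
have E0 : a ord0 = b ord0.
  by have := congr1 (modn^~ K) E; rewrite !modnMDl !modn_small.
have E1 := IH (fun i => a (lift ord0 i)) (fun i => b (lift ord0 i))
  (fun i => aK _) (fun i => bK _).
have {}E1 j : a (lift ord0 j) = b (lift ord0 j).
  apply: E1; apply/eqP; move/eqP: E; rewrite E0 eqn_add2r eqn_pmul2r//.
by case: (unliftP ord0 i) => [j ->|->].
Qed.

(* Kronecker substitution reduces to one variable. *)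
Lemma meval_inj0 (F : numDomainType) (n : nat) (p : mpoly n F) :
  (forall v, meval v p = 0) -> p = 0.
Proof.
move=> p0; apply/eqP/negPn/negP => pn0.
(* Larger than every exponent in [p], so that [phi m] is a base [K] expansion and determines [m]. *)
pose K := (mmeasure mdeg p).+1.
pose phi (m : multinom n) := (\sum_(i < n) m i * K ^ i)%N.
have mK m : m \in msupp p -> forall i, (m i < K)%N.
  move=> mp i; rewrite /K ltnS; apply: leq_trans (ltnW (msize_mdeg_lt mp)).
  by rewrite mdegE (bigD1 i)//= leq_addr.
pose q : {poly F} := \sum_(m <- msupp p) mcoeff m p *: 'X^(phi m).
have q0 t : q.[t] = 0.
  rewrite -(p0 (fun i => t ^+ (K ^ i))) mevalE /q horner_sum.
  apply: eq_bigr => m _; rewrite hornerZ hornerXn; congr (_ * _).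
  rewrite /phi; elim/big_rec2: _ => [|i x y _ <-]; first by rewrite expr0.
  by rewrite exprD -exprM mulnC.
have : q = 0.
  apply/eqP/negPn/negP => qn0.
  have h1 : all (root q) [seq i%:R | i <- iota 0 (size q)].
    by apply/allP => x _; rewrite /root q0.
  have h2 : uniq [seq (i%:R : F) | i <- iota 0 (size q)].
    rewrite map_inj_uniq ?iota_uniq// => i j /eqP.
    by rewrite eqr_nat => /eqP.
  have := max_poly_roots qn0 h1 h2.
  by rewrite size_map size_iota ltnn.
have [m mp] : exists m, m \in msupp p.
  move: pn0; rewrite -msize_poly_eq0 msize_msupp0; case: (msupp p) => // m s _.
  by exists m; rewrite mem_head.
move=> qE; have := congr1 (fun r : {poly F} => r`_(phi m)) qE.
rewrite coef0 /q coef_sum (bigD1_seq m)//= ?msupp_uniq//.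
rewrite coefZ coefXn eqxx mulr1 big1_seq ?addr0; last first.
  move=> m' /andP[mm' m'p]; rewrite coefZ coefXn.
  case: eqP => [E|_]; last by rewrite mulr0.
  case/eqP: mm'; apply/mnmP => i; symmetry.
  by apply: (base_digits_inj (K := K)) (esym _) i => //; exact: mK.
by move=> /eqP; rewrite mcoeff_eq0 mp.
Qed.

Lemma meval_inj (F : numDomainType) (n : nat) (p q : mpoly n F) :
  (forall v, meval v p = meval v q) -> p = q.
Proof.
move=> pq; apply/eqP; rewrite -subr_eq0; apply/eqP/meval_inj0 => v.
by rewrite mevalB pq subrr.
Qed.

End MevalInjective.

Section MatrixNorm.
Context {R : realType}.
Local Notation C := R[i].

Lemma rnorm_mx_entry (m n : nat) (x : 'M[C]_(m, n)) i j :
  normc (x i j) <= rnorm (x : 'M[C]_(m, n)).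
Proof.
rewrite -lecR -normv_rnorm.
suff H : `|x i j| <= mx_norm x by exact: H.
rewrite mx_normE; have -> : `|x i j| = (`|x i j|%:nng)%:num by [].
by rewrite num_le; apply/bigmax_geP; right; exists (i, j).
Qed.

Lemma rnorm_mx_le (m n : nat) (x : 'M[C]_(m, n)) (c : R) : 0 <= c ->
  (forall i j, normc (x i j) <= c) -> rnorm (x : 'M[C]_(m, n)) <= c.
Proof.
move=> c0 xc; rewrite -lecR -normv_rnorm.
suff H : mx_norm x <= c%:C by exact: H.
have [->|x0] := eqVneq (mx_norm x) 0; first by rewrite ler0c.
have [[i j] /= ->] := mx_norm_neq0 x0.
have -> : `|x i j| = (normc (x i j))%:C by [].
by rewrite lecR.
Qed.

End MatrixNorm.

Section Affine.
Context {R : realType}.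
Local Notation C := R[i].

Lemma linear_exW (V W : normedModType C) (L : V -> W) : linear L ->
  exists L' : {linear V -> W}, L' =1 L.
Proof.
move=> Ll; pose Lm := GRing.isLinear.Build C V W *:%R L Ll.
by exists (HB.pack L Lm : {linear V -> W}).
Qed.

Lemma differentiable_affine (V W : normedModType C) (A L : V -> W) (K : R) x :
  linear L -> (forall h, rnorm (L h) <= K * rnorm h) ->
  (forall h, A (x + h) = A x + L h) -> differentiable A x.
Proof.
move=> /linear_exW[L' LE] LK AL.
have K1 : 0 < `|K| + 1 by rewrite ltr_wpDl.
have [] // := @eps_differentiable R V W A x L'; last first.
  move=> e e0; exists 1 => // h _; rewrite AL LE [A x + _]addrC addrK subrr rnorm0.
  by rewrite mulr_ge0 ?rnorm_ge0// ltW.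
move=> y; apply/continuous_epsP => e e0; exists (e / (`|K| + 1)); first by rewrite divr_gt0.
move=> h hr; rewrite linearD addrAC subrr add0r LE.
apply: le_trans (LK h) _; apply: le_trans (_ : (`|K| + 1) * rnorm h <= _).
  by rewrite ler_wpM2r ?rnorm_ge0//; have := ler_norm K; lra.
by rewrite mulrC -ler_pdivlMr// ltW.
Qed.

Lemma holo_affine (V W : normedModType C) (A L : V -> W) (K : R) (phi : W -> C) x :
  linear L -> (forall h, rnorm (L h) <= K * rnorm h) ->
  (forall h, A (x + h) = A x + L h) -> holo phi (A x) -> holo (fun y => phi (A y)) x.
Proof.
move=> Ll LK AL [hA]; split; apply: (differentiable_comp _ hA).
exact: differentiable_affine Ll LK AL.
Qed.

End Affine.

Section Jet.
Context {R : realType}.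
Local Notation C := R[i].
Local Notation MC g := ('M[C]_g : normedModType C).

Lemma linear_sym_part (g : nat) : linear (@sym_part R g : MC g -> MC g).
Proof.
by move=> a u v; apply/matrixP => i j; rewrite /sym_part !mxE; ring.
Qed.

Lemma rnorm_sym_part (g : nat) (h : MC g) : rnorm (sym_part h : MC g) <= 1 * rnorm h.
Proof.
rewrite mul1r; apply: rnorm_mx_le; first exact: rnorm_ge0.
move=> i j; rewrite /sym_part !mxE normcM normcV.
have -> : normc (2 : C) = 2 by rewrite -[2](rmorph_nat (real_complex R)) normc_real normr_nat.
rewrite ler_pdivrMl//; apply: le_trans (normcD _ _) _.
by have := rnorm_mx_entry h i j; have := rnorm_mx_entry h j i; lra.
Qed.

(** Holomorphy of forms is stated in the coordinates of an unspecified basis, even for scalar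
    values; [F] is recovered as a combination of them. *)
Lemma holo_scalar_coordinate (V : normedModType C) (F : V -> C^o) x :
  (forall i, holo (fun y => coordinate i (F y)) x) -> holo F x.
Proof.
move=> hF; pose b := vbasis {:(C^o)%type}.
have E y : F y = \sum_i coordinate i (F y) * b`_i.
  by rewrite [LHS](coord_vbasis (memvf (F y))).
have : holo (fun y => \sum_i coordinate i (F y) * b`_i) x.
  by apply: holo_sum => i; apply: holoM; [exact: hF|exact: holo_cst].
by apply: holo_near; exists 1 => // h _; rewrite -E.
Qed.

Variables (n : nat) (f : 'M[C]_(1 + n) -> C^o).
Hypothesis hol : holomorphic_siegel f.

Definition symmetrized (w : MC (1 + n)) : C := f (sym_part w).

(** The hypothesis [hol] gives differentiability at symmetric points only. Elsewhere it follows by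
    the chain rule, since [symmetrized] is unchanged by composition with the linear map
    [sym_part]. *)
Lemma holo_symmetrized : holo_on (@sym_siegel R (1 + n) : set (MC (1 + n))) symmetrized.
Proof.
move=> w sw; have symK : sym_part (sym_part w) = sym_part w.
  by rewrite sym_partK// sym_part_sym.
have H : holo symmetrized (sym_part w : MC (1 + n)).
  by apply: holo_scalar_coordinate => i; split; exact: hol.
have : holo (fun y => symmetrized (sym_part y : MC (1 + n))) w.
  apply: (@holo_affine _ _ _ (@sym_part R (1 + n) : MC (1 + n) -> MC (1 + n))
    (@sym_part R (1 + n) : MC (1 + n) -> MC (1 + n)) 1).
  - exact: linear_sym_part.
  - exact: rnorm_sym_part.
  - by move=> h; rewrite -[h in LHS]scale1r addrC linear_sym_part scale1r addrC.
  - exact: H.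
apply: holo_near; exists 1 => // h _.
by rewrite /symmetrized (sym_partK (sym_part_sym _)).
Qed.

Definition zdir (z : 'rV[C]_n) : MC (1 + n) := block_mx 0 z z^T 0.

Lemma block_tauD (t1 : 'M[C]_1) (z y : 'rV[C]_n) (t2 : 'M[C]_n) :
  block_tau t1 (z + y) t2 = block_tau t1 z t2 + zdir y.
Proof. by rewrite /block_tau /zdir add_block_mx !addr0 linearD. Qed.

Lemma zdirZ (a : C) z : zdir (a *: z) = a *: zdir z.
Proof. by rewrite /zdir scale_block_mx !scaler0 linearZ. Qed.

Lemma block_tau0 (t1 : 'M[C]_1) (z : 'rV[C]_n) (t2 : 'M[C]_n) :
  block_tau t1 z t2 = block_tau t1 0 t2 + zdir z.
Proof. by rewrite -block_tauD add0r. Qed.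

Lemma zdir_sum (zeta : 'I_n -> C) :
  zdir (\row_b zeta b) = \sum_(b < n) zeta b *: zdir (delta_mx 0 b).
Proof.
have -> : \row_b zeta b = \sum_(b < n) zeta b *: delta_mx 0 b :> 'rV[C]_n.
  by rewrite [LHS]row_sum_delta; apply: eq_bigr => b _; rewrite mxE.
have z0 : zdir 0 = 0 by rewrite /zdir trmx0 block_mx0.
rewrite (big_morph zdir (_ : {morph zdir : x y / x + y}) z0).
  by apply: eq_bigr => b _; rewrite zdirZ.
by move=> x y; rewrite /zdir add_block_mx !addr0 linearD.
Qed.

Lemma dirderiv_block (psi : MC (1 + n) -> C) (t1 : 'M[C]_1) (t2 : 'M[C]_n) (e : 'rV[C]_n) z :
  'D_e ((fun z => psi (block_tau t1 z t2)) : 'rV[C]_n -> C^o) z =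
  dirderiv (zdir e) psi (block_tau t1 z t2).
Proof.
rewrite /dirderiv /derive.
suff -> : (fun h : C => h^-1 *: (((fun z => psi (block_tau t1 z t2) : C^o) \o shift z) (h *: e) -
     psi (block_tau t1 z t2))) = (fun h : C => h^-1 *: (((psi : _ -> C^o) \o
       shift (block_tau t1 z t2 : MC (1 + n))) (h *: zdir e) - psi (block_tau t1 z t2))) by [].
by apply/funext => h /=; rewrite [_ + z]addrC block_tauD zdirZ [_ + h *: zdir _]addrC.
Qed.

Lemma partial_mixed (psi : MC (1 + n) -> C) (t1 : 'M[C]_1) (t2 : 'M[C]_n) (m : multinom n) :
  partial m (fun z => psi (block_tau t1 z t2) : C^o) =
  fun z => mixed (fun b => zdir (delta_mx 0 b)) m psi (block_tau t1 z t2).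
Proof.
rewrite /partial /mixed; elim: (enum 'I_n) => [//|b s /= ->].
elim: (m b) => [//|k IH]; rewrite iterS IH.
by apply/funext => z; rewrite dirderiv_block.
Qed.

Lemma block_tau_sym (t1 : 'M[C]_1) (z : 'rV[C]_n) (t2 : 'M[C]_n) :
  t2^T = t2 -> (block_tau t1 z t2)^T = block_tau t1 z t2.
Proof.
move=> E; rewrite /block_tau tr_block_mx trmxK E; congr (block_mx _ _ _ _).
by apply/matrixP => i j; rewrite !ord1 mxE.
Qed.

Lemma symmetrized_block (t1 : 'M[C]_1) (z : 'rV[C]_n) (t2 : 'M[C]_n) : t2^T = t2 ->
  symmetrized (block_tau t1 z t2) = f (block_tau t1 z t2).
Proof. by move=> E; rewrite /symmetrized sym_partK// block_tau_sym. Qed.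

Lemma taylor_coeff_mixed (t1 : 'M[C]_1) (t2 : 'M[C]_n) (m : multinom n) : t2^T = t2 ->
  taylor_coeff f m t1 t2 = (\prod_(b < n) (m b)`!%:R)^-1 *
    mixed (fun b => zdir (delta_mx 0 b)) m symmetrized (block_tau t1 0 t2).
Proof.
move=> E; rewrite /taylor_coeff; congr (_ * _).
have -> : (fun z => f (block_tau t1 z t2)) =
    (fun z => symmetrized (block_tau t1 z t2) : C^o).
  by apply/funext => z; rewrite symmetrized_block.
by rewrite partial_mixed.
Qed.

Lemma mcoeff_taylor_poly (r : nat) t1 t2 (m : multinom n) :
  mcoeff m (taylor_poly r f t1 t2) = if mdeg m == r then taylor_coeff f m t1 t2 else 0.
Proof.
rewrite /taylor_poly raddf_sum/=; under eq_bigr do rewrite mcoeffZ mcoeffX.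
case: eqP => mr; last first.
  rewrite big1// => k /eqP kr; case: eqP => [km|_]; last by rewrite mulr0.
  by case: mr; rewrite -km.
have mb : (mdeg m < r.+1)%N by rewrite mr.
rewrite (bigD1 (BMultinom mb))/= ?mr//= eqxx mulr1 big1 ?addr0// => k /andP[_ km].
by case: eqP => [kE|_]; rewrite ?mulr0//; move: km; rewrite -val_eqE/= kE eqxx.
Qed.

(** The value of t_r(f) at zeta, as a Taylor coefficient in one variable; in this form it can be
    read off as a limit along s |-> s zeta. *)
Definition leading (r : nat) (zeta : 'rV[C]_n) (p : MC (1 + n)) : C :=
  r`!%:R^-1 * diter (zdir zeta) r symmetrized p.

Lemma meval_taylor_poly (r : nat) t1 t2 (zeta : 'I_n -> C) : t2^T = t2 ->
  sym_siegel (block_tau t1 0 t2) ->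
  meval zeta (taylor_poly r f t1 t2) = leading r (\row_b zeta b) (block_tau t1 0 t2).
Proof.
move=> E Om; rewrite /leading zdir_sum.
rewrite (diter_mixed (fun b => zdir (delta_mx 0 b)) (@open_sym_siegel R (1 + n))
  holo_symmetrized zeta r Om).
rewrite mulrA mulVf ?mul1r; last by rewrite pnatr_eq0 -lt0n fact_gt0.
rewrite /taylor_poly raddf_sum/=; apply: eq_bigr => m _.
rewrite mevalZ mevalX taylor_coeff_mixed// mulrAC; congr (_ * _).
rewrite /mweight -prodfV -big_split/=; apply: eq_bigr => b _.
by rewrite mulrC.
Qed.

End Jet.

(** * The leading term *)

Section BlockSiegel.
Context {R : realType}.
Local Notation C := R[i].
Variables (p q : nat).

Lemma siegel_gen_block0 (t1 : 'M[C]_p) (t2 : 'M[C]_q) : siegel t1 -> siegel t2 -> siegel (gen_block t1 0 t2).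
Proof.
move=> [s1 p1] [s2 p2]; rewrite /gen_block trmx0; split.
  by rewrite tr_block_mx !trmx0 s1 s2.
move=> v; rewrite -[v]hsubmxK; move: (lsubmx v) (rsubmx v) => l m v0.
rewrite map_block_mx !map_mx0.
rewrite mul_row_block !mulmx0 addr0 add0r tr_row_mx mul_row_col mxE.
have nn (g : nat) (Y : 'M[R]_g) (w : 'rV[R]_g) : posdef Y -> 0 <= (w *m Y *m w^T) 0 0.
  by move=> pY; have [->|/pY/ltW//] := eqVneq w 0; rewrite !mul0mx mxE.
have [l0|/p1 lp] := eqVneq l 0; last by rewrite ltr_pwDl// nn.
have [r0|/p2 rp] := eqVneq m 0; last by rewrite ltr_wpDl// nn.
by case/eqP: v0; rewrite l0 r0 row_mx0.
Qed.

Lemma siegel_gen_blockl (t1 : 'M[C]_p) z (t2 : 'M[C]_q) : siegel (gen_block t1 z t2) -> siegel t1.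
Proof.
move=> [s0 p0]; split.
  by move: s0; rewrite /gen_block tr_block_mx => /eq_block_mx[].
move=> v v0; have := p0 (row_mx v 0); rewrite map_block_mx.
rewrite mul_row_block !mul0mx !addr0 tr_row_mx mul_row_col trmx0 mulmx0 addr0; apply.
by apply: contraNneq v0 => /(congr1 lsubmx); rewrite row_mxKl linear0 => ->.
Qed.

Lemma siegel_gen_blockr (t1 : 'M[C]_p) z (t2 : 'M[C]_q) : siegel (gen_block t1 z t2) -> siegel t2.
Proof.
move=> [s0 p0]; split.
  by move: s0; rewrite /gen_block tr_block_mx => /eq_block_mx[].
move=> v v0; have := p0 (row_mx 0 v); rewrite map_block_mx.
rewrite mul_row_block !mul0mx !add0r tr_row_mx mul_row_col trmx0 mulmx0 add0r; apply.
by apply: contraNneq v0 => /(congr1 rsubmx); rewrite row_mxKr linear0 => ->.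
Qed.

End BlockSiegel.

Section LeadingTerm.
Context {R : realType}.
Local Notation C := R[i].
Local Notation MC g := ('M[C]_g : normedModType C).
Variables (n r : nat) (f : 'M[C]_(1 + n) -> C^o).
Hypothesis hol : holomorphic_siegel f.
Hypothesis hlow : forall i : nat, (i < r)%N -> forall tau1 tau2,
  siegel tau1 -> siegel tau2 -> taylor_part i f tau1 tau2 = 0.

Let Om : set (MC (1 + n)) := @sym_siegel R (1 + n).
Let Phi := symmetrized f.

Lemma leading_vanish j zeta t1 t2 : (j < r)%N -> siegel t1 -> siegel t2 ->
  diter (zdir zeta) j Phi (block_tau t1 0 t2) = 0.
Proof.
move=> jr s1 s2; have sb : Om (block_tau t1 0 t2).
  exact/siegel_sym_siegel/siegel_gen_block0.
have := @meval_taylor_poly R n f hol j t1 t2 (fun b => zeta 0 b) s2.1 sb.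
have -> : \row_b zeta 0 b = zeta by apply/matrixP => i b; rewrite ord1 mxE.
have /(congr1 val) /= -> := hlow jr s1 s2.
have fn : (j`!%:R^-1 : C) != 0 by rewrite invr_eq0 pnatr_eq0 -lt0n fact_gt0.
by rewrite meval0 /leading => /esym/eqP; rewrite mulf_eq0 (negbTE fn)/= => /eqP.
Qed.

(** The expansion is taken at the moving point [ps], which has zero off-diagonal block, so that the
    terms of degree below r vanish there too. The uniform remainder of [taylor_leading] and the
    continuity of [leading] in its base point give the limit. *)
Lemma leading_limit zeta t1 t2 (A : 'M[C]_1) (B : 'M[C]_n) :
  siegel t1 -> siegel t2 -> B^T = B ->
  forall e : R, 0 < e -> exists2 d : R, 0 < d & forall s : C, normc s < d ->
    sym_siegel (block_tau (t1 + s ^+ 2 *: A) (s *: zeta) (t2 + s ^+ 2 *: B)) /\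
    normc (Phi (block_tau (t1 + s ^+ 2 *: A) (s *: zeta) (t2 + s ^+ 2 *: B)) -
      s ^+ r * leading f r zeta (block_tau t1 0 t2)) <= e * normc s ^+ r.
Proof.
move=> s1 s2 BB e e0; pose p0 : MC (1 + n) := block_tau t1 0 t2.
have sp0 : Om p0 by exact/siegel_sym_siegel/siegel_gen_block0.
have Oo : open Om by exact: open_sym_siegel.
have [q [M [q0 qO hd hM]]] := holo_locally_bounded Oo sp0 (holo_symmetrized hol).
pose P : MC (1 + n) := block_tau A 0 B.
have AA : A^T = A by apply/matrixP => i j; rewrite !ord1 mxE.
pose v := zdir zeta.
have v1 : 0 < rnorm v + 1 by rewrite ltr_wpDl// rnorm_ge0.
have P1 : 0 < rnorm P + 1 by rewrite ltr_wpDl// rnorm_ge0.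
have q2 : 0 < q / 2 by rewrite divr_gt0.
have M0 : 0 <= M by apply: le_trans (normc_ge0 _) (hM p0 _); rewrite subrr rnorm0.
pose w := derive_radius v (q / 2).
have w0 : 0 < w by rewrite divr_gt0// mulr_gt0.
pose K := 2 * M / w ^+ r.+1.
have K0 : 0 < K + 1.
  by rewrite ltr_wpDl// divr_ge0 ?mulr_ge0// exprn_ge0// ltW.
have hl : holo (fun p => leading f r zeta p) p0.
  apply: holoM; first exact: holo_cst.
  exact: (holo_diter v r Oo (holo_symmetrized hol)).
have e2 : 0 < e / 2 by rewrite divr_gt0.
have [d1 d10 h1] := holo_eps hl e2.
(* In order: |s^2| <= |s|; s within the range of [taylor_leading]; [ps] within q / 2 of [p0];
   [s *: v] shorter than q / 2; [leading] changed by at most e / 2; Taylor remainder at most e / 2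
   times |s|^r. *)
pose d := Num.min (Num.min 1 (w / 2)) (Num.min (Num.min (q / 2 / (rnorm P + 1))
  (q / 2 / (rnorm v + 1))) (Num.min (d1 / (rnorm P + 1)) (e / 2 / (K + 1)))).
exists d.
  rewrite /d !lt_min; do ![apply/andP; split]; first exact: ltr01; exact: divr_gt0.
move=> s; rewrite /d !lt_min => /andP[/andP[sd1 sw] /andP[/andP[sP sv] /andP[sd sK]]].
have n0 := normc_ge0 s.
have s2P : rnorm (s ^+ 2 *: P) <= normc s * (rnorm P + 1).
  rewrite rnormZ normcX expr2 -mulrA; apply: ler_wpM2l => //.
  apply: le_trans (_ : 1 * rnorm P <= _); last by rewrite mul1r lerDl.
  by apply: ler_wpM2r; [exact: rnorm_ge0|exact: ltW].
rewrite (ltr_pdivlMr _ _ P1) in sP; rewrite (ltr_pdivlMr _ _ P1) in sd.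
rewrite (ltr_pdivlMr _ _ v1) in sv; rewrite (ltr_pdivlMr _ _ K0) in sK.
pose ps : MC (1 + n) := p0 + s ^+ 2 *: P.
have psE : ps = block_tau (t1 + s ^+ 2 *: A) 0 (t2 + s ^+ 2 *: B).
  rewrite /ps /p0 /P /block_tau scale_block_mx add_block_mx !scaler0 !addr0 trmx0.
  by rewrite scaler0 addr0.
have xE : block_tau (t1 + s ^+ 2 *: A) (s *: zeta) (t2 + s ^+ 2 *: B) = ps + s *: v :> MC _.
  by rewrite block_tau0 -psE zdirZ.
have psp : rnorm (ps - p0) < q / 2.
  by rewrite /ps addrAC subrr add0r; exact: le_lt_trans s2P sP.
have inb y : rnorm (y - ps) < q / 2 -> rnorm (y - p0) < q.
  move=> yp; have := rnormD (y - ps) (ps - p0); rewrite addrA subrK.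
  by move=> /le_lt_trans; apply; rewrite (splitr q) ltrD.
have xq : rnorm (ps + s *: v - p0) < q.
  apply: inb; rewrite addrAC subrr add0r rnormZ.
  by apply: le_lt_trans sv; apply: ler_wpM2l => //; rewrite lerDl.
split; first by rewrite xE; exact: qO.
rewrite xE.
have sps : siegel ps.
  have : sym_siegel ps by apply: qO; apply: lt_trans psp _; rewrite ltr_pdivrMr// ltr_pMr// ltr1n.
  rewrite /sym_siegel/= sym_partK//.
  by rewrite psE block_tau_sym// linearD/= linearZ/= s2.1 BB.
have sps' : siegel (gen_block (t1 + s ^+ 2 *: A) 0 (t2 + s ^+ 2 *: B)).
  by move: sps; rewrite psE.
have sps1 : siegel (t1 + s ^+ 2 *: A) by exact: siegel_gen_blockl sps'.
have sps2 : siegel (t2 + s ^+ 2 *: B) by exact: siegel_gen_blockr sps'.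
have van j : (j < r)%N -> diter v j Phi ps = 0.
  by move=> jr; rewrite psE; exact: leading_vanish.
have T := @taylor_leading R (MC (1 + n)) Phi ps v (q / 2) M r q2
  (fun y yp => hd y (inb y yp)) (fun y yp => hM y (inb y yp)) van s (ltW sw).
rewrite -/w -/K in T.
have H1 := h1 (s ^+ 2 *: P) (le_lt_trans s2P sd).
have -> : Phi (ps + s *: v) - s ^+ r * leading f r zeta p0 =
  (Phi (ps + s *: v) - s ^+ r * leading f r zeta ps) +
  s ^+ r * (leading f r zeta ps - leading f r zeta p0) by ring.
apply: le_trans (normcD _ _) _; rewrite normcM normcX.
have sr0 : 0 <= normc s ^+ r by rewrite exprn_ge0.
have A1 : K * normc s ^+ r.+1 <= e / 2 * normc s ^+ r.
  rewrite exprS mulrA; apply: ler_wpM2r => //; apply: le_trans (ltW sK).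
  by rewrite mulrC; apply: ler_wpM2l => //; rewrite lerDl.
have A2 : normc s ^+ r * normc (leading f r zeta ps - leading f r zeta p0) <=
   normc s ^+ r * (e / 2) by apply: ler_wpM2l.
have A3 : normc (Phi (ps + s *: v) - s ^+ r * leading f r zeta ps) <= K * normc s ^+ r.+1.
  exact: T.
have -> : e * normc s ^+ r = e / 2 * normc s ^+ r + normc s ^+ r * (e / 2) by field.
by apply: lerD; [exact: le_trans A3 A1|exact: A2].
Qed.

Lemma leading_unique (G : C -> C) (a b : C) :
  (forall e : R, 0 < e -> exists2 d : R, 0 < d & forall s : C, normc s < d -> s != 0 ->
    normc (G s - s ^+ r * a) <= e * normc s ^+ r) ->
  (forall e : R, 0 < e -> exists2 d : R, 0 < d & forall s : C, normc s < d -> s != 0 ->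
    normc (G s - s ^+ r * b) <= e * normc s ^+ r) -> a = b.
Proof.
move=> Ga Gb; apply: eq_of_normc_le => e e0.
have e2 : 0 < e / 2 by rewrite divr_gt0.
have [d1 d10 h1] := Ga _ e2; have [d2 d20 h2] := Gb _ e2.
pose x := Num.min d1 d2 / 2.
have m0 : 0 < Num.min d1 d2 by rewrite lt_min d10.
have x0 : 0 < x by rewrite divr_gt0.
have [xd1 xd2] : x < d1 /\ x < d2.
  have : Num.min d1 d2 <= d1 by rewrite ge_min lexx.
  have : Num.min d1 d2 <= d2 by rewrite ge_min lexx orbT.
  by rewrite /x; split; lra.
have nx : normc x%:C = x by rewrite normc_real gtr0_norm.
have xC : x%:C != 0 :> C by rewrite -normc_gt0 nx.
have := h1 x%:C; rewrite nx => /(_ xd1 xC) H1.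
have := h2 x%:C; rewrite nx => /(_ xd2 xC) H2.
have xr : 0 < x ^+ r by rewrite exprn_gt0.
rewrite -(ler_pM2l xr) -{1}nx -normcX -normcM.
have -> : x%:C ^+ r * (a - b) = (G x%:C - x%:C ^+ r * b) - (G x%:C - x%:C ^+ r * a) by ring.
apply: le_trans (normcD _ _) _; rewrite normcN.
by move: (normc _) (normc _) H1 H2 => u1 u2; lra.
Qed.

End LeadingTerm.

(** * Transformation laws of the leading term *)

Section LeadingLaw.
Context {R : realType}.
Local Notation C := R[i].
Local Notation MC g := ('M[C]_g : normedModType C).
Variables (n r : nat) (k : int) (f : 'M[C]_(1 + n) -> C^o).
Hypothesis hol : holomorphic_siegel f.
Hypothesis ftr : forall M tau, symplectic M -> siegel tau ->
  f (siegel_act M tau) = det_rep k (autom_factor M tau) (f tau).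
Hypothesis hlow : forall i : nat, (i < r)%N -> forall tau1 tau2,
  siegel tau1 -> siegel tau2 -> taylor_part i f tau1 tau2 = 0.

Lemma sym_siegel_block (t1 : 'M[C]_1) z (t2 : 'M[C]_n) : t2^T = t2 ->
  sym_siegel (block_tau t1 z t2) -> siegel (block_tau t1 z t2).
Proof. by move=> E; rewrite /sym_siegel/= sym_partK// block_tau_sym. Qed.

(* The corrections A and B enter to second order in s, hence do not affect the leading term. *)
Lemma leading_scale (t1 s1 A : 'M[C]_1) (t2 s2 B : 'M[C]_n) (zeta u : 'rV[C]_n) (c : C) :
  siegel t1 -> siegel t2 -> siegel s1 -> siegel s2 -> B^T = B ->
  (forall s : C, siegel (block_tau t1 (s *: zeta) t2) ->
    f (block_tau (s1 + s ^+ 2 *: A) (s *: u) (s2 + s ^+ 2 *: B)) =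
    c * f (block_tau t1 (s *: zeta) t2)) ->
  leading f r u (block_tau s1 0 s2) = c * leading f r zeta (block_tau t1 0 t2).
Proof.
move=> ht1 ht2 hs1 hs2 BB law.
pose G s := symmetrized f (block_tau (s1 + s ^+ 2 *: A) (s *: u) (s2 + s ^+ 2 *: B)).
apply: (@leading_unique R r G) => e e0.
  have [d d0 h] := leading_limit hol hlow u A hs1 hs2 BB e0.
  by exists d => // s sd _; exact: (h s sd).2.
have c1 : 0 < normc c + 1 by rewrite ltr_wpDl// normc_ge0.
have e1 : 0 < e / (normc c + 1) by rewrite divr_gt0.
have [d d0 h] := leading_limit hol hlow zeta 0 ht1 ht2 (trmx0 C n n) e1.
exists d => // s sd _; have [ss hs] := h s sd; move: ss hs.
rewrite !scaler0 !addr0 => ss hs.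
have E2 : (s2 + s ^+ 2 *: B)^T = s2 + s ^+ 2 *: B by rewrite linearD/= linearZ/= hs2.1 BB.
have -> : G s - s ^+ r * (c * leading f r zeta (block_tau t1 0 t2)) =
  c * (symmetrized f (block_tau t1 (s *: zeta) t2) -
    s ^+ r * leading f r zeta (block_tau t1 0 t2)).
  rewrite /G (symmetrized_block _ _ _ E2) (symmetrized_block _ _ _ ht2.1).
  rewrite law; last exact: (sym_siegel_block ht2.1 ss).
  by rewrite mulrBr; congr (_ - _); rewrite mulrCA.
have cc := normc_ge0 c.
rewrite normcM; apply: le_trans (_ : normc c * (e / (normc c + 1) * normc s ^+ r) <= _).
  by apply: ler_wpM2l.
rewrite mulrA; apply: ler_wpM2r; first by rewrite exprn_ge0// normc_ge0.
by rewrite mulrCA ger_pMr// ler_pdivrMr// mul1r lerDl.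
Qed.

Lemma leading_left M1 t1 t2 zeta : symplectic M1 -> siegel t1 -> siegel t2 ->
  leading f r ((invmx (autom_factor M1 t1))^T *m zeta) (block_tau (siegel_act M1 t1) 0 t2) =
  (\det (autom_factor M1 t1)) ^ k * leading f r zeta (block_tau t1 0 t2).
Proof.
move=> sM h1 h2; set u := _ *m zeta.
(* A 1 x 1 matrix is symmetric; this makes the correction to [t2] symmetric, as [leading_scale]
   asks. *)
have E0 : (invmx (autom_factor M1 t1) *m intC (dlsubmx M1))^T =
   invmx (autom_factor M1 t1) *m intC (dlsubmx M1).
  by apply/matrixP => i j; rewrite !ord1 mxE.
apply: (@leading_scale t1 (siegel_act M1 t1) 0 t2 t2
  (- (u^T *m intC (dlsubmx M1) *m zeta))) => //.
- exact: siegel_act_siegel.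
- rewrite linearN/=; congr (- _).
  have -> : u^T *m intC (dlsubmx M1) =
      zeta^T *m (invmx (autom_factor M1 t1) *m intC (dlsubmx M1)).
    by rewrite /u trmx_mul trmxK mulmxA.
  by rewrite !trmx_mul -trmx_mul E0 trmxK !mulmxA.
move=> s ss; have := form_left ftr sM h1 ss; rewrite -scalemxAr -/u => <-.
congr f; rewrite scaler0 addr0 /gen_block /block_tau; congr (block_mx _ _ _ _).
by rewrite [(s *: _)^T]linearZ/= -!scalemxAl -!scalemxAr scalerA -expr2 scalerN.
Qed.

Lemma leading_right M2 t1 t2 zeta : symplectic M2 -> siegel t1 -> siegel t2 ->
  leading f r (zeta *m invmx (autom_factor M2 t2)) (block_tau t1 0 (siegel_act M2 t2)) =
  (\det (autom_factor M2 t2)) ^ k * leading f r zeta (block_tau t1 0 t2).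
Proof.
move=> sM h1 h2; set u := zeta *m _.
apply: (@leading_scale t1 t1 (- (u *m intC (dlsubmx M2) *m zeta^T)) t2 (siegel_act M2 t2) 0) => //.
- exact: siegel_act_siegel.
- exact: trmx0.
move=> s ss; have := form_right ftr sM h2 ss; rewrite -scalemxAl -/u => <-.
congr f; rewrite scaler0 addr0 /gen_block /block_tau; congr (block_mx _ _ _ _).
by rewrite [(s *: _)^T]linearZ/= -!scalemxAl -!scalemxAr scalerA -expr2 scalerN.
Qed.

Lemma meval_taylor_scale (t1 : 'M[C]_1) (t2 : 'M[C]_n) (a : C) v :
  meval (fun b => a * v b) (taylor_poly r f t1 t2) = a ^+ r * meval v (taylor_poly r f t1 t2).
Proof.
rewrite /taylor_poly !raddf_sum/= mulr_sumr; apply: eq_bigr => m /eqP mr.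
rewrite !mevalZ !mevalX mulrCA; congr (_ * _).
have -> : a ^+ r = \prod_(b < n) a ^+ (m : multinom n) b by rewrite prodrXr -mdegE mr.
rewrite -big_split/=; apply: eq_bigr => b _.
by rewrite exprMn.
Qed.

Lemma meval_leading (t1 : 'M[C]_1) (t2 : 'M[C]_n) (zeta : 'rV[C]_n) : siegel t1 -> siegel t2 ->
  leading f r zeta (block_tau t1 0 t2) = meval (zeta 0) (taylor_poly r f t1 t2).
Proof.
move=> h1 h2; have sb : sym_siegel (block_tau t1 0 t2).
  exact/siegel_sym_siegel/siegel_gen_block0.
have := @meval_taylor_poly R n f hol r t1 t2 (zeta 0) h2.1 sb.
have -> : \row_b zeta 0 b = zeta by apply/matrixP => i b; rewrite ord1 mxE.
by move=> ->.
Qed.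

(** In degree one J is a scalar: replacing J^-1 zeta by zeta costs the factor (det J)^r by
    homogeneity, which raises the weight from k to k + r. *)
Lemma taylor_poly_left M1 t1 t2 : symplectic M1 -> siegel t1 -> siegel t2 ->
  taylor_poly r f (siegel_act M1 t1) t2 =
  (\det (autom_factor M1 t1)) ^ (k + r%:Z) *: taylor_poly r f t1 t2.
Proof.
move=> sM h1 h2; apply: meval_inj => v; rewrite mevalZ.
have JU := autom_factor_unit sM h1; set J := autom_factor M1 t1 in JU *.
have dJ : \det J != 0 by rewrite -unitfE -unitmxE.
pose zeta : 'rV[C]_n := J^T *m \row_b v b.
have E : \row_b v b = (invmx J)^T *m zeta.
  by rewrite /zeta mulmxA -trmx_mul mulmxV// trmx1 mul1mx.
have := leading_left zeta sM h1 h2; rewrite -/J -E.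
rewrite (meval_leading _ (siegel_act_siegel sM h1) h2) (meval_leading _ h1 h2).
have -> : zeta 0 = (fun b => \det J * v b).
  apply/funext => b; rewrite /zeta mxE big_ord1 det_mx11.
  by congr (_ * _); rewrite mxE.
rewrite meval_taylor_scale (expfzDr _ _ dJ) -exprnP -mulrA => <-.
by apply: meval_eq => b; rewrite mxE.
Qed.

(** Substituting the columns of J for the variables and evaluating at v is evaluating at the row v
    J, which is what [leading_right] provides. *)
Lemma taylor_poly_right M2 t1 t2 : symplectic M2 -> siegel t1 -> siegel t2 ->
  taylor_poly r f t1 (siegel_act M2 t2) =
  (\det (autom_factor M2 t2)) ^ k *:
    comp_mpoly (std_image (autom_factor M2 t2)) (taylor_poly r f t1 t2).
Proof.
move=> sM h1 h2; apply: meval_inj => v; rewrite mevalZ comp_mpoly_meval.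
have JU := autom_factor_unit sM h2; set J := autom_factor M2 t2 in JU *.
pose zeta : 'rV[C]_n := (\row_b v b) *m J.
have E : \row_b v b = zeta *m invmx J by rewrite /zeta mulmxK.
have := leading_right zeta sM h1 h2; rewrite -/J -E.
rewrite (meval_leading _ h1 (siegel_act_siegel sM h2)) (meval_leading _ h1 h2).
move=> H; rewrite (meval_eq (v2 := fun b => (\row_b v b : 'rV[C]_n) 0 b)); last by move=> b; rewrite mxE.
rewrite H; congr (_ * _); apply: meval_eq => b.
rewrite tnth_mktuple raddf_sum/= /zeta mxE; apply: eq_bigr => a _.
by rewrite mevalZ mevalXU mxE mulrC.
Qed.

End LeadingLaw.

Section TaylorHolomorphic.
Context {R : realType}.
Local Notation C := R[i].
Local Notation MC g := ('M[C]_g : normedModType C).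

Lemma holomorphic_siegel_comb (g : nat) (V : vectType C) (I : Type) (s : seq I)
    (P : pred I) (c : I -> 'M[C]_g -> C) (v : I -> V) (F : 'M[C]_g -> V) :
  (forall i tau, siegel tau -> holo (fun w : MC g => c i (sym_part w)) tau) ->
  (forall tau, tau^T = tau -> F tau = \sum_(i <- s | P i) c i tau *: v i) ->
  holomorphic_siegel F.
Proof.
move=> hc hF tau st j; apply: (@holoW R (MC g)).
have -> : (fun w : MC g => coordinate j (F (sym_part w)) : C) =
    (fun w => \sum_(i <- s | P i) c i (sym_part w) * coordinate j (v i)).
  apply/funext => w; rewrite hF ?sym_part_sym// /coordinate linear_sum/=.
  by apply: eq_bigr => i _; rewrite linearZ.
by apply: holo_sum => i; apply: holoM; [exact: hc|exact: holo_cst].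
Qed.

Variables (n : nat) (f : 'M[C]_(1 + n) -> C^o).
Hypothesis hol : holomorphic_siegel f.

Let hm (m : multinom n) : holo_on (@sym_siegel R (1 + n) : set (MC (1 + n)))
  (mixed (fun b => zdir (delta_mx 0 b)) m (symmetrized f)).
Proof. apply: holo_mixed; [exact: open_sym_siegel|exact: holo_symmetrized]. Qed.

Lemma rnorm_block (a : 'M[C]_1) (z : 'rV[C]_n) (y : 'cV[C]_n) (b : 'M[C]_n) (c : R) : 0 <= c ->
  (forall i j, normc (a i j) <= c) -> (forall i j, normc (z i j) <= c) ->
  (forall i j, normc (y i j) <= c) -> (forall i j, normc (b i j) <= c) ->
  rnorm (block_mx a z y b : MC (1 + n)) <= c.
Proof.
move=> c0 ha hz hy hb; apply: rnorm_mx_le => // i0 j0.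
by rewrite -(splitK i0) -(splitK j0); case: (fintype.split i0) => i1; case: (fintype.split j0) => j1 /=;
  rewrite ?block_mxEul ?block_mxEur ?block_mxEdl ?block_mxEdr.
Qed.

Lemma holo_taylor_coeff1 (m : multinom n) t1 t2 : siegel t1 -> siegel t2 ->
  holo (fun w : MC 1 => taylor_coeff f m (sym_part w) t2) t1.
Proof.
move=> h1 h2; pose A (w : MC 1) : MC (1 + n) := block_tau (sym_part w) 0 t2.
pose L (w : MC 1) : MC (1 + n) := block_mx (sym_part w) 0 0 0.
have -> : (fun w : MC 1 => taylor_coeff f m (sym_part w) t2) = (fun w =>
    (\prod_(b < n) (m b)`!%:R)^-1 *
    mixed (fun b => zdir (delta_mx 0 b)) m (symmetrized f) (A w)).
  by apply/funext => w; rewrite taylor_coeff_mixed//; exact: h2.1.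
apply: holoM; first exact: holo_cst.
apply: (@holo_affine R (MC 1) (MC (1 + n)) A L 1).
- move=> a u v; rewrite /L (linear_sym_part a u v) scale_block_mx add_block_mx.
  by rewrite !scaler0 !addr0.
- move=> h; rewrite mul1r; apply: rnorm_block; first exact: rnorm_ge0.
  + move=> i j; apply: le_trans (rnorm_mx_entry _ _ _) _.
    by have := rnorm_sym_part h; rewrite mul1r.
  + by move=> i j; rewrite mxE normc_0 rnorm_ge0.
  + by move=> i j; rewrite mxE normc_0 rnorm_ge0.
  + by move=> i j; rewrite mxE normc_0 rnorm_ge0.
- move=> h; rewrite /A /L /block_tau trmx0 add_block_mx !addr0.
  by congr (block_mx _ _ _ _); rewrite -[t1]scale1r linear_sym_part !scale1r.
apply: hm; rewrite /A sym_partK; last exact: h1.1.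
exact/siegel_sym_siegel/siegel_gen_block0.
Qed.

Lemma holo_taylor_coeff2 (m : multinom n) t1 t2 : siegel t1 -> siegel t2 ->
  holo (fun w : MC n => taylor_coeff f m t1 (sym_part w)) t2.
Proof.
move=> h1 h2; pose A (w : MC n) : MC (1 + n) := block_tau t1 0 (sym_part w).
pose L (w : MC n) : MC (1 + n) := block_mx 0 0 0 (sym_part w).
have -> : (fun w : MC n => taylor_coeff f m t1 (sym_part w)) = (fun w =>
    (\prod_(b < n) (m b)`!%:R)^-1 *
    mixed (fun b => zdir (delta_mx 0 b)) m (symmetrized f) (A w)).
  by apply/funext => w; rewrite taylor_coeff_mixed//; exact: sym_part_sym.
apply: holoM; first exact: holo_cst.
apply: (@holo_affine R (MC n) (MC (1 + n)) A L 1).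
- move=> a u v; rewrite /L (linear_sym_part a u v) scale_block_mx add_block_mx.
  by rewrite !scaler0 !addr0.
- move=> h; rewrite mul1r; apply: rnorm_block; first exact: rnorm_ge0.
  + by move=> i j; rewrite mxE normc_0 rnorm_ge0.
  + by move=> i j; rewrite mxE normc_0 rnorm_ge0.
  + by move=> i j; rewrite mxE normc_0 rnorm_ge0.
  + move=> i j; apply: le_trans (rnorm_mx_entry _ _ _) _.
    by have := rnorm_sym_part h; rewrite mul1r.
- move=> h; rewrite /A /L /block_tau trmx0 add_block_mx !addr0.
  by congr (block_mx _ _ _ _); rewrite -[t2]scale1r linear_sym_part !scale1r.
apply: hm; rewrite /A sym_partK; last exact: h2.1.
exact/siegel_sym_siegel/siegel_gen_block0.
Qed.

(** Fixed vectors with scalar functions as coefficients, the shape required by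
    [holomorphic_siegel_comb]. The monomials in the sum have degree r, so the default 0 of [insubd]
    is not taken. *)
Lemma taylor_part_comb (r : nat) t1 t2 : taylor_part r f t1 t2 =
  \sum_(m : bmultinom n r.+1 | mdeg m == r)
    taylor_coeff f m t1 t2 *: (insubd (0 : dhomog n C r) (mpolyX C m)).
Proof.
apply: val_inj; rewrite /= /taylor_poly raddf_sum/=; apply: eq_bigr => m mr.
have mh : mpolyX C (m : multinom n) \is ishomog1 r mdeg by rewrite dhomogX.
transitivity (taylor_coeff f m t1 t2 *: val (insubd (0 : dhomog n C r) (mpolyX C m))); last by [].
by congr (_ *: _); rewrite insubdK.
Qed.

End TaylorHolomorphic.

Lemma holomorphic_taylor_part (R : realType) (n r : nat) (f : 'M[R[i]]_(1 + n.+1) -> R[i]^o) t1 :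
  holomorphic_siegel f -> siegel t1 -> holomorphic_siegel (taylor_part r f t1).
Proof.
move=> hol h1; pose c (m : bmultinom n.+1 r.+1) t2 := taylor_coeff f m t1 t2.
apply: (holomorphic_siegel_comb (c := c)); last by move=> tau _; exact: taylor_part_comb.
by move=> m tau st; exact: holo_taylor_coeff2.
Qed.

(** * Expansion at the cusp *)

Section Infinity.
Context {R : realType}.
Local Notation C := R[i].

Lemma contin_bounded (g : R -> C) a b : contin a b g ->
  exists M, forall x, a <= x <= b -> normc (g x) <= M.
Proof.
move=> [gc]; have [ab|ba] := leP a b; last first.
  by exists 0 => x /andP[ax xb]; have := le_trans ax xb; rewrite leNgt ba.
have nc : {within `[a, b], continuous (fun x => normc (g x))}.
  apply: continuous_in_subspaceT => x; rewrite inE/= in_itv/= => xab.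
  by apply: (continuous_comp (gc x xab)); exact: continuous_normc.
have [c _ hc] := EVT_max ab nc.
by exists (normc (g c)) => x xab; apply: hc; rewrite in_itv.
Qed.

Lemma Im_addZ (w : C) (n : int) : complex.Im (w + n%:~R) = complex.Im w.
Proof.
rewrite raddfD/= (_ : complex.Im n%:~R = 0) ?addr0//.
by rewrite -[n%:~R](rmorph_int (real_complex R)).
Qed.

Lemma periodic_int (P : R -> Prop) (f : C -> C) :
  (forall w, P (complex.Im w) -> f (w + 1) = f w) ->
  forall w (n : int), P (complex.Im w) -> f (w + n%:~R) = f w.
Proof.
move=> fper.
have H (m : nat) v : P (complex.Im v) -> f (v + m%:~R) = f v.
  elim: m v => [|m IH] v Pv; first by rewrite addr0.
  have -> : m.+1%:~R = m%:~R + 1 :> C by rewrite -addn1 PoszD intrD.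
  by rewrite addrA fper ?Im_addZ// IH.
move=> w [m|m] Pw; first exact: H.
by rewrite -(H m.+1 (w + _)) ?Im_addZ// NegzE mulrNz subrK.
Qed.

Lemma horizontal_bounded (f : C -> C) (s : R) :
  (forall w, complex.Im w = s -> f (w + 1) = f w) ->
  (forall w, complex.Im w = s -> ccontinuous f w) ->
  exists M, forall w, complex.Im w = s -> normc (f w) <= M.
Proof.
move=> fper fc.
have [M hM] : exists M, forall x, 0 <= x <= 1 -> normc (f (x +i* s)) <= M.
  by apply: contin_bounded; apply: contin_horizontal => x _; exact: fc.
exists M => w ws.
pose n := Num.floor (complex.Re w).
have -> : f w = f (w + (- n)%:~R).
  by rewrite (@periodic_int (fun y => y = s) f fper).
have -> : w + (- n)%:~R = (complex.Re w - n%:~R) +i* s.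
  rewrite mulrNz -[n%:~R](rmorph_int (real_complex R)) -ws.
  by case: (w) => a b; apply/eqP; rewrite eq_complex/= oppr0 addr0 !eqxx.
apply: hM; rewrite subr_ge0 ge_floor//= lerBlDl.
by have /ltW := floorD1_gt (complex.Re w); rewrite intrD.
Qed.

Section NomeExpansion.
Variable f : C -> C.
Hypothesis fd : forall w, 0 < complex.Im w -> cdiff f w.
Hypothesis fper : forall w, 0 < complex.Im w -> f (w + 1) = f w.
Hypothesis fbd : exists B T, forall w, T <= complex.Im w -> normc (f w) <= B.

(** The integrand of Cauchy's formula on the line Im w = s with nome z replaced by a free variable
    q. Its integral is defined and holomorphic for |q| < exp (- 2 pi s), the point q = 0
    included. *)
Let qker (s : R) (q : C) (x : R) : C :=
  f (x +i* s) * (nome (x +i* s) / (nome (x +i* s) - q)).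

Let nome_line (s x : R) : normc (nome (x +i* s) : C) = expR (- (2 * pi * s)).
Proof. by rewrite normc_nome. Qed.

Let nome_far (s x : R) q : normc q < expR (- (2 * pi * s)) -> nome (x +i* s) - q != 0.
Proof.
move=> qs; rewrite subr_eq0; apply/eqP => E.
by move: qs; rewrite -E nome_line ltxx.
Qed.

Let qker_diff s q x : normc q < expR (- (2 * pi * s)) -> cdiff (qker s ^~ x) q.
Proof.
move=> qs; apply: cdiffM; first exact: cdiff_cst.
apply: cdiffM; first exact: cdiff_cst.
apply: cdiffV; first exact: nome_far.
by apply: cdiffB; [exact: cdiff_cst|exact: cdiff_id].
Qed.

Let qker_contin s q : 0 < s -> normc q < expR (- (2 * pi * s)) -> contin 0 1 (qker s q).
Proof.
move=> s0 qs; apply: (@contin_horizontal R (fun w => f w * (nome w / (nome w - q)))) => x _.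
apply/cdiff_continuous/cdiffM; first exact: fd.
apply: cdiffM; first exact: cdiff_nome.
apply: cdiffV; first exact: nome_far.
by apply: cdiffB; [exact: cdiff_nome|exact: cdiff_cst].
Qed.

Let qint s q := cint 0 1 (qker s q).

Let qint_diff s q : 0 < s -> normc q < expR (- (2 * pi * s)) -> cdiff (qint s) q.
Proof.
move=> s0 qs; pose E := expR (- (2 * pi * s)).
have [r r0 rE] : exists2 r : R, 0 < r & E - (normc q + r) = r.
  by exists ((E - normc q) / 2); [rewrite divr_gt0// subr_gt0|field].
have E0 : 0 < E by exact: expR_gt0.
have near y : normc (y - q) < r -> normc y < normc q + r.
  by move=> yq; have := normcD (y - q) q; rewrite subrK; lra.
have [M hM] : exists M, forall w, complex.Im w = s -> normc (f w) <= M.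
  apply: horizontal_bounded => w ws; first by apply: fper; rewrite ws.
  by apply/cdiff_continuous/fd; rewrite ws.
suff [[H] _] : holo (V := C^o) (fun y => cint 0 1 (qker s y)) q /\ forall v : C^o,
    'D_v (fun y : C^o => cint 0 1 (qker s y) : C^o) q =
    cint 0 1 (fun t => 'D_v ((qker s)^~ t : C^o -> C^o) q) by split.
apply: (@derive_under_cint R C^o (qker s) q r (M * (E / r)) r0).
- move=> y t; rewrite rnormc => /near yr.
  by split; apply: cdiffW; apply: qker_diff; rewrite -/E; lra.
- move=> y t; rewrite rnormc => /near yr; rewrite !normcM normcV nome_line -/E.
  have M0 : normc (f (t +i* s)) <= M by exact: hM.
  have D : r <= normc (nome (t +i* s) - y).
    by have := lerB_normc (nome (t +i* s)) y; rewrite nome_line -/E; lra.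
  have D0 : 0 < normc (nome (t +i* s) - y) by exact: lt_le_trans D.
  apply: ler_pM; [exact: normc_ge0| |exact: M0|].
    by apply: divr_ge0; exact: ltW.
  by apply: ler_wpM2l; [exact: ltW|rewrite lef_pV2].
- by move=> y; rewrite rnormc => /near yr; apply: qker_contin => //; rewrite -/E; lra.
Qed.

Let qint_nome s z : 0 < s -> s < complex.Im z -> qint s (nome z) = f z.
Proof.
move=> s0 sz; have [B [T hB]] := fbd.
rewrite (@halfplane_cauchy R f s B z sz); first by apply: eq_cint => x _; rewrite cauchy_kernelE.
- by move=> w ws; apply: fper; exact: lt_le_trans ws.
- by move=> w ws; apply: fd; exact: lt_le_trans ws.
- by exists T.
Qed.

Let nome_Im z (s : R) : (normc (nome z : C) < expR (- (2 * pi * s))) = (s < complex.Im z).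
Proof. by rewrite normc_nome ltr_expR ltrN2 ltr_pM2l// mulr_gt0 ?pi_gt0. Qed.

(** For q = nome z both integrals are f z; at q = 0 they are horizontal integrals of the periodic
    function [f]. *)
Let qint_indep s s' q : 0 < s -> 0 < s' -> normc q < expR (- (2 * pi * s)) ->
  normc q < expR (- (2 * pi * s')) -> qint s q = qint s' q.
Proof.
move=> s0 s0' qs qs'; have [q0|/nome_surj[z zq]] := eqVneq q 0; last first.
  by rewrite -zq !qint_nome// -nome_Im zq.
wlog ss' : s s' s0 s0' qs qs' / s <= s'.
  by move=> H; have [h|/ltW h] := leP s s'; [|symmetry]; apply: H.
have E t : qint t q = cint 0 1 (fun x => f (x +i* t)).
  apply: eq_cint => x _; rewrite /qker q0 subr0 divff ?mulr1//; exact: nome_neq0.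
rewrite !E; apply: periodic_cint_const => //.
  move=> y /andP[sy _]; have -> : 1 +i* y = (0 +i* y) + 1 :> C.
    by apply/eqP; rewrite eq_complex/= add0r addr0 !eqxx.
  by apply: fper => /=; exact: lt_le_trans sy.
by move=> x y _ /andP[sy _]; apply: fd => /=; exact: lt_le_trans sy.
Qed.

(** No single line serves the whole unit disc. This height corresponds to the circle of radius (1 +
    |q|) / 2; by [qint_indep] it may be kept fixed near a given q, which yields
    differentiability. *)
Let level (q : C) : R := - ln ((1 + normc q) / 2) / (2 * pi).

Let level_expR q : normc q < 1 -> 0 < level q /\ expR (- (2 * pi * level q)) = (1 + normc q) / 2.
Proof.
move=> q1; have q0 := normc_ge0 q; have p0 : 0 < 2 * pi :> R by rewrite mulr_gt0// pi_gt0.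
have r0 : 0 < (1 + normc q) / 2 by lra.
split.
  by rewrite /level divr_gt0// oppr_gt0 ln_lt0//; apply/andP; split=> //; lra.
rewrite /level mulrC divfK ?gt_eqF// opprK lnK//.
Qed.

Lemma nome_expansion : exists F : C -> C,
  (forall q, normc q < 1 -> cdiff F q) /\
  (forall z, 0 < complex.Im z -> f z = F (nome z)).
Proof.
exists (fun q => qint (level q) q); split.
  move=> q q1; have [l0 lE] := level_expR q1.
  have ql : normc q < expR (- (2 * pi * level q)) by rewrite lE; lra.
  apply: (cdiff_near _ (qint_diff l0 ql)).
  exists ((1 - normc q) / 2); first by lra.
  move=> v vd; have qv : normc (q + v) < (1 + normc q) / 2.
    by have := normcD q v; lra.
  have qv1 : normc (q + v) < 1 by lra.
  have [l0' lE'] := level_expR qv1.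
  by apply: qint_indep => //; [rewrite lE|rewrite lE'; lra].
move=> z z0; have n1 : normc (nome z : C) < 1.
  have := nome_Im z 0; rewrite mulr0 oppr0 expR0 => ->; exact: z0.
have [l0 lE] := level_expR n1.
by rewrite qint_nome// -nome_Im lE; lra.
Qed.

End NomeExpansion.

Lemma coordinate_scalar j (v : (C^o)%type) : coordinate j v = v * coordinate j (1 : C^o).
Proof.
by rewrite /coordinate -[v in LHS]mulr1 -[v * 1]/(v *: (1 : C^o)) linearZ.
Qed.

Lemma holomorphic_at_infinity_bounded (f : 'M[C]_1 -> C^o) :
  (forall z : C, 0 < complex.Im z -> cdiff (fun t => f t%:M) z) ->
  (forall z : C, 0 < complex.Im z -> f (z + 1)%:M = f z%:M) ->
  (exists B T, forall z : C, T <= complex.Im z -> normc (f z%:M) <= B) ->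
  holomorphic_at_infinity f.
Proof.
move=> fd fper fbd; have [F [Fd Fe]] := nome_expansion fd fper fbd.
exists F; split; last exact: Fe.
move=> q q1 j; have Fq : cdiff F q by apply: Fd; rewrite -ltcR.
have -> : (fun x : C^o => coordinate j (F x)) = (fun x : C^o => F x * coordinate j (1 : C^o)).
  by apply/funext => x; rewrite coordinate_scalar.
by apply: cdiffW; apply: cdiffM => //; exact: cdiff_cst.
Qed.

Lemma expansion_at_infinity (g : nat) (f : 'M[C]_g -> C^o) : holomorphic_at_infinity f ->
  exists F : C -> C, (forall q, normc q < 1 -> cdiff F q) /\
    (forall z : C, 0 < complex.Im z -> f z%:M = F (nome z)).
Proof.
move=> [F [Fd Fe]]; exists F; split=> // q q1.
have [j|] := @holo_scalar_coordinate R C^o F q; last by split.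
by split; apply: Fd; rewrite -ltcR in q1.
Qed.

End Infinity.

(** * Finite dimension in degree one *)

Section Vanishing.
Context {R : realType}.
Local Notation C := R[i].

Lemma circle_bounded (F : C -> C) (r : R) : 0 < r -> (forall w, normc w <= r -> cdiff F w) ->
  exists M, forall x, normc (F (circle r x)) <= M.
Proof.
move=> r0 Fd.
have [M hM] : exists M, forall w, complex.Im w = 0 -> normc (F (r%:C * nome w)) <= M.
  apply: horizontal_bounded => w w0; first by rewrite nomeD1.
  apply/cdiff_continuous/(@cdiff_comp _ (fun w => r%:C * nome w) F).
    by apply: cdiffM; [exact: cdiff_cst|exact: cdiff_nome].
  apply: Fd; rewrite normcM normc_nome w0 mulr0 oppr0 expR0 mulr1 normc_real.
  by rewrite gtr0_norm.
by exists M => x; exact: hM.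
Qed.

(** Both are the j-th derivative at 0 divided by j!. *)
Lemma cauchy_coef_radius (F : C -> C) (r r' : R) j : 0 < r -> 0 < r' ->
  (forall w, normc w <= r -> cdiff F w) -> (forall w, normc w <= r' -> cdiff F w) ->
  cauchy_coef F r j = cauchy_coef F r' j.
Proof.
have H s : 0 < s -> (forall w, normc w <= s -> cdiff F w) ->
    diter1 j F 0 = j`!%:R * cauchy_coef F s j.
  move=> s0 Fd; have [M hM] := circle_bounded s0 Fd.
  rewrite (iter_derive1 s0 Fd hM) ?normc_0//; congr (_ * _).
  apply: eq_cint => x _; rewrite subr0 exprS.
  have c0 := circle_neq0 x s0.
  by field; rewrite c0 expf_neq0.
move=> r0 r0' Fd Fd'; have E := H r r0 Fd; rewrite (H r' r0' Fd') in E.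
have fn : j`!%:R != 0 :> C by rewrite pnatr_eq0 -lt0n fact_gt0.
exact: (esym (mulfI fn E)).
Qed.

Lemma vanishing_bound (F : C -> C) (r r0 M : R) d q : 0 < r -> 0 < r0 ->
  (forall w, normc w <= r -> cdiff F w) -> (forall w, normc w <= r0 -> cdiff F w) ->
  (forall j, (j < d)%N -> cauchy_coef F r0 j = 0) ->
  (forall x, normc (F (circle r x)) <= M) -> normc q <= r / 2 ->
  normc (F q) <= normc q ^+ d * (2 * M / r ^+ d).
Proof.
move=> rp r0p Fd Fd0 van hM qr.
have qr' : normc q < r by lra.
rewrite (disc_taylor rp Fd d qr') big1 ?add0r; last first.
  move=> j _; rewrite (cauchy_coef_radius j rp r0p Fd Fd0) van ?mul0r//.
rewrite normcM normcX; apply: ler_wpM2l; first by rewrite exprn_ge0// normc_ge0.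
exact: taylor_rem_bound.
Qed.

Lemma normc_exprz (z : C) (k : int) : normc (z ^ k) = normc z ^ k.
Proof. by case: k => k; rewrite -?exprnP ?normcX// NegzE -!exprnN normcV normcX. Qed.

Lemma Im_inv (z : C) : complex.Im (- z^-1) = complex.Im z / normc z ^+ 2.
Proof. by rewrite normc_sqr; case: z => a b /=; rewrite opprK. Qed.

(* The fundamental domain of the modular group lies above the height 1/2. *)
Lemma modular_reduction (P : C -> Prop) :
  (forall z (n : int), 0 < complex.Im z -> P (z + n%:~R) -> P z) ->
  (forall z, 0 < complex.Im z -> P (- z^-1) -> P z) ->
  (forall z, 2^-1 <= complex.Im z -> P z) ->
  forall z, 0 < complex.Im z -> P z.
Proof.
move=> trP invP topP.
have H (N : nat) : forall z, 0 < complex.Im z -> 2^-1 <= 2 ^+ N * complex.Im z -> P z.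
  elim: N => [|N IH] z z0 zN; first by apply: topP; rewrite expr0 mul1r in zN.
  have [?|zh] := leP 2^-1 (complex.Im z); first exact: topP.
  pose n := Num.floor (complex.Re z + 2^-1).
  apply: (trP z (- n) z0); set w := z + _.
  have wI : complex.Im w = complex.Im z by exact: Im_addZ.
  have wR : complex.Re w = complex.Re z - n%:~R.
    by rewrite raddfD/= mulrNz -[n%:~R](rmorph_int (real_complex R)).
  have R2 : `|complex.Re w| <= 2^-1.
    have h1 : n%:~R <= complex.Re z + 2^-1 by exact: ge_floor.
    have h2 : complex.Re z + 2^-1 < n%:~R + 1 by have := floorD1_gt (complex.Re z + 2^-1); rewrite intrD.
    by rewrite ler_norml wR; apply/andP; split; lra.
  have nw : normc w ^+ 2 <= 2^-1.
    rewrite normc_sqr wI -real_normK ?num_real//.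
    have : `|complex.Re w| ^+ 2 <= 2^-1 ^+ 2 by rewrite lerXn2r// nnegrE// invr_ge0.
    have : complex.Im z ^+ 2 <= 2^-1 ^+ 2.
      by rewrite lerXn2r// ?nnegrE ?invr_ge0//; exact: ltW.
    by move: (`|_| ^+ 2) (_ ^+ 2) => a b; lra.
  have wn : 0 < normc w ^+ 2.
    rewrite exprn_gt0// normc_gt0; apply/eqP => w0.
    by move: z0; rewrite -wI w0 ltxx.
  apply: invP; first by rewrite wI.
  (* |w|^2 is at most 1/4 + 1/4, so inversion at least doubles the imaginary part and the induction
     on [N] reaches the height 1/2. *)
  have I2 : 2 * complex.Im z <= complex.Im (- w^-1).
    rewrite Im_inv wI ler_pdivlMr// mulrAC mulrC.
    rewrite -[X in _ <= X]mulr1; apply: ler_wpM2l; first exact: ltW.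
    by move: (normc w ^+ 2) nw => a; lra.
  apply: IH; first by apply: lt_le_trans I2; rewrite mulr_gt0.
  apply: le_trans zN _; rewrite exprSr -mulrA; apply: ler_wpM2l I2.
  by rewrite exprn_ge0.
move=> z z0.
have [N hN] := exists_small_halving (2^-1 : R) z0.
apply: (H N) => //; rewrite -ler_pdivrMl ?exprn_gt0// mulrC; exact: ltW.
Qed.

Section Modular.
Variables (kappa : int) (phi F : C -> C) (d : nat).
Hypothesis dk : (`|kappa|%N + 2 <= d)%N.
Hypothesis Fd : forall q, normc q < 1 -> cdiff F q.
Hypothesis phiF : forall z, 0 < complex.Im z -> phi z = F (nome z).
Hypothesis phi_inv : forall z, 0 < complex.Im z -> phi (- z^-1) = z ^ kappa * phi z.
Hypothesis van : forall j, (j < d)%N -> cauchy_coef F 2^-1 j = 0.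

(** Invariant under translations and inversion, so that a bound above the height 1/2 holds on the
    whole upper half plane. *)
Let g z := normc (phi z) ^+ 2 * complex.Im z ^ kappa.

Let g_tr z (n : int) : 0 < complex.Im z -> g (z + n%:~R) = g z.
Proof. by move=> z0; rewrite /g Im_addZ !phiF ?Im_addZ// nomeD nome_int mulr1. Qed.

Let g_inv z : 0 < complex.Im z -> g (- z^-1) = g z.
Proof.
move=> z0; have zn : z != 0 by apply/eqP => zE; move: z0; rewrite zE ltxx.
have nz : 0 < normc z by rewrite normc_gt0.
rewrite /g Im_inv phi_inv// normcM normc_exprz expfzMl.
have -> : ((normc z ^+ 2)^-1) ^ kappa = ((normc z ^ kappa) ^+ 2)^-1.
  by rewrite -expfV !expr2 expfzMl.
have a0 : normc z ^ kappa != 0 by rewrite expfz_neq0// gt_eqF.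
by field.
Qed.

Let nome_half (y x : R) : circle (expR (- (2 * pi * y))) x = nome (x +i* y) :> C.
Proof.
have -> : x +i* y = x%:C + (0 +i* y) by apply/eqP; rewrite eq_complex/= addr0 add0r !eqxx.
rewrite nomeD [RHS]mulrC /circle; congr (_ * _).
by with_strategy transparent [nome] rewrite /nome/= !(mulr0, mul0r) cos0 sin0 mulr1 mulr0.
Qed.

Let radius_lt1 (y : R) : 0 < y -> expR (- (2 * pi * y)) < 1.
Proof. by move=> y0; rewrite expR_lt1 oppr_lt0 !mulr_gt0// pi_gt0. Qed.

Let radius_half (y : R) : 4^-1 <= y -> expR (- (2 * pi * y)) <= 2^-1.
Proof.
move=> y4; apply: le_trans (_ : expR (- 1) <= _).
  rewrite ler_expR lerN2; have := pi_ge2 R.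
  move=> p2; apply: le_trans (_ : 2 * 2 * 4^-1 <= _); first by lra.
  by apply: ler_pM => //; rewrite ?mulr_ge0 ?invr_ge0// ler_pM2l.
rewrite expRN lef_pV2 ?posrE ?expR_gt0//.
by have := expR_ge1Dx (1 : R); lra.
Qed.

(** The line of height y is the circle of radius exp (- 2 pi y) in the variable q. From y >= 1/4
    this radius is at most 1/2, and from Im z >= 2 y the point nome z lies within half of it, where
    [vanishing_bound] applies. *)
Let vanish (y : R) z M : 4^-1 <= y -> 2 * y <= complex.Im z ->
  (forall w, complex.Im w = y -> normc (phi w) <= M) ->
  normc (phi z) <= normc (nome z : C) ^+ d * (2 * M / expR (- (2 * pi * y)) ^+ d).
Proof.
move=> y4 yz hM; have y0 : 0 < y by lra.
have z0 : 0 < complex.Im z by lra.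
rewrite phiF//; apply: (vanishing_bound (r0 := 2^-1)) => //.
- exact: expR_gt0.
- by move=> w wr; apply: Fd; apply: le_lt_trans wr (radius_lt1 y0).
- by move=> w wr; apply: Fd; lra.
- by move=> x; rewrite nome_half -phiF//; exact: hM.
rewrite normc_nome; apply: le_trans (_ : expR (- (2 * pi * (y + y))) <= _).
  rewrite ler_expR lerN2; apply: ler_wpM2l; last by lra.
  by rewrite mulr_ge0// pi_ge0.
rewrite mulrDr opprD expRD; apply: ler_wpM2l; first exact: expR_ge0.
exact: radius_half.
Qed.

Let g_bounded : exists B, forall z, 2^-1 <= complex.Im z -> g z <= B.
Proof.
have [M hM] : exists M, forall w, complex.Im w = 4^-1 -> normc (phi w) <= M.
  have q0 : (0 : R) < 4^-1 by rewrite invr_gt0.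
  have [M hM] := @circle_bounded F (expR (- (2 * pi * 4^-1))) (expR_gt0 _)
     (fun w wr => Fd (le_lt_trans wr (radius_lt1 q0))).
  exists M => -[a b] /= ->; rewrite phiF//.
  by rewrite -nome_half.
pose K := 2 * M / expR (- (2 * pi * 4^-1)) ^+ d.
exists (K ^+ 2 * 2 ^+ `|kappa|%N) => z z2.
have z0 : 0 < complex.Im z by lra.
have V : normc (phi z) <= normc (nome z : C) ^+ d * K by apply: vanish => //; lra.
set y := complex.Im z in z2 z0 *; pose a := normc (nome z : C).
have aE : a = expR (- (2 * pi * y)) by exact: normc_nome.
have a0 : 0 < a by rewrite aE expR_gt0.
have a1 : a <= 1 by rewrite aE ltW// radius_lt1.
have ay : a * y <= 1.
  rewrite -ler_pdivlMl// mulr1 aE -expRN opprK.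
  apply: le_trans (_ : expR y <= _); first by have := expR_ge1Dx y; lra.
  by rewrite ler_expR ler_peMl ?ltW//; have := pi_ge2 R; lra.
(* Exponential decay beats the power of y: a y <= 1 for positive weight, a <= 1 and 1 / y <= 2 for
   negative weight. *)
have yk : a ^+ `|kappa|%N * y ^ kappa <= 2 ^+ `|kappa|%N.
  case: (kappa) => m; rewrite ?absz_nat.
    rewrite -exprnP -exprMn; apply: lerXn2r; rewrite ?nnegrE ?mulr_ge0 ?ltW//.
    by apply: le_lt_trans ay _; rewrite ltr1n.
  rewrite NegzE abszN absz_nat -exprnN -exprVn -exprMn; apply: lerXn2r => //.
  - by rewrite nnegrE mulr_ge0 ?invr_ge0 ?ltW.
  - by rewrite nnegrE.
  apply: le_trans (_ : 1 * 2 <= _); last by rewrite mul1r.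
  apply: ler_pM; [exact: ltW|by rewrite invr_ge0 ltW|exact: a1|].
  by rewrite -[X in _ <= X]invrK lef_pV2 ?posrE ?invr_gt0.
have yk0 : 0 <= y ^ kappa by rewrite exprz_ge0// ltW.
apply: le_trans (_ : (a ^+ d * K) ^+ 2 * y ^ kappa <= _).
  apply: ler_wpM2r => //; apply: lerXn2r => //; rewrite nnegrE ?normc_ge0//.
  exact: le_trans (normc_ge0 _) V.
rewrite exprMn -exprM mulrAC [X in _ <= X]mulrC.
apply: ler_wpM2r; first exact: sqr_ge0.
apply: le_trans yk; apply: ler_wpM2r => //.
by apply: ler_wiXn2l => //; [exact: ltW|]; move: dk; lia.
Qed.

(* Vanishing to order d at the cusp gains a factor 2 ^ - d from the height y / 2 to y. *)
Let g_contract B : (forall z, 2^-1 <= complex.Im z -> g z <= B) ->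
  forall z, 2^-1 <= complex.Im z -> g z <= B / 4.
Proof.
move=> hB; have gB : forall z, 0 < complex.Im z -> g z <= B.
  apply: modular_reduction => //.
  - by move=> z n z0; rewrite g_tr.
  - by move=> z z0; rewrite g_inv.
move=> z z2; set y := complex.Im z in z2 *; have y0 : 0 < y by lra.
have y20 : 0 < y / 2 by rewrite divr_gt0.
have yk0 : 0 < (y / 2) ^ kappa by rewrite exprz_gt0.
have B0 : 0 <= B.
  apply: le_trans (gB z y0); rewrite mulr_ge0 ?sqr_ge0// exprz_ge0//; exact: ltW.
pose M := Num.sqrt (B / (y / 2) ^ kappa).
have M2 : M ^+ 2 = B / (y / 2) ^ kappa by rewrite sqr_sqrtr// divr_ge0// ltW.
have hM w : complex.Im w = y / 2 -> normc (phi w) <= M.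
  move=> wy; rewrite -[normc _]ger0_norm ?normc_ge0// -sqrtr_sqr ler_wsqrtr//.
  by rewrite ler_pdivlMr// -wy; apply: gB; rewrite wy.
have V := @vanish (y / 2) z M _ _ hM.
have {}V : normc (phi z) <= 2 * M * 2^-1 ^+ d.
  apply: le_trans (V _ _) _; [by lra|by rewrite -/y; lra|].
  have -> : normc (nome z : C) = expR (- (2 * pi * (y / 2))) * expR (- (2 * pi * (y / 2))).
    by rewrite -expRD normc_nome; congr expR; rewrite -/y; field.
  have e0 := expR_gt0 (- (2 * pi * (y / 2))); have eh := @radius_half (y / 2).
  move: e0 eh; set e := expR _ => e0 eh; rewrite exprMn.
  have -> : e ^+ d * e ^+ d * (2 * M / e ^+ d) = 2 * M * e ^+ d.
    by field; rewrite expf_neq0// gt_eqF.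
  apply: ler_wpM2l; first by rewrite mulr_ge0// sqrtr_ge0.
  by apply: lerXn2r; [rewrite nnegrE; exact: ltW|rewrite nnegrE invr_ge0|apply: eh; lra].
have V2 : normc (phi z) ^+ 2 <= (2 * M * 2^-1 ^+ d) ^+ 2.
  by apply: lerXn2r V; rewrite nnegrE ?normc_ge0// !mulr_ge0 ?sqrtr_ge0// exprn_ge0// invr_ge0.
apply: le_trans (_ : (2 * M * 2^-1 ^+ d) ^+ 2 * y ^ kappa <= _).
  by apply: ler_wpM2r V2; rewrite exprz_ge0// ltW.
have -> : (2 * M * 2^-1 ^+ d) ^+ 2 * y ^ kappa = B * (4 * 2 ^ kappa / 4 ^+ d).
  have yE : y ^ kappa = (y / 2) ^ kappa * 2 ^ kappa by rewrite -expfzMl divfK ?pnatr_eq0.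
  have -> : (2 * M * 2^-1 ^+ d) ^+ 2 = 4 * M ^+ 2 * (2^-1 ^+ 2) ^+ d.
    by rewrite [(2^-1 ^+ 2) ^+ d]exprAC; move: (2^-1 ^+ d) => u; ring.
  have -> : 2^-1 ^+ 2 = 4^-1 :> R by rewrite expr2; lra.
  by rewrite M2 yE exprVn; field; rewrite expf_neq0 ?pnatr_eq0// gt_eqF.
apply: ler_wpM2l => //.
rewrite ler_pdivrMr ?exprn_gt0//.
have k2 : (2 : R) ^ kappa <= 4 ^+ `|kappa|%N.
  case: (kappa) => m; rewrite ?absz_nat -?exprnP.
    by apply: lerXn2r; rewrite ?nnegrE// ler_nat.
  rewrite NegzE abszN absz_nat -exprnN; apply: le_trans (_ : 1 <= _).
    by rewrite invf_le1 ?exprn_gt0// exprn_ege1// ler1n.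
  by rewrite exprn_ege1// ler1n.
apply: le_trans (_ : 4 * 4 ^+ `|kappa|%N <= _); first exact: ler_wpM2l.
(* The exponent is |kappa| + 2: one factor 4 is the squared 2 of the remainder bound, the other is
   the desired gain. This is the source of the 2 in [dk]. *)
rewrite ler_pdivlMl// -!exprS.
by apply: ler_weXn2l; rewrite ?ler1n//; move: dk; lia.
Qed.

Lemma modular_vanish z : 0 < complex.Im z -> phi z = 0.
Proof.
have [B0 hB0] := g_bounded.
have hB n : forall z, 2^-1 <= complex.Im z -> g z <= B0 / 4 ^+ n.
  elim: n => [|n IH] w w2; first by rewrite expr0 divr1 hB0.
  by have := g_contract IH w2; rewrite exprSr invfM mulrA.
apply: (@modular_reduction (fun z => phi z = 0)).
- by move=> w n w0; rewrite !phiF ?Im_addZ// nomeD nome_int mulr1.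
- move=> w w0; rewrite phi_inv// => /eqP; rewrite mulf_eq0 => /orP[|/eqP//].
  by rewrite expfz_eq0 => /andP[_ /eqP wE]; move: w0; rewrite wE ltxx.
move=> w w2; apply/eqP; rewrite -normc_eq0.
have y0 : 0 < complex.Im w by lra.
have yk : 0 < complex.Im w ^ kappa by rewrite exprz_gt0.
have g0 : 0 <= g w by rewrite mulr_ge0 ?sqr_ge0 ?ltW.
suff : g w = 0.
  by move=> /eqP; rewrite mulf_eq0 (gt_eqF yk) orbF sqrf_eq0.
apply/eqP; rewrite eq_le g0 andbT leNgt; apply/negP => gp.
have [n hn] := exists_small_halving B0 gp.
have B00 : 0 <= B0 by apply: le_trans (hB0 w w2).
have := hB n w w2; rewrite leNgt => /negP; apply; apply: le_lt_trans hn.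
apply: ler_wpM2l => //; rewrite lef_pV2 ?posrE ?exprn_gt0//.
by apply: lerXn2r; rewrite ?nnegrE// ler_nat.
Qed.

End Modular.
End Vanishing.

(** * Linear dependence of forms of degree one *)

Section DegreeOne.
Context {R : realType}.
Local Notation C := R[i].

Lemma siegel1 (z : C) : 0 < complex.Im z -> siegel (z%:M : 'M[C]_1).
Proof.
move=> z0; split; first by rewrite tr_scalar_mx.
move=> v v0; rewrite quadE !big_ord1 !mxE eqxx mulr1n mulrAC -expr2.
rewrite mulr_gt0// exprn_even_gt0//=; apply: contraNneq v0 => v00.
by apply/eqP/matrixP => i j; rewrite !ord1 v00 mxE.
Qed.

Lemma siegel1P (t : 'M[C]_1) : siegel t -> t = (t 0 0)%:M /\ 0 < complex.Im (t 0 0).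
Proof.
move=> [_ pt]; split; first exact: mx11_scalar.
have := pt 1%:M; rewrite quadE !big_ord1 !mxE eqxx mulr1n mul1r mulr1; apply.
by apply/eqP => /matrixP/(_ 0 0)/eqP; rewrite !mxE eqxx oner_eq0.
Qed.

Lemma form1_inv (k : int) (f : 'M[C]_1 -> C^o) (z : C) :
  (forall M tau, symplectic M -> siegel tau ->
    f (siegel_act M tau) = det_rep k (autom_factor M tau) (f tau)) ->
  0 < complex.Im z -> f (- z^-1)%:M = z ^ k * f z%:M.
Proof.
move=> ftr z0; have sz := siegel1 z0.
have zn : z != 0 by apply/eqP => zE; move: z0; rewrite zE ltxx.
pose M : 'M[int]_(1 + 1) := block_mx 0 (- 1%:M) 1%:M 0.
have sM : symplectic M.
  apply/symplectic_blockP; split.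
  - by rewrite trmx0 mul0mx mulmx0.
  - by rewrite mulmx0 trmx0 mul0mx.
  - by rewrite mulmx0 trmx1 mul1mx sub0r opprK.
have J1 : autom_factor M z%:M = z%:M.
  by rewrite /autom_factor block_mxKdl block_mxKdr /intC map_mx0 map_mx1 mul1mx addr0.
have := ftr M _ sM sz; rewrite (@siegel_act_unique _ _ _ _ sM sz (- z^-1)%:M); last first.
  rewrite J1 /act_num block_mxKul block_mxKur /intC map_mx0 mul0mx add0r.
  by rewrite map_mxN map_mx1 -scalar_mxM mulNr mulVf// raddfN.
by rewrite J1 /det_rep det_scalar1.
Qed.

Lemma cauchy_coefD (F G : C -> C) (r : R) j : 0 < r ->
  (forall w, normc w <= r -> cdiff F w) -> (forall w, normc w <= r -> cdiff G w) ->
  cauchy_coef (fun q => F q + G q) r j = cauchy_coef F r j + cauchy_coef G r j.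
Proof.
move=> r0 Fd Gd; rewrite /cauchy_coef -cintD.
- by apply: eq_cint => x _; rewrite mulrDl.
- exact: contin_coef.
- exact: contin_coef.
Qed.

Lemma cauchy_coefZ (F : C -> C) (r : R) (c : C) j : 0 < r ->
  (forall w, normc w <= r -> cdiff F w) ->
  cauchy_coef (fun q => c * F q) r j = c * cauchy_coef F r j.
Proof.
move=> r0 Fd; rewrite /cauchy_coef -cintZ.
  by apply: eq_cint => x _; rewrite mulrA.
exact: contin_coef.
Qed.

Lemma cdiff_sum (I : Type) (s : seq I) (F : I -> C -> C) w :
  (forall i, cdiff (F i) w) -> cdiff (fun q => \sum_(i <- s) F i q) w.
Proof.
move=> Fd; elim: s => [|i s IH].
  have -> : (fun q => \sum_(i <- [::]) F i q) = (fun=> 0).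
    by apply/funext => q; rewrite big_nil.
  exact: cdiff_cst.
have -> : (fun q => \sum_(i <- i :: s) F i q) = (fun q => F i q + \sum_(i <- s) F i q).
  by apply/funext => q; rewrite big_cons.
exact: cdiffD.
Qed.

Lemma cauchy_coef_comb (I : Type) (s : seq I) (c : I -> C) (F : I -> C -> C) (r : R) j :
  0 < r -> (forall i w, normc w <= r -> cdiff (F i) w) ->
  cauchy_coef (fun q => \sum_(i <- s) c i * F i q) r j = \sum_(i <- s) c i * cauchy_coef (F i) r j.
Proof.
move=> r0 Fd; have Fd' i w : normc w <= r -> cdiff (fun q => c i * F i q) w.
  by move=> wr; apply: cdiffM; [exact: cdiff_cst|exact: Fd].
elim: s => [|i s IH].
  rewrite big_nil; transitivity (0 * cint 0 1 (fun=> 0 : C)); last exact: mul0r.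
  rewrite -cintZ; last exact: contin_cst.
  by apply: eq_cint => x _; rewrite big_nil !mul0r.
rewrite big_cons -IH -cauchy_coefZ//; last exact: Fd.
rewrite -cauchy_coefD//.
- by congr (cauchy_coef _ r j); apply/funext => q; rewrite big_cons.
- exact: Fd'.
- by move=> w wr; apply: cdiff_sum => i'; exact: Fd'.
Qed.

(** More forms than conditions: some nonzero combination has its first |k| + 2 coefficients at the
    cusp equal to 0, and [modular_vanish] makes it zero. *)
Lemma forms_dependent (k : int) (N : nat) (f : 'I_N -> 'M[C]_1 -> C^o) :
  (`|k|%N + 2 < N)%N -> (forall i, siegel_form (det_rep k) (f i)) ->
  exists2 c : 'rV[C]_N, c != 0 &
    forall t, siegel t -> \sum_i c 0 i * f i t = 0.
Proof.
set d := (`|k|%N + 2)%N => dN hf.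
have /choice[F hF] i : exists F : C -> C, (forall q, normc q < 1 -> cdiff F q) /\
    (forall z, 0 < complex.Im z -> f i z%:M = F (nome z)).
  by have [_ _ /(_ erefl)/expansion_at_infinity] := hf i.
pose A : 'M[C]_(N, d) := \matrix_(i, j) cauchy_coef (F i) 2^-1 j.
have : kermx A != 0.
  rewrite kermx_eq0 /row_free; apply/eqP => E.
  by have := rank_leq_col A; rewrite E leqNgt dN.
move=> /rowV0Pn[c /sub_kermxP cA c0].
exists c => //.
have h0 : (0 : R) < 2^-1 by rewrite invr_gt0.
have h1 : (2^-1 : R) < 1 by lra.
move=> t /siegel1P[tE t0]; rewrite tE.
apply: (@modular_vanish R k (fun z => \sum_i c 0 i * f i z%:M)
  (fun q => \sum_i c 0 i * F i q) d) => //.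
- move=> q q1; apply: cdiff_sum => i; apply: cdiffM; first exact: cdiff_cst.
  exact: (hF i).1.
- by move=> z z0; apply: eq_bigr => i _; rewrite (hF i).2.
- move=> z z0; rewrite mulr_sumr; apply: eq_bigr => i _.
  have [_ ftr _] := hf i.
  by rewrite (form1_inv ftr z0) mulrCA.
move=> j jd; rewrite cauchy_coef_comb//; last first.
  by move=> i w w2; apply: (hF i).1; lra.
have := congr1 (fun M : 'rV[C]_d => M 0 (Ordinal jd)) cA.
rewrite mxE [in RHS]mxE => E; rewrite -[RHS]E.
by apply: eq_bigr => i _; rewrite mxE.
Qed.

End DegreeOne.

(** * The Koecher principle *)

Section HorosphereBound.
Context {R : realType}.
Local Notation C := R[i].
Local Notation MC g := ('M[C]_g : normedModType C).

Lemma matrix_continuous (T : topologicalType) (g : nat) (F : T -> 'M[C]_g) :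
  (forall i j, continuous (fun p => F p i j : C^o)) -> continuous (F : T -> MC g).
Proof.
move=> Fc p; apply/cvg_rnormP => e e0.
have H : \forall q \near p, forall ij : 'I_g * 'I_g,
    normc (F q ij.1 ij.2 - F p ij.1 ij.2) <= e.
  apply: filter_forall => -[i j] /=.
  by have /cvg_rnormP/(_ e e0) := Fc i j p; apply: filterS => q; rewrite rnormc.
apply: filterS H => q hq; apply: rnorm_mx_le; first exact: ltW.
by move=> i j; rewrite !mxE; exact: (hq (i, j)).
Qed.

Variable n : nat.

Lemma block_continuous (T : topologicalType) (a : T -> C) (z : T -> 'rV[C]_n) (t2 : 'M[C]_n) :
  continuous (a : T -> C^o) -> (forall j, continuous (fun p => z p 0 j : C^o)) ->
  continuous ((fun p => block_tau (a p)%:M (z p) t2) : T -> MC (1 + n)).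
Proof.
move=> ac zc; apply: matrix_continuous => i0 j0.
rewrite -(splitK i0) -(splitK j0).
case: (fintype.split i0) => i1; case: (fintype.split j0) => j1 /=.
- have -> : (fun p => block_tau (a p)%:M (z p) t2 (lshift n i1) (lshift n j1) : C^o) = a.
    by apply/funext => p; rewrite block_mxEul !ord1 mxE eqxx mulr1n.
  exact: ac.
- have -> : (fun p => block_tau (a p)%:M (z p) t2 (lshift n i1) (rshift 1 j1) : C^o) =
    (fun p => z p 0 j1) by apply/funext => p; rewrite block_mxEur ord1.
  exact: zc.
- have -> : (fun p => block_tau (a p)%:M (z p) t2 (rshift 1 i1) (lshift n j1) : C^o) =
    (fun p => z p 0 i1) by apply/funext => p; rewrite block_mxEdl mxE ord1.
  exact: zc.
have -> : (fun p => block_tau (a p)%:M (z p) t2 (rshift 1 i1) (rshift 1 j1) : C^o) =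
    (fun=> t2 i1 j1) by apply/funext => p; rewrite block_mxEdr.
by move=> p; exact: cst_continuous.
Qed.

Variable t2 : 'M[C]_n.
Hypothesis h2 : siegel t2.
Let Y : 'M[R]_n := map_mx (@complex.Im R) t2.

Let YT : Y^T = Y. Proof. by rewrite /Y map_trmx h2.1. Qed.

(** Completing the square: at (l, m) the imaginary part is the form Y at m + l v plus l^2 (Im t1 - v
    Y v^T). *)
Lemma siegel_block (t1 : 'M[C]_1) (z : 'rV[C]_n) (v : 'rV[R]_n) :
  map_mx (@complex.Im R) z = v *m Y -> (v *m Y *m v^T) 0 0 < complex.Im (t1 0 0) ->
  siegel (block_tau t1 z t2).
Proof.
move=> zv vt; split; first exact: block_tau_sym h2.1.
move=> w; rewrite -[w]hsubmxK; move: (lsubmx w) (rsubmx w) => l m w0.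
rewrite /block_tau map_block_mx -/Y -map_trmx zv.
set Y1 := map_mx _ t1.
have -> : row_mx l m *m block_mx Y1 (v *m Y) (v *m Y)^T Y *m (row_mx l m)^T =
    (m + l *m v) *m Y *m (m + l *m v)^T + l *m (Y1 - v *m Y *m v^T) *m l^T.
  rewrite mul_row_block tr_row_mx mul_row_col [(v *m Y)^T]trmx_mul YT.
  rewrite [(m + _)^T]linearD/= [(l *m v)^T]trmx_mul.
  rewrite !(mulmxDl, mulmxDr, mulmxN, mulNmx, mulmxA).
  set a1 := l *m Y1 *m l^T; set a2 := m *m Y *m v^T *m l^T.
  set a3 := l *m v *m Y *m m^T; set a4 := m *m Y *m m^T; set a5 := l *m v *m Y *m v^T *m l^T.
  clearbody a1 a2 a3 a4 a5; apply/matrixP => i j; rewrite !mxE; ring.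
rewrite mxE.
have nn (x : 'rV[R]_n) : 0 <= (x *m Y *m x^T) 0 0.
  by have [->|/h2.2/ltW//] := eqVneq x 0; rewrite !mul0mx mxE.
have lq : (l *m (Y1 - v *m Y *m v^T) *m l^T) 0 0 =
    l 0 0 ^+ 2 * (complex.Im (t1 0 0) - (v *m Y *m v^T) 0 0).
  move: (v *m Y *m v^T) => q; rewrite quadE !big_ord1 !mxE; ring.
rewrite lq; have [l0|l0] := eqVneq l 0.
  have m0 : m != 0 by apply: contraNneq w0 => ->; rewrite l0 row_mx0.
  by rewrite l0 mul0mx addr0 [(0 : 'rV_1) 0 0]mxE expr0n mul0r addr0; exact: h2.2.
rewrite ltr_wpDl// mulr_gt0 ?subr_gt0// exprn_even_gt0//=.
by apply: contraNneq l0 => l00; apply/eqP/matrixP => i j; rewrite !ord1 l00 mxE.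
Qed.

Variables (k : int) (f : 'M[C]_(1 + n) -> C^o).
Hypothesis hol : holomorphic_siegel f.
Hypothesis ftr : forall M tau, symplectic M -> siegel tau ->
  f (siegel_act M tau) = det_rep k (autom_factor M tau) (f tau).

Local Notation cz b := (map_mx (intr : int -> C) b).

Lemma block_translation (t1 : 'M[C]_1) z (a : int) (b : 'rV[int]_n) :
  siegel (block_tau t1 z t2) ->
  f (block_tau (t1 + (a%:~R)%:M) (z + cz b) t2) = f (block_tau t1 z t2).
Proof.
move=> s; have ST : (block_mx a%:M b b^T 0 : 'M[int]_(1 + n))^T = block_mx a%:M b b^T 0.
  by rewrite tr_block_mx trmxK tr_scalar_mx trmx0.
rewrite -(form_translation ftr ST s); congr f.
rewrite /intC map_block_mx map_scalar_mx map_mx0 /block_tau add_block_mx addr0.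
by rewrite linearD/= map_trmx.
Qed.

Lemma block_shift (t1 : 'M[C]_1) z (b : 'rV[int]_n) :
  siegel (block_tau t1 z t2) ->
  f (block_tau (t1 + cz b *m z^T + z *m (cz b)^T + cz b *m t2 *m (cz b)^T) (z + cz b *m t2) t2) =
  f (block_tau t1 z t2).
Proof.
move=> s; pose U : 'M[int]_(1 + n) := block_mx 1%:M b 0 1%:M.
pose W : 'M[int]_(1 + n) := block_mx 1%:M 0 (- b^T) 1%:M.
have UW : U^T *m W = 1%:M.
  rewrite /U /W tr_block_mx !trmx1 trmx0 mulmx_block !mul1mx !mul0mx !mulmx1 !mulmx0.
  by rewrite !addr0 add0r subrr -scalar_mx_block.
have := form_unimodular ftr UW s.
have -> : \det (intC W : 'M[C]_(1 + n)) = 1.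
  by rewrite /intC map_block_mx !map_mx1 map_mx0 det_lblock !det1 mulr1.
rewrite exp1rz mul1r => <-; congr f.
rewrite /intC /U map_block_mx !map_mx1 map_mx0 /block_tau tr_block_mx !trmx1 trmx0.
rewrite !mulmx_block ?mul1mx ?mul0mx ?mulmx1 ?mulmx0 ?addr0 ?add0r.
rewrite mulmxDl !addrA; congr (block_mx _ _ _ _).
by rewrite linearD/= trmx_mul h2.1.
Qed.

Let Q (v : 'rV[R]_n) : R := (v *m Y *m v^T) 0 0.

Let shift_v (x : R) : 0 <= x + (- Num.floor x)%:~R <= 1.
Proof.
have h1 : (Num.floor x)%:~R <= x by exact: ge_floor.
have h2' : x < (Num.floor x)%:~R + 1 by have := floorD1_gt x; rewrite intrD.
by rewrite mulrNz; apply/andP; split; lra.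
Qed.

(** The unipotent shift moves v by the integer vector [b] and keeps the excess Im t1 - Q v equal to
    1, hence preserves the horosphere. *)
Let Im_shift (t1 : 'M[C]_1) z v (b : 'rV[int]_n) :
  map_mx (@complex.Im R) z = v *m Y -> complex.Im (t1 0 0) = 1 + Q v ->
  let v' := v + map_mx intr b in
  map_mx (@complex.Im R) (z + cz b *m t2) = v' *m Y /\
  complex.Im ((t1 + cz b *m z^T + z *m (cz b)^T + cz b *m t2 *m (cz b)^T) 0 0) = 1 + Q v'.
Proof.
move=> zv tv v'; pose br : 'rV[R]_n := map_mx intr b.
have ImM (m p q : nat) (A : 'M[int]_(m, p)) (B : 'M[C]_(p, q)) :
    map_mx (@complex.Im R) (map_mx intr A *m B) = map_mx intr A *m map_mx (@complex.Im R) B.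
  apply/matrixP => i j; rewrite !mxE raddf_sum; apply: eq_bigr => l _.
  rewrite !mxE -[(A i l)%:~R in LHS](rmorph_int (real_complex R)).
  by case: (B l j) => x y /=; rewrite mul0r addr0.
have zI : map_mx (@complex.Im R) (z + cz b *m t2) = v' *m Y.
  by rewrite map_mxD ImM zv -/Y mulmxDl.
split=> //.
have e1 : map_mx (@complex.Im R) (cz b *m z^T) = br *m Y *m v^T.
  by rewrite ImM -map_trmx zv trmx_mul YT mulmxA.
have e2 : map_mx (@complex.Im R) (z *m (cz b)^T) = v *m Y *m br^T.
  rewrite -[z *m _]trmxK trmx_mul trmxK -map_trmx e1 !trmx_mul trmxK YT.
  by rewrite mulmxA.
have e3 : map_mx (@complex.Im R) (cz b *m t2 *m (cz b)^T) = br *m Y *m br^T.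
  rewrite -mulmxA ImM -mulmxA; congr (_ *m _).
  by rewrite -[t2 *m _]trmxK trmx_mul trmxK h2.1 -map_trmx ImM -/Y trmx_mul YT.
have E : map_mx (@complex.Im R) (t1 + cz b *m z^T + z *m (cz b)^T + cz b *m t2 *m (cz b)^T) =
    map_mx (@complex.Im R) t1 + br *m Y *m v^T + v *m Y *m br^T + br *m Y *m br^T.
  by rewrite !map_mxD e1 e2 e3.
have QE : v' *m Y *m v'^T = v *m Y *m v^T + br *m Y *m v^T + (v *m Y *m br^T + br *m Y *m br^T).
  by rewrite /v' -/br [(v + _)^T]linearD/= !(mulmxDl, mulmxDr) addrACA.
have := congr1 (fun M : 'M[R]_1 => M 0 0) E; rewrite mxE => ->.
rewrite /Q QE; move: tv; rewrite /Q.
move: (v *m Y *m v^T) (br *m Y *m v^T) (v *m Y *m br^T) (br *m Y *m br^T) => q1 q2 q3 q4 tv.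
by rewrite !mxE tv; ring.
Qed.

Let mx_norm_le1 (m : nat) (u : 'rV[R]_m) : (forall j, 0 <= u 0 j <= 1) -> `|u| <= 1.
Proof.
move=> u1; suff : mx_norm u <= 1 by [].
have [->|u0] := eqVneq (mx_norm u) 0; first exact: ler01.
have [[i j] /= ->] := mx_norm_neq0 u0.
by rewrite ord1; have /andP[h1 h1'] := u1 j; rewrite ger0_norm.
Qed.

(* Shifts bring v into the unit cube and translations bring the real parts into [0, 1], so that
   the horosphere is covered by translates of a compact set. *)
Lemma horosphere_bound : exists B, forall (t1 : 'M[C]_1) z v,
  map_mx (@complex.Im R) z = v *m Y ->
  complex.Im (t1 0 0) = 1 + (v *m Y *m v^T) 0 0 ->
  normc (f (block_tau t1 z t2)) <= B.
Proof.
(* Parametrizes the horosphere by the real part of [t1], the real part of z, and v; the bound is the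
   maximum of |f| over the image of a compact box. *)
pose G (p : R * 'rV[R]_n * 'rV[R]_n) : 'M[C]_(1 + n) :=
  block_tau (p.1.1 +i* (1 + Q p.2))%:M (\row_j (p.1.2 0 j +i* (p.2 *m Y) 0 j)) t2.
have Gs p : siegel (G p).
  apply: (@siegel_block _ _ p.2); first by apply/matrixP => i j; rewrite !ord1 !mxE.
  by rewrite [X in _ < complex.Im X]mxE eqxx mulr1n /= -/(Q _) ltrDr.
have c2 : continuous (fun p : R * 'rV[R]_n * 'rV[R]_n => p.2) by move=> p; exact: cvg_snd.
have c1 : continuous (fun p : R * 'rV[R]_n * 'rV[R]_n => p.1) by move=> p; exact: cvg_fst.
have c2j j : continuous (fun p : R * 'rV[R]_n * 'rV[R]_n => p.2 0 j).
  move=> p; apply: (@continuous_comp _ _ _ (fun p : R * 'rV[R]_n * 'rV[R]_n => p.2)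
    (fun v : 'rV[R]_n => v 0 j)); first exact: c2.
  exact: coord_continuous.
have c12j j : continuous (fun p : R * 'rV[R]_n * 'rV[R]_n => p.1.2 0 j).
  move=> p; apply: (@continuous_comp _ _ _ (fun p : R * 'rV[R]_n * 'rV[R]_n => p.1)
    (fun q => q.2 0 j)); first exact: c1.
  apply: (@continuous_comp _ _ _ (fun q : R * 'rV[R]_n => q.2) (fun v : 'rV[R]_n => v 0 j)).
    exact: cvg_snd.
  exact: coord_continuous.
have c11 : continuous (fun p : R * 'rV[R]_n * 'rV[R]_n => p.1.1).
  move=> p; apply: (@continuous_comp _ _ _ (fun p : R * 'rV[R]_n * 'rV[R]_n => p.1)
    (fun q => q.1)); first exact: c1.
  exact: cvg_fst.
have Lc j : continuous (fun p : R * 'rV[R]_n * 'rV[R]_n => \sum_i p.2 0 i * Y i j).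
  apply: continuous_big_sum => i q.
  by apply: cvgM; [exact: c2j|exact: cvg_cst].
have Qc : continuous (fun p : R * 'rV[R]_n * 'rV[R]_n => Q p.2).
  have -> : (fun p : R * 'rV[R]_n * 'rV[R]_n => Q p.2) =
      (fun p => \sum_j \sum_i p.2 0 i * Y i j * p.2 0 j).
    by apply/funext => q; rewrite /Q quadE.
  apply: continuous_big_sum => j; apply: continuous_big_sum => i q.
  by apply: cvgM; [apply: cvgM; [exact: c2j|exact: cvg_cst]|exact: c2j].
have Gc : continuous (G : _ -> MC (1 + n)).
  apply: block_continuous.
    by move=> p; apply: cvg_complex; [exact: c11|apply: cvgD; [exact: cvg_cst|exact: Qc]].
  move=> j; have -> : (fun p : R * 'rV[R]_n * 'rV[R]_n =>
      (\row_j (p.1.2 0 j +i* (p.2 *m Y) 0 j)) 0 j : C^o) =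
      (fun p => p.1.2 0 j +i* (\sum_i p.2 0 i * Y i j)).
    by apply/funext => q; rewrite !mxE.
  move=> p; apply: cvg_complex; first exact: c12j.
  exact: Lc.
pose H p : R := normc (symmetrized f (G p)).
have Hc : continuous H.
  move=> p; apply: (@continuous_comp _ C^o _ (fun p => symmetrized f (G p)) (fun z => normc z)).
    apply: (@continuous_comp _ (MC (1 + n)) C^o G (symmetrized f)); first exact: Gc.
    have [d] := holo_symmetrized hol (siegel_sym_siegel (Gs p)).
    exact: differentiable_continuous.
  exact: continuous_normc.
pose S : set 'rV[R]_n := [set v | `|v| <= 1].
have cS : compact S.
  apply: bounded_closed_compact.
    by exists 1; split; [exact: num_real|move=> x x1 v /= v1; apply: le_trans v1 (ltW x1)].
  apply: (@closed_comp _ _ (fun v : 'rV[R]_n => `|v|) [set y | y <= 1]); last exact: closed_le.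
  by move=> v _; exact: norm_continuous.
pose K := (`[0 : R, 1]%classic `*` S) `*` S.
have cK : compact K.
  by apply: compact_setX => //; apply: compact_setX => //; exact: segment_compact.
have K0 : K !=set0.
  exists ((0, 0), 0); split=> /=; last by rewrite /S/= normr0.
  by split=> /=; [rewrite in_itv/= lexx ler01|rewrite /S/= normr0].
have [c cmax hmax] := @compact_EVT_max _ R H K K0 cK (continuous_subspaceT Hc).
exists (H c) => t1 z v zv tv.
pose b : 'rV[int]_n := \row_j (- Num.floor (v 0 j)).
have s0 : siegel (block_tau t1 z t2) by apply: (siegel_block zv); rewrite tv /Q ltrDr.
have [] := Im_shift b zv tv; rewrite -(block_shift b s0).
have v1 j : 0 <= (v + map_mx intr b) 0 j <= 1 by rewrite !mxE; exact: shift_v.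
move: v1; set v' := v + _; set z' := z + _; set t1' := t1 + _ + _ + _ => v1 zv' tv'.
have s1 : siegel (block_tau t1' z' t2) by apply: (siegel_block zv'); rewrite tv' /Q ltrDr.
pose a : int := - Num.floor (complex.Re (t1' 0 0)).
pose b' : 'rV[int]_n := \row_j (- Num.floor (complex.Re (z' 0 j))).
rewrite -(block_translation a b' s1).
pose p : R * 'rV[R]_n * 'rV[R]_n := ((complex.Re (t1' 0 0) + a%:~R,
  \row_j (complex.Re (z' 0 j) + (b' 0 j)%:~R)), v').
have addI (w : C) (m : int) : w + m%:~R = (complex.Re w + m%:~R) +i* complex.Im w.
  rewrite -[m%:~R in LHS](rmorph_int (real_complex R)).
  by case: w => x y; apply/eqP; rewrite eq_complex/= addr0 !eqxx.
have -> : block_tau (t1' + (a%:~R)%:M) (z' + cz b') t2 = G p.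
  rewrite /G; congr block_tau.
    apply/matrixP => i j; rewrite !ord1 [RHS]mxE eqxx mulr1n [LHS]mxE.
    by rewrite [((a%:~R)%:M : 'M[C]_1) 0 0]mxE eqxx mulr1n addI tv'.
  apply/matrixP => i j; rewrite !ord1 [LHS]mxE [RHS]mxE.
  have -> : cz b' 0 j = (b' 0 j)%:~R by rewrite [LHS]mxE.
  rewrite addI; congr (_ +i* _); first by rewrite /= [RHS]mxE.
  by rewrite -[v' *m Y]zv' [RHS]mxE.
rewrite -(symmetrized_block f _ _ h2.1); apply: (hmax p); rewrite inE; split=> /=.
  split=> /=; first by rewrite in_itv/=; exact: shift_v.
  by apply: mx_norm_le1 => j; rewrite !mxE; exact: shift_v.
exact: mx_norm_le1.
Qed.

End HorosphereBound.

Section KoecherBound.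
Context {R : realType}.
Local Notation C := R[i].
Local Notation MC g := ('M[C]_g : normedModType C).
Variables (n : nat) (t2 : 'M[C]_n.+1).
Hypothesis h2 : siegel t2.
Variables (k : int) (f : 'M[C]_(1 + n.+1) -> C^o).
Hypothesis hol : holomorphic_siegel f.
Hypothesis ftr : forall M tau, symplectic M -> siegel tau ->
  f (siegel_act M tau) = det_rep k (autom_factor M tau) (f tau).

Let Y : 'M[R]_n.+1 := map_mx (@complex.Im R) t2.
Let YT : Y^T = Y. Proof. by rewrite /Y map_trmx h2.1. Qed.
Let YU : Y \in unitmx. Proof. exact: posdef_unit h2.2. Qed.
Let Q (v : 'rV[R]_n.+1) : R := (v *m Y *m v^T) 0 0.
(** Chosen with u Y = e_0: adding s e_0 to z adds (Im s) u to the vector v with Im z = v Y. *)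
Let u : 'rV[R]_n.+1 := delta_mx 0 0 *m invmx Y.
Let A := Q u.

Let A_gt0 : 0 < A.
Proof.
apply: h2.2; apply/eqP => u0; have := mulmxKV YU (delta_mx 0 0 : 'rV[R]_n.+1).
rewrite -/u u0 mul0mx => /matrixP/(_ 0 0)/eqP.
by rewrite !mxE !eqxx eq_sym oner_eq0.
Qed.

Let Q_line v (s : R) : Q (v + s *: u) = Q v + 2 * s * (v *m Y *m u^T) 0 0 + s ^+ 2 * A.
Proof.
rewrite /A /Q [(v + _)^T]linearD/= [(s *: u)^T]linearZ/=.
rewrite !(mulmxDl, mulmxDr) -!scalemxAl -!scalemxAr -?scalemxAl.
have -> : u *m Y *m v^T = v *m Y *m u^T.
  have <- : (u *m Y *m v^T)^T = v *m Y *m u^T by rewrite trmx_mul trmxK trmx_mul YT mulmxA.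
  by apply/matrixP => i j; rewrite !ord1 [RHS]mxE.
move: (v *m Y *m v^T) (v *m Y *m u^T) (u *m Y *m u^T) => q1 q2 q3.
by rewrite !mxE; ring.
Qed.

(** For |s| >= 1 the modulus a of nome is at most 1/2 or at least 2, and in both cases a <= 2 |a -
    1|. *)
Let kernel_bound (x s : R) : 1 <= `|s| -> normc (cauchy_kernel 0 (x +i* s)) <= 2.
Proof.
move=> s1; rewrite cauchy_kernelE nome0 normcM normcV.
have nE : normc (nome (x +i* s) : C) = expR (- (2 * pi * s)) by rewrite normc_nome.
set a := expR _ in nE; have a0 : 0 < a by exact: expR_gt0.
have p2 : 2 <= pi :> R by exact: pi_ge2.
have D1 : `|a - 1| <= normc (nome (x +i* s) - 1 : C).
  rewrite -nE ler_norml; apply/andP; split.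
    by have := lerB_normc 1 (nome (x +i* s) : C); rewrite normc_1 normcB; lra.
  by have := lerB_normc (nome (x +i* s) : C) 1; rewrite normc_1.
have D2 : a <= 2 * `|a - 1|.
  have [s0|s0] := leP 0 s.
    have : a <= 2^-1.
      apply: le_trans (_ : expR (- 1) <= _).
        rewrite ler_expR lerN2; apply: le_trans (_ : 1 * 1 <= _); first by rewrite mul1r.
        by apply: ler_pM => //; [lra|rewrite -(ger0_norm s0)].
      rewrite expRN lef_pV2 ?posrE ?expR_gt0//.
      by have := expR_ge1Dx (1 : R); lra.
    by move=> ah; rewrite ler0_norm; lra.
  have : 2 <= a.
    apply: le_trans (_ : expR 1 <= _); first by have := expR_ge1Dx (1 : R); lra.
    rewrite ler_expR -mulrN -(ltr0_norm s0) -[1]mulr1.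
    by apply: ler_pM => //; lra.
  by move=> ah; rewrite ger0_norm; lra.
have D0 : 0 < normc (nome (x +i* s) - 1 : C) by apply: lt_le_trans D1; lra.
by rewrite nE ler_pdivrMr//; apply: le_trans D2 _; rewrite ler_pM2l.
Qed.

Let K1 := \sum_j `|u 0 j|.
Let K2 := \sum_j \sum_i `|invmx Y i j|.

Let z_bounds (z : 'rV[C]_n.+1) : (forall j, normc (z 0 j) <= 1) ->
  let v := map_mx (@complex.Im R) z *m invmx Y in
  Q v <= K2 /\ `|(v *m Y *m u^T) 0 0| <= K1.
Proof.
move=> z1 v; have I1 j : `|(map_mx (@complex.Im R) z) 0 j| <= 1.
  by rewrite mxE; apply: le_trans (normr_Im _) (z1 j).
have vY : v *m Y = map_mx (@complex.Im R) z by rewrite mulmxKV.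
split.
  have -> : Q v = (map_mx (@complex.Im R) z *m invmx Y *m (map_mx (@complex.Im R) z)^T) 0 0.
    by rewrite /Q vY /v trmx_mul trmx_inv YT mulmxA.
  rewrite quadE; apply: le_trans (ler_norm _) _.
  apply: le_trans (ler_norm_sum _ _ _) _; apply: ler_sum => j _.
  apply: le_trans (ler_norm_sum _ _ _) _; apply: ler_sum => i _.
  rewrite !normrM -[X in _ <= X]mul1r -[X in _ <= X]mulr1.
  apply: ler_pM; [by rewrite mulr_ge0|exact: normr_ge0| |exact: I1].
  exact: ler_wpM2r.
rewrite vY mxE; apply: le_trans (ler_norm_sum _ _ _) _; apply: ler_sum => j _.
rewrite normrM [u^T j 0]mxE -[X in _ <= X]mul1r.
exact: ler_wpM2r.
Qed.

(* The slice s |-> (t1, z + s e_0, t2) is 1-periodic and meets the horosphere on two horizontal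
   lines, at heights sm <= -1 and sp >= 1; Cauchy's formula in the strip between them applies. *)
Lemma koecher_bound : exists B T, forall (t1 : 'M[C]_1) (z : 'rV[C]_n.+1),
  T <= complex.Im (t1 0 0) -> (forall j, normc (z 0 j) <= 1) ->
  siegel (block_tau t1 z t2) /\ normc (f (block_tau t1 z t2)) <= B.
Proof.
have [B hB] := horosphere_bound h2 hol ftr.
(* Two lines, on each of which |f| <= [B] and the kernel is at most 2. The threshold gives [c] >= A
   + 2 K1 below, which puts both lines at distance at least 1 from the real axis. *)
exists (B * 2 + B * 2), (1 + K2 + A + 2 * K1) => t1 z tT z1.
set y1 := complex.Im (t1 0 0) in tT *.
pose v := map_mx (@complex.Im R) z *m invmx Y.
have [] := z_bounds z1; rewrite -/v; set Q0 := Q v; set b := (v *m Y *m u^T) 0 0 => Q0K bK.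
have b0 : - K1 <= b <= K1 by rewrite -ler_norml.
have K10 : 0 <= K1 by rewrite sumr_ge0.
have K20 : 0 <= K2 by rewrite sumr_ge0// => j _; rewrite sumr_ge0.
have A0 := A_gt0.
have zI (s : C) : map_mx (@complex.Im R) (z + s *: (delta_mx 0 0 : 'rV[C]_n.+1)) =
    (v + complex.Im s *: u) *m Y.
  rewrite mulmxDl /v mulmxKV// -scalemxAl /u mulmxKV//.
  apply/matrixP => i j; rewrite !mxE raddfD/=; congr (_ + _).
  by case: (_ && _); rewrite ?mulr1 ?mulr0.
(* The slice meets the horosphere where A s^2 + 2 b s - c = 0, with roots [sm] and [sp]. Since |b|
   <= K1, the discriminant r^2 = b^2 + A c is at least (A + |b|)^2, so the roots lie beyond -1 and
   1. *)
pose c := y1 - 1 - Q0.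
pose r := Num.sqrt (b ^+ 2 + A * c).
have c0 : A + 2 * K1 <= c by rewrite /c; lra.
have D0 : 0 <= b ^+ 2 + A * c by rewrite addr_ge0 ?sqr_ge0// mulr_ge0 ?ltW//; lra.
have r2 : r ^+ 2 = b ^+ 2 + A * c by rewrite sqr_sqrtr.
have r0 : 0 <= r by exact: sqrtr_ge0.
have Ac : A * (A + 2 * K1) <= A * c by rewrite ler_pM2l.
have rA1 : A + b <= r by nra.
have rA2 : A - b <= r by nra.
pose sp := (- b + r) / A; pose sm := (- b - r) / A.
have sp1 : 1 <= sp by rewrite /sp ler_pdivlMr// mul1r; lra.
have sm1 : sm <= - 1 by rewrite /sm ler_pdivrMr// mulN1r; lra.
have spE : A * sp = - b + r by rewrite /sp mulrC divfK// gt_eqF.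
have smE : A * sm = - b - r by rewrite /sm mulrC divfK// gt_eqF.
have QE (s : R) : Q (v + s *: u) = (y1 - 1) + A * ((s - sm) * (s - sp)).
  apply: (mulfI (lt0r_neq0 A0)); rewrite Q_line -/Q0 -/b [RHS]mulrDr.
  have -> : A * (A * ((s - sm) * (s - sp))) = (A * s - A * sm) * (A * s - A * sp) by ring.
  rewrite spE smE.
  have -> : (A * s - (- b - r)) * (A * s - (- b + r)) = (A * s + b) ^+ 2 - r ^+ 2 by ring.
  by rewrite r2 /c; ring.
pose F (s : C) := f (block_tau t1 (z + s *: (delta_mx 0 0 : 'rV[C]_n.+1)) t2).
have Fs (s : C) : sm <= complex.Im s <= sp ->
    siegel (block_tau t1 (z + s *: (delta_mx 0 0 : 'rV[C]_n.+1)) t2).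
  move=> /andP[s1 s2]; apply: (siegel_block h2 (zI s)); rewrite -/y1.
  have -> : ((v + complex.Im s *: u) *m map_mx (@complex.Im R) t2 *m
     (v + complex.Im s *: u)^T) 0 0 = Q (v + complex.Im s *: u) by [].
  rewrite QE; have : (complex.Im s - sm) * (complex.Im s - sp) <= 0.
    by apply: mulr_ge0_le0; lra.
  by move=> h; have := mulr_ge0_le0 (ltW A0) h; lra.
have s0 : siegel (block_tau t1 z t2).
  by have := Fs 0; rewrite scale0r addr0; apply => /=; apply/andP; split; lra.
split=> //.
have F0 : f (block_tau t1 z t2) = F 0 by rewrite /F scale0r addr0.
have [lo hi] : sm < complex.Im (0 : C) /\ complex.Im (0 : C) < sp by split=> /=; lra.
have line (s : R) : Q (v + s *: u) = y1 - 1 -> forall x, normc (F (x +i* s)) <= B.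
  move=> qs x; apply: (hB _ _ _ (zI (x +i* s))).
  have -> : ((v + complex.Im (x +i* s) *: u) *m map_mx (@complex.Im R) t2 *m
     (v + complex.Im (x +i* s) *: u)^T) 0 0 = Q (v + s *: u) by [].
  by rewrite qs -/y1; ring.
have lp : forall x, normc (F (x +i* sp)) <= B.
  by apply: line; rewrite QE subrr !mulr0 addr0.
have lm : forall x, normc (F (x +i* sm)) <= B.
  by apply: line; rewrite QE subrr mul0r mulr0 addr0.
have Fd (s : C) : sm <= complex.Im s <= sp -> cdiff F s.
  move=> hs; pose e : MC (1 + n.+1) := zdir (delta_mx 0 0).
  have -> : F = slice (symmetrized f) (block_tau t1 z t2 : MC (1 + n.+1)) e.
    by apply/funext => w; rewrite /slice /e -zdirZ -block_tauD symmetrized_block//; exact: h2.1.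
  apply: cdiff_slice; rewrite /e -zdirZ -block_tauD.
  by apply: (holo_symmetrized hol); exact/siegel_sym_siegel/Fs.
have Fp (s : C) : sm <= complex.Im s <= sp -> F (s + 1) = F s.
  move=> hs; rewrite /F -(block_translation ftr 0 (delta_mx 0 0) (Fs s hs)).
  congr (f (block_tau _ _ _)); first by rewrite raddf0 addr0.
  rewrite scalerDl scale1r addrA; congr (_ + _).
  by apply/matrixP => i j; rewrite !mxE; case: (_ && _).
have cont (s : R) : sm <= s <= sp -> s != 0 ->
    contin 0 1 (fun x => F (x +i* s) * cauchy_kernel 0 (x +i* s)).
  move=> hs sn; apply: continM; last by apply: contin_kernel.
  by apply: contin_horizontal => x _; apply/cdiff_continuous/Fd.
have bnd (s : R) : sm <= s <= sp -> 1 <= `|s| -> (forall x, normc (F (x +i* s)) <= B) ->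
    normc (cint 0 1 (fun x => F (x +i* s) * cauchy_kernel 0 (x +i* s))) <= B * 2.
  move=> hs s1 FB; apply: le_trans (cint_norm (M := B * 2) _ _ _) _.
  - exact: ler01.
  - by apply: cont => //; apply/eqP => sE; move: s1; rewrite sE normr0 ler10.
  - move=> x _; rewrite normcM; apply: ler_pM; [exact: normc_ge0|exact: normc_ge0|exact: FB|].
    exact: kernel_bound.
  by rewrite subr0 mul1r.
have smsp : sm <= sp by lra.
have bm : normc (cint 0 1 (fun x => F (x +i* sm) * cauchy_kernel 0 (x +i* sm))) <= B * 2.
  apply: (bnd sm _ _ lm); first by rewrite lexx smsp.
  by rewrite ler0_norm; lra.
have bp : normc (cint 0 1 (fun x => F (x +i* sp) * cauchy_kernel 0 (x +i* sp))) <= B * 2.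
  apply: (bnd sp _ _ lp); first by rewrite lexx smsp.
  by rewrite ger0_norm; lra.
rewrite F0 (strip_cauchy lo hi Fp Fd); apply: le_trans (normcD _ _) _; rewrite normcN.
exact: lerD bm bp.
Qed.

End KoecherBound.

(** * Cauchy estimates near the cusp *)

Section BoundedDerivatives.
Context {R : realType}.
Local Notation C := R[i].
Local Notation MC g := ('M[C]_g : normedModType C).
Variables (n : nat) (t2 : 'M[C]_n).
Let Om : set (MC (1 + n)) := @sym_siegel R (1 + n).

(** Boundedness on a whole polydisc in z, uniformly for Im t1 large. The radius [e] is existential
    because each differentiation halves it. *)
Definition cusp_bounded (psi : MC (1 + n) -> C) := exists (e B T : R), 0 < e /\
  forall (t1 : 'M[C]_1) (z : 'rV[C]_n), T <= complex.Im (t1 0 0) ->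
  (forall j, normc (z 0 j) <= e) ->
  Om (block_tau t1 z t2) /\ normc (psi (block_tau t1 z t2)) <= B.

Lemma rnorm_zdir (z : 'rV[C]_n) : rnorm (zdir z) <= 1 * rnorm z.
Proof.
rewrite mul1r; apply: rnorm_block; first exact: rnorm_ge0.
- by move=> i j; rewrite mxE normc_0 rnorm_ge0.
- by move=> i j; exact: rnorm_mx_entry.
- by move=> i j; rewrite mxE; exact: rnorm_mx_entry.
- by move=> i j; rewrite mxE normc_0 rnorm_ge0.
Qed.

Lemma linear_zdir : linear (@zdir R n).
Proof.
by move=> a u v; rewrite -zdirZ /zdir add_block_mx !addr0 linearD.
Qed.

Lemma cusp_bounded_dirderiv psi (e : 'rV[C]_n) : holo_on Om psi -> cusp_bounded psi ->
  cusp_bounded (dirderiv (zdir e) psi).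
Proof.
move=> hpsi [d [B [T [d0 H]]]]; have d20 : 0 < d / 2 by rewrite divr_gt0.
exists (d / 2), (2 * B / (d / 2) * rnorm (e : 'rV[C]_n)), T; split=> // t1 z tT zd.
have zd' j : normc (z 0 j) <= d by apply: le_trans (zd j) _; lra.
split; first exact: (H t1 z tT zd').1.
have near (y : 'rV[C]_n) : rnorm (y - z) < d / 2 -> forall j, normc (y 0 j) <= d.
  move=> yz j; have := normcD (y 0 j - z 0 j) (z 0 j); rewrite subrK.
  have := rnorm_mx_entry (y - z) 0 j; rewrite !mxE; have := zd j; lra.
rewrite -dirderiv_block; apply: derive_bound => // y yz; last exact: (H t1 y tT (near y yz)).2.
apply: (@holo_affine R _ (MC (1 + n)) (fun y => block_tau t1 y t2) (@zdir R n) 1).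
- exact: linear_zdir.
- exact: rnorm_zdir.
- by move=> h; rewrite block_tauD.
by apply: hpsi; exact: (H t1 y tT (near y yz)).1.
Qed.

Lemma cusp_bounded_mixed m psi : holo_on Om psi -> cusp_bounded psi ->
  cusp_bounded (mixed (fun b => zdir (delta_mx 0 b)) m psi).
Proof.
have Oo : open Om by exact: open_sym_siegel.
move=> hpsi bpsi; rewrite /mixed; elim: (enum 'I_n) => [//|b s IH] /=.
elim: (m b) => [//|l IHl]; apply: cusp_bounded_dirderiv IHl.
by apply: holo_diter => //; apply: holo_mixed_on.
Qed.

Lemma taylor_coeff_bounded (f : 'M[C]_(1 + n) -> C^o) m : siegel t2 -> holomorphic_siegel f ->
  cusp_bounded (symmetrized f) ->
  exists B T, forall z : C, T <= complex.Im z -> normc (taylor_coeff f m z%:M t2) <= B.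
Proof.
move=> h2 hol bf; pose a : C := (\prod_(b < n) (m b)`!%:R)^-1.
have [d [B [T [d0 H]]]] := cusp_bounded_mixed m (holo_symmetrized hol) bf.
exists (normc a * B), T => z zT; rewrite taylor_coeff_mixed; last exact: h2.1.
rewrite normcM; apply: ler_wpM2l; first exact: normc_ge0.
apply: (H z%:M 0 _ _).2 => [|j]; first by rewrite mxE eqxx mulr1n.
by rewrite mxE normc_0 ltW.
Qed.

End BoundedDerivatives.

(** * Taylor coefficients as forms of degree one *)

Section CoefficientForms.
Context {R : realType}.
Local Notation C := R[i].
Local Notation MC g := ('M[C]_g : normedModType C).

Lemma cdiff_scalar (g : 'M[C]_1 -> C) (z : C) :
  holo (fun w : MC 1 => g (sym_part w)) (z%:M : MC 1) -> cdiff (fun t => g t%:M) z.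
Proof.
move=> hg; suff : holo (V := C^o) (fun t => g (sym_part (t%:M : MC 1))) z.
  have -> : (fun t : C => g (sym_part t%:M)) = (fun t => g t%:M).
    by apply/funext => t; rewrite sym_partK// tr_scalar_mx.
  by case.
apply: (@holo_affine R C^o (MC 1) (fun t => t%:M) (fun t => t%:M) 1
  (fun w : MC 1 => g (sym_part w))).
- by move=> a u v; rewrite raddfD/= -scale_scalar_mx.
- move=> h; rewrite mul1r; apply: rnorm_mx_le; first exact: rnorm_ge0.
  by move=> i j; rewrite !ord1 mxE eqxx mulr1n rnormc.
- by move=> h; rewrite raddfD.
exact: hg.
Qed.

Lemma taylor_mcoeff_form (n r : nat) (k : int) (f : 'M[C]_(1 + n.+1) -> C^o)
    (m : multinom n.+1) (t2 : 'M[C]_n.+1) :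
  holomorphic_siegel f ->
  (forall M tau, symplectic M -> siegel tau ->
    f (siegel_act M tau) = det_rep k (autom_factor M tau) (f tau)) ->
  (forall i : nat, (i < r)%N -> forall tau1 tau2,
    siegel tau1 -> siegel tau2 -> taylor_part i f tau1 tau2 = 0) ->
  siegel t2 ->
  siegel_form (det_rep (k + r%:Z)) (fun t1 => mcoeff m (taylor_poly r f t1 t2) : C^o).
Proof.
move=> hol ftr hlow h2.
have law : forall M tau, symplectic M -> siegel tau ->
    mcoeff m (taylor_poly r f (siegel_act M tau) t2) =
    det_rep (k + r%:Z) (autom_factor M tau) (mcoeff m (taylor_poly r f tau t2)).
  by move=> M tau sM st; rewrite (taylor_poly_left hol ftr hlow sM st h2) mcoeffZ.
have hc tau : siegel tau ->
    holo (fun w : MC 1 => mcoeff m (taylor_poly r f (sym_part w) t2)) tau.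
  move=> st; have -> : (fun w : MC 1 => mcoeff m (taylor_poly r f (sym_part w) t2)) =
      (fun w => (mdeg m == r)%:R * taylor_coeff f m (sym_part w) t2).
    apply/funext => w; rewrite mcoeff_taylor_poly.
    by case: (mdeg m == r); rewrite ?mul1r ?mul0r.
  by apply: holoM; [exact: holo_cst|exact: holo_taylor_coeff1].
split=> //.
  apply: (holomorphic_siegel_comb (I := unit) (s := [:: tt]) (P := xpredT)
    (c := fun _ t1 => mcoeff m (taylor_poly r f t1 t2)) (v := fun=> 1 : C^o)).
    by move=> _ tau st; exact: hc.
  by move=> tau _; rewrite big_seq1 -[RHS]/(_ * 1) mulr1.
move=> _; apply: holomorphic_at_infinity_bounded.
- by move=> z z0; apply: (cdiff_scalar (g := fun t1 => mcoeff m (taylor_poly r f t1 t2))); apply: hc; exact: siegel1.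
- move=> z z0; have := @form_translation R 1 (k + r%:Z)
    (fun t1 => mcoeff m (taylor_poly r f t1 t2)) law 1%:M z%:M (trmx1 _ _) (siegel1 z0).
  by rewrite /intC map_mx1 -raddfD.
have [B [T HB]] := koecher_bound h2 hol ftr.
have bf : cusp_bounded t2 (symmetrized f).
  exists 1, B, T; split=> // t1 z tT z1; have [s0 b0] := HB t1 z tT z1.
  by rewrite symmetrized_block; [split=> //; exact: siegel_sym_siegel|exact: h2.1].
have [B' [T' HB']] := taylor_coeff_bounded m h2 hol bf.
exists `|B'|, T' => z zT; rewrite mcoeff_taylor_poly.
case: (mdeg m == r); last by rewrite normc_0.
exact: le_trans (HB' z zT) (ler_norm _).
Qed.

Lemma siegel_form_comb (g : nat) (k : int) (I : Type) (s : seq I) (c : I -> C)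
    (h : I -> 'M[C]_g -> C^o) :
  (forall i, siegel_form (det_rep k) (h i)) ->
  siegel_form (det_rep k) (fun t => \sum_(i <- s) c i * h i t : C^o).
Proof.
move=> hf; split.
- apply: (holomorphic_siegel_comb (s := s) (P := xpredT) (c := fun i t => c i * h i t)
    (v := fun=> 1 : C^o)).
    move=> i tau st; apply: holoM; first exact: holo_cst.
    have [hol _ _] := hf i.
    by apply: holo_scalar_coordinate => j; split; exact: hol.
  by move=> tau _; apply: eq_bigr => i _; rewrite -[RHS]/(_ * 1) mulr1.
- move=> M tau sM st; rewrite /det_rep -[RHS]/(_ * _) mulr_sumr; apply: eq_bigr => i _.
  by have [_ -> // _] := hf i; rewrite mulrCA.
move=> g1; have /choice[F hF] i : exists F : C -> C, (forall q, normc q < 1 -> cdiff F q) /\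
    (forall z, 0 < complex.Im z -> h i z%:M = F (nome z)).
  by have [_ _ /(_ g1)/expansion_at_infinity] := hf i.
exists (fun q => \sum_(i <- s) c i * F i q); split=> [q q1 j|z z0]; last first.
  by apply: eq_bigr => i _; rewrite (hF i).2.
have -> : (fun x : C^o => coordinate j (\sum_(i <- s) c i * F i x : C^o)) =
   (fun x : C^o => (\sum_(i <- s) c i * F i x) * coordinate j (1 : C^o)).
  by apply/funext => x; rewrite coordinate_scalar.
apply: cdiffW; apply: cdiffM; last exact: cdiff_cst.
apply: cdiff_sum => i; apply: cdiffM; first exact: cdiff_cst.
by apply: (hF i).1; rewrite -ltcR.
Qed.

End CoefficientForms.

(** * Exchange of the variables in degree two *)

Section Swap.
Context {R : realType}.
Local Notation C := R[i].
Local Notation MC g := ('M[C]_g : normedModType C).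

(** The exchange law holds on the Siegel space only; derivatives are compared from equality on an
    open set. *)
Lemma partial_eq (n : nat) (O : set 'rV[C]_n) (m : multinom n) (F G : 'rV[C]_n -> C^o) :
  open (O : set ('rV[C]_n : normedModType C)) -> (forall z, O z -> F z = G z) ->
  forall z, O z -> partial m F z = partial m G z.
Proof.
move=> Oo; rewrite /partial; elim: (enum 'I_n) F G => [//|b s IH] F G FG /=.
elim: (m b) => [|l IHl] z Oz; first exact: IH.
rewrite !iterS; exact: (@dirderiv_eq R ('rV[C]_n : normedModType C) O (delta_mx 0 b) _ _ Oo IHl).
Qed.

Lemma open_block (n : nat) (t1 : 'M[C]_1) (t2 : 'M[C]_n) :
  open ([set z | sym_siegel (block_tau t1 z t2)] : set ('rV[C]_n : normedModType C)).
Proof.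
apply: (@open_comp ('rV[C]_n : normedModType C) (MC (1 + n)) (fun z => block_tau t1 z t2)
  (@sym_siegel R (1 + n))); last exact: open_sym_siegel.
move=> z _; apply: differentiable_continuous.
apply: (@differentiable_affine R _ (MC (1 + n)) _ (@zdir R n) 1).
- exact: linear_zdir.
- exact: rnorm_zdir.
- by move=> h; rewrite block_tauD.
Qed.

Section SwapForm.
Variables (r : nat) (k : int) (f : 'M[C]_(1 + 1) -> C^o).
Hypothesis hf : siegel_form (det_rep k) f.
Hypothesis hlow : forall i : nat, (i < r)%N -> forall tau1 tau2,
  siegel tau1 -> siegel tau2 -> taylor_part i f tau1 tau2 = 0.

Let U : 'M[int]_(1 + 1) := block_mx 0 1%:M 1%:M 0.
Let c : C := (\det (intC U : 'M[C]_(1 + 1))) ^ k.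
(** [f] up to the sign [c], written as a one-term sum to be an instance of [siegel_form_comb]. *)
Let f' : 'M[C]_(1 + 1) -> C^o := fun t => \sum_(i <- [:: tt]) c * f t.

Let hf' : siegel_form (det_rep k) f'.
Proof. exact: (@siegel_form_comb R _ k unit [:: tt] (fun=> c) (fun=> f)). Qed.

Lemma swap_block (t1 t2 z : 'M[C]_1) : siegel (block_tau t1 z t2) ->
  f (block_tau t2 z t1) = f' (block_tau t1 z t2).
Proof.
move=> s; rewrite /f' big_seq1; have [_ ftr _] := hf.
have UU : U^T *m U = 1%:M.
  rewrite /U tr_block_mx !trmx1 !trmx0 mulmx_block ?mul1mx ?mul0mx ?mulmx1 ?mulmx0 ?addr0 ?add0r.
  by rewrite -scalar_mx_block.
rewrite -(form_unimodular ftr UU s); congr f.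
have zT : z^T = z by apply/matrixP => i j; rewrite !ord1 mxE.
rewrite /intC /U map_block_mx !map_mx1 !map_mx0 /block_tau tr_block_mx !trmx1 !trmx0.
by rewrite !mulmx_block ?mul1mx ?mul0mx ?mulmx1 ?mulmx0 ?addr0 ?add0r zT.
Qed.

Lemma swap_taylor_coeff m (t1 t2 : 'M[C]_1) : siegel t1 -> siegel t2 ->
  taylor_coeff f m t1 t2 = taylor_coeff f' m t2 t1.
Proof.
move=> h1 h2; rewrite /taylor_coeff; congr (_ * _).
apply: (partial_eq m (@open_block 1 t2 t1)); last first.
  exact/siegel_sym_siegel/siegel_gen_block0.
by move=> z sz; apply: swap_block; exact: sym_siegel_block h1.1 sz.
Qed.

Lemma swap_taylor_poly i (t1 t2 : 'M[C]_1) : siegel t1 -> siegel t2 ->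
  taylor_poly i f t1 t2 = taylor_poly i f' t2 t1.
Proof.
by move=> h1 h2; rewrite /taylor_poly; apply: eq_bigr => m _; rewrite swap_taylor_coeff.
Qed.

Lemma taylor_part_infinity (t1 : 'M[C]_1) : siegel t1 ->
  holomorphic_at_infinity (taylor_part r f t1 : 'M[C]_1 -> dhomog 1 C r).
Proof.
move=> h1; have [hol' ftr' _] := hf'.
have hlow' i : (i < r)%N -> forall tau1 tau2,
    siegel tau1 -> siegel tau2 -> taylor_part i f' tau1 tau2 = 0.
  move=> ir a b ha hb; apply: val_inj; rewrite /= -swap_taylor_poly//.
  by have /(congr1 val) := hlow ir hb ha.
have /choice[F hF] (m : bmultinom 1 r.+1) : exists F : C -> C,
    (forall q, normc q < 1 -> cdiff F q) /\
    (forall z, 0 < complex.Im z -> mcoeff m (taylor_poly r f' z%:M t1) = F (nome z)).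
  by have [_ _ /(_ erefl)/expansion_at_infinity] := taylor_mcoeff_form m hol' ftr' hlow' h1.
pose v (m : bmultinom 1 r.+1) : dhomog 1 C r := insubd (0 : dhomog 1 C r) (mpolyX C m).
exists (fun q => \sum_(m : bmultinom 1 r.+1 | mdeg m == r) F m q *: v m).
split=> [q q1 j|z z0]; last first.
  rewrite taylor_part_comb; apply: eq_bigr => m mr; congr (_ *: _).
  by rewrite swap_taylor_coeff//; [rewrite -(hF m).2// mcoeff_taylor_poly mr|exact: siegel1].
have -> : (fun x : C^o => coordinate j (\sum_(m : bmultinom 1 r.+1 | mdeg m == r) F m x *: v m)) =
   (fun x : C^o => \sum_(m <- [seq m : bmultinom 1 r.+1 <- index_enum (bmultinom 1 r.+1) | mdeg m == r])
       F m x * coordinate j (v m)).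
  apply/funext => x; rewrite /coordinate linear_sum/= big_filter.
  by apply: eq_bigr => m _; rewrite linearZ.
apply: cdiffW; apply: cdiff_sum => m; apply: cdiffM; last exact: cdiff_cst.
by apply: (hF m).1; rewrite -ltcR.
Qed.

End SwapForm.

Lemma taylor_part_form (n r : nat) (k : int) (f : 'M[C]_(1 + n.+1) -> C^o) t1 :
  siegel_form (det_rep k) f ->
  (forall i : nat, (i < r)%N -> forall tau1 tau2,
    siegel tau1 -> siegel tau2 -> taylor_part i f tau1 tau2 = 0) ->
  siegel t1 -> siegel_form (@sym_det_rep R n.+1 r k) (taylor_part r f t1).
Proof.
move=> hf hlow h1; have [hol ftr _] := hf; split.
- exact: holomorphic_taylor_part.
- move=> M t2 sM h2; apply: val_inj; rewrite /= (taylor_poly_right hol ftr hlow sM h1 h2).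
  by [].
(* The condition at infinity concerns the second factor only when its degree [n.+1] is 1. *)
move=> [n0]; subst n; exact: (taylor_part_infinity hf hlow h1).
Qed.

End Swap.

(** * Separation of the variables *)

Section SeparatedKernel.
Variables (K : fieldType) (A B : Type) (P : A -> Prop) (Q : B -> Prop) (F : A -> B -> K).

Let gram (N : nat) (x : 'I_N -> A) (y : 'I_N -> B) : 'M[K]_N := \matrix_(i, j) F (x i) (y j).

Let nonsingular (N : nat) := exists x y,
  [/\ forall i : 'I_N, P (x i), forall j : 'I_N, Q (y j) & \det (gram x y) != 0].

(* The Schur complement of a maximal nonsingular minor vanishes. *)
Lemma separated_kernel (d : nat) :
  (forall (N : nat) (x : 'I_N -> A) (y : 'I_N -> B), (forall i, P (x i)) ->
    (forall j, Q (y j)) -> \det (\matrix_(i, j) F (x i) (y j)) != 0 -> (N <= d)%N) ->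
  exists (N : nat) (x : 'I_N -> A) (y : 'I_N -> B) (B' : 'M[K]_N),
  [/\ forall i, P (x i), forall j, Q (y j),
    (\matrix_(i, j) F (x i) (y j)) *m B' = 1%:M &
    forall a b, P a -> Q b -> F a b = \sum_i (\sum_j B' j i * F a (y j)) * F (x i) b].
Proof.
move=> bounded.
(* The empty minor has determinant 1 and nonsingular minors have size at most [d], so the property
   fails at some successor. *)
have [N [nsN maxN]] : exists N, nonsingular N /\ ~ nonsingular N.+1.
  apply: contrapT => no; have ns N : nonsingular N.
    elim: N => [|N IH].
      have x0 : 'I_0 -> A by case.
      have y0 : 'I_0 -> B by case.
      by exists x0, y0; split=> [[]|[]|] //; rewrite det_mx00 oner_eq0.
    by apply: contrapT => nN; apply: no; exists N.
  have [x [y [px qy dxy]]] := ns d.+1.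
  by have := bounded d.+1 x y px qy dxy; rewrite ltnn.
have [x [y [px qy dM]]] := nsN; set M := gram x y in dM.
have MU : M \in unitmx by rewrite unitmxE unitfE.
exists N, x, y, (invmx M); split=> //; first exact: mulmxV.
move=> a b pa qb.
pose rw : 'rV[K]_N := \row_j F a (y j); pose cl : 'cV[K]_N := \col_i F (x i) b.
(* Bordering the maximal minor by [a] and [b] gives a singular matrix. *)
pose x' (i : 'I_(N + 1)) := if fintype.split i is inl i' then x i' else a.
pose y' (j : 'I_(N + 1)) := if fintype.split j is inl j' then y j' else b.
have G' : gram x' y' = block_mx M cl rw (F a b)%:M.
  apply/matrixP => i j; rewrite -(splitK i) -(splitK j) mxE /x' /y' !unsplitK.
  case: (fintype.split i) => i'; case: (fintype.split j) => j' /=.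
  - by rewrite block_mxEul mxE.
  - by rewrite block_mxEur mxE.
  - by rewrite block_mxEdl mxE.
  - by rewrite block_mxEdr !ord1 mxE eqxx mulr1n.
have d0 : \det (gram x' y') = 0.
  apply: contrapT => /eqP dn; apply: maxN; rewrite -addn1.
  exists x', y'; split=> // i; rewrite /x' /y'; case: (fintype.split i) => //.
have LU : block_mx M cl rw (F a b)%:M =
    block_mx 1%:M 0 (rw *m invmx M) 1%:M *m
    block_mx M cl 0 ((F a b)%:M - rw *m invmx M *m cl).
  rewrite mulmx_block ?mul1mx ?mul0mx ?addr0 ?mulmx0 ?addr0 mulmxKV//.
  by rewrite addrC subrK.
move: d0; rewrite G' LU det_mulmx det_lblock det_ublock !det1 !mul1r => /eqP.
rewrite mulf_eq0 (negbTE dM)/= det_mx11 => /eqP.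
rewrite mxE [(_%:M : 'M[K]_1) 0 0]mxE eqxx mulr1n [(- _ : 'M[K]_1) 0 0]mxE => /subr0_eq ->.
rewrite mxE; apply: eq_bigr => i _; rewrite [cl i 0]mxE mxE; congr (_ * _).
by apply: eq_bigr => j _; rewrite [rw 0 j]mxE mulrC.
Qed.

End SeparatedKernel.

Theorem proposition2p1 (R : realType) (n r : nat) (k : int)
    (f : 'M[R[i]]_(1 + n.+1) -> R[i]^o)
    (hf : siegel_form (det_rep k) f)
    (hlow : forall i : nat, (i < r)%N -> forall tau1 tau2,
       siegel tau1 -> siegel tau2 -> taylor_part i f tau1 tau2 = 0)
    (hr : exists tau1 tau2,
       [/\ siegel tau1, siegel tau2 & taylor_part r f tau1 tau2 <> 0]) :
  nonzero_tensor (siegel_form (det_rep (k + r%:Z)))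
    (siegel_form (@sym_det_rep R n.+1 r k)) (taylor_part r f).
Proof.
have [hol ftr _] := hf; pose kr : int := k + r%:Z.
pose F (t1 : 'M[R[i]]_1) (b : 'M[R[i]]_n.+1 * multinom n.+1) : R[i] :=
  mcoeff b.2 (taylor_poly r f t1 b.1).
have Fform b : siegel b.1 -> siegel_form (det_rep (k + r%:Z)) (fun t1 => F t1 b : R[i]^o).
  by move=> hb; exact: taylor_mcoeff_form.
have [|N [x [y [B [hx hy MB FE]]]]] := @separated_kernel R[i] _ _ (@siegel R 1)
  (fun b => @siegel R n.+1 b.1) F (`|kr|%N + 2).
  move=> N x y hx hy; rewrite leqNgt; apply: contra => dN.
  (* The columns of a minor are values of forms of weight k + r in tau'; a linear relation among
     these forms makes the minor singular. *)
  have [c c0 hc] := forms_dependent dN (fun i => Fform (y i) (hy i)).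
  rewrite -det_tr; apply/det0P; exists c => //.
  apply/matrixP => i j; rewrite ord1 !mxE -[RHS](hc (x j) (hx j)).
  by apply: eq_bigr => l _; rewrite !mxE.
have MU : \matrix_(i, j) F (x i) (y j) \in unitmx by have [] := mulmx1_unit MB.
exists N, (fun i t1 => \sum_j B j i * F t1 (y j) : R[i]^o), (fun i => taylor_part r f (x i)).
have tE t1 t2 : siegel t1 -> siegel t2 -> taylor_part r f t1 t2 =
    \sum_(i < N) (\sum_j B j i * F t1 (y j)) *: taylor_part r f (x i) t2.
  move=> h1 h2; apply: val_inj; rewrite [RHS]raddf_sum; apply/mpolyP => m.
  rewrite -[LHS]/(F t1 (t2, m)) FE// [RHS]raddf_sum; apply: eq_bigr => i _.
  by rewrite -mcoeffZ.
split=> //.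
- rewrite lt0n; apply/negP => /eqP N0; have [t1 [t2 [h1 h2]]] := hr.
  by apply; rewrite tE// big1// => i; have := ltn_ord i; rewrite [X in (_ < X)%N]N0.
- move=> i; split; last exact: taylor_part_form.
  by apply: siegel_form_comb => j; exact: Fform.
- move=> c hc l; rewrite -[RHS](hc (x l) (hx l)).
  (* [B] is inverse to the minor, so the i-th first factor takes the value 1 at [x i] and 0 at the
     other chosen points; evaluating a relation at [x l] isolates its l-th coefficient. *)
  have V i : \sum_j B j i * F (x l) (y j) = (l == i)%:R.
    have := congr1 (fun M : 'M[R[i]]_N => M l i) MB; rewrite !mxE => <-.
    by apply: eq_bigr => j _; rewrite mxE mulrC.
  under [RHS]eq_bigr do rewrite V -[_ *: _]/(_ * _).
  rewrite (bigD1 l)//= eqxx mulr1 big1 ?addr0// => i il.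
  by rewrite eq_sym (negbTE il) mulr0.
move=> c hc; pose cv : 'rV[R[i]]_N := \row_i c i.
(* Each [y j] is a point together with a monomial: the coefficient of that monomial, at that point,
   of a relation among the second factors is one entry of this product. *)
have : cv *m \matrix_(i, j) F (x i) (y j) = 0.
  apply/matrixP => i0 j; rewrite !mxE.
  have /(congr1 val) := hc (y j).1 (hy j); rewrite raddf_sum/= => /(congr1 (mcoeff (y j).2)).
  rewrite mcoeff0 raddf_sum/= => E; rewrite -[RHS]E; apply: eq_bigr => i _.
  by rewrite !mxE -mcoeffZ.
move=> /(congr1 (mulmxr (invmx (\matrix_(i, j) F (x i) (y j))))) /=.
rewrite mulmxK// mul0mx => /matrixP c0 i.
by have := c0 0 i; rewrite !mxE.
Qed.
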